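(* There exists a complete flat front $f\colon M=\mathbb{C}\setminus\{0,1,-2,-3/2\}\to\mathcal{H}^3$ whose hyperbolic Gauss maps are $$(G,G_* )=\left(z^3,\ \frac{z(z+6)}{2z+5}\right).$$ In particular, the totally ramified value numbers of $G$ and $G_*$ on $M$ are $\nu_G=2$ and $\nu_{G_*}=1$, and all ends of $f$ (the points $0,1,-2,-3/2,\infty$ of $\mathbb{C}\cup\{\infty\}$) are regular and embedded.
   Context: Hyperbolic space: identify Lorentz-Minkowski space $\mathbb{R}^4_1$ (metric $-x_0y_0+x_1y_1+x_2y_2+x_3y_3$) with the $2\times2$ Hermitian matrices via $(x_0,x_1,x_2,x_3)\leftrightarrow\begin{pmatrix}x_0+x_3& x_1+ix_2\\ x_1-ix_2& x_0-x_3\end{pmatrix}$; then $\mathcal{H}^3=\{aa^*: a\in SL(2,\mathbb{C})\}$, where $a^*={}^t\bar a$, with the induced metric of constant curvature $-1$. Flat fronts: let $M$ be a connected oriented $2$-manifold. A smooth map $f\colon M\to\mathcal{H}^3$ is a front if there is a unit vector field $n$ along $f$ with $\langle df,n\rangle=0$ such that $(f,n)\colon M\to T_1\mathcal{H}^3$ is an immersion. Its parallel fronts are $f_t=(\cosh t)f+(\sinh t)n$, $t\in\mathbb{R}$. A front $f$ is a flat front if for each $p\in M$ there is $t\in\mathbb{R}$ such that $f_t$ is a flat immersion at $p$. For a flat front there is a unique complex structure on $M$, always used on $M$ (here it is the standard one on $\mathbb{C}\setminus\{0,1,-2,-3/2\}$, with coordinate $z$), and a holomorphic immersion $\mathcal{E}=(E_{ij})\colon\widetilde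 M\to SL(2,\mathbb{C})$ on the universal cover $\widetilde{M}$ such that $\mathcal{E}^{-1}d\mathcal{E}$ is off-diagonal, $f=\mathcal{E}\mathcal{E}^*$ and $n=\mathcal{E}e_3\mathcal{E}^*$ with $e_3=\mathrm{diag}(1,-1)$. The hyperbolic Gauss maps $G=E_{11}/E_{21}$ and $G_*=E_{12}/E_{22}$ are well-defined holomorphic maps $M\to\mathbb{C}\cup\{\infty\}$. Completeness: with $ds^2=\langle df,df\rangle$ (degenerate at singular points of $f$), the front $f$ is complete if there is a symmetric $2$-tensor $T$ on $M$ vanishing outside a compact subset of $M$ such that $ds^2+T$ is a complete Riemannian metric on $M$. If $f$ is a complete flat front, $M$ is biholomorphic to a closed Riemann surface $\overline{M}$ minus finitely many points, called the ends of $f$. Ends: an end $p$ of a complete flat front is regular if $G$ extends meromorphically across $p$ (equivalently, $G_*$ does; equivalently, the Hopf differential $Q=\omega\theta$, where $\mathcal{E}^{-1}d\mathcal{E}=\begin{pmatrix}0&\theta\\ \omega&0\end{pmatrix}$, has at most a pole of order $2$ at $p$). An end $p$ is embedded if there is a neighborhood $U$ of $p$ in $\overline{M}$ such that $f|_{U\setminus\{p\}}$ is an embedding. Totally ramified value number: let $h\colon M\to\mathbb{C}\cup\{\infty\}$ be a nonconstant meromorphic function on a Riemann surface $M$. A value $b\in\mathbb{C}\cup\{\infty\}$ is a totally ramified value of $h$ if $h$ branches (has multiplicity at least $2$) at every point of $h^{-1}(b)$; omitted (exceptional) values, i.e. values with $h^{-1}(b)=\emptyset$, are included. Let $a_1,\ldots,a_{r_0}$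 be the exceptional values and $b_1,\ldots,b_{l_0}$ the other totally ramified values, and let $\nu_j\ge2$ be the minimum of the multiplicities of $h$ at the points of $h^{-1}(b_j)$. Then $\nu_h:=r_0+\sum_{j=1}^{l_0}\left(1-\frac1{\nu_j}\right)$. *)

(* Defs.v *)
From Stdlib Require Export Reals List.
From Coquelicot Require Export Coquelicot.

Open Scope R_scope.

(** * Complex 2x2 matrices, Lorentz-Minkowski space and hyperbolic space *)

Definition Mat : Type := @matrix C 2 2.

Definition entry (A : Mat) (i j : nat) : C := coeff_mat (RtoC 0) A i j.

Definition mmul (A B : Mat) : Mat := @Mmult C_Ring 2 2 2 A B.

Definition adjoint (A : Mat) : Mat :=
  mk_matrix 2 2 (fun i j => Cconj (entry A j i)).

Definition mdet (A : Mat) : C :=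
  (entry A 0 0 * entry A 1 1 - entry A 0 1 * entry A 1 0)%C.

Definition minv (A : Mat) : Mat :=
  [[ (entry A 1 1 / mdet A)%C, (- entry A 0 1 / mdet A)%C ],
   [ (- entry A 1 0 / mdet A)%C, (entry A 0 0 / mdet A)%C ]].

Definition e3 : Mat := [[ RtoC 1, RtoC 0 ], [ RtoC 0, RtoC (-1) ]].

Inductive lidx : Set := t0 | t1 | t2 | t3.

Definition L4 : Type := lidx -> R.

Definition lorentz (v w : L4) : R :=
  - (v t0 * w t0) + v t1 * w t1 + v t2 * w t2 + v t3 * w t3.

Definition herm (v : L4) : Mat :=
  [[ RtoC (v t0 + v t3), (v t1, v t2) : C ],
   [ (v t1, - v t2) : C, RtoC (v t0 - v t3) ]].

Definition in_H3 (v : L4) : Prop :=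
  exists a : Mat, mdet a = RtoC 1 /\ herm v = mmul a (adjoint a).

(** * Differential calculus on open subsets of C = R x R *)

Inductive dir : Set := dx | dy.

Definition sum_dir (F : dir -> R) : R := F dx + F dy.

Definition slice (d : dir) (u : C -> R) (z : C) : R -> R :=
  match d with
  | dx => fun s => u (s, snd z)
  | dy => fun s => u (fst z, s)
  end.

Definition coord (d : dir) (z : C) : R :=
  match d with dx => fst z | dy => snd z end.

Definition ex_pd (d : dir) (u : C -> R) (z : C) : Prop :=
  ex_derive (slice d u z) (coord d z).

Definition pd (d : dir) (u : C -> R) (z : C) : R :=
  Derive (slice d u z) (coord d z).

Fixpoint pds (l : list dir) (u : C -> R) : C -> R :=
  match l with
  | nil => u
  | d :: l' => pd d (pds l' u)
  end.

Definition smooth_on (U : C -> Prop) (u : C -> R) : Prop :=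
  forall (l : list dir) (z : C), U z ->
    continuous (pds l u) z /\ forall d, ex_pd d (pds l u) z.

Definition smooth_map (U : C -> Prop) (f : C -> L4) : Prop :=
  forall mu, smooth_on U (fun z => f z mu).

Definition dmap (d : dir) (f : C -> L4) (z : C) : L4 :=
  fun mu => pd d (fun w => f w mu) z.

Definition immersed_at (f : C -> L4) (z : C) : Prop :=
  forall a b : R,
    (forall mu, a * dmap dx f z mu + b * dmap dy f z mu = 0) ->
    a = 0 /\ b = 0.

(** * Symmetric 2-tensors, Gaussian curvature and completeness *)

(* [g i j z] is the coefficient of the tensor on the coordinate fields
   d/dx, d/dy at [z]. *)
Definition tensor2 : Type := dir -> dir -> C -> R.

Definition symmetric_tensor (M : C -> Prop) (g : tensor2) : Prop :=
  (forall i j, smooth_on M (g i j)) /\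
  (forall i j z, M z -> g i j z = g j i z).

Definition tensor_add (g h : tensor2) : tensor2 :=
  fun i j z => g i j z + h i j z.

Definition quad (g : tensor2) (z : C) (v : dir -> R) : R :=
  sum_dir (fun i => sum_dir (fun j => g i j z * v i * v j)).

Definition riemannian (M : C -> Prop) (g : tensor2) : Prop :=
  symmetric_tensor M g /\
  forall z v, M z -> (exists i, v i <> 0) -> 0 < quad g z v.

Definition induced (f : C -> L4) : tensor2 :=
  fun i j z => lorentz (dmap i f z) (dmap j f z).

Definition gdet (g : tensor2) (z : C) : R :=
  g dx dx z * g dy dy z - g dx dy z * g dy dx z.

Definition ginv (g : tensor2) (k l : dir) (z : C) : R :=
  match k, l with
  | dx, dx => g dy dy z / gdet g z
  | dy, dy => g dx dx z / gdet g z
  | dx, dy => - g dx dy z / gdet g z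
  | dy, dx => - g dy dx z / gdet g z
  end.

(* Gamma^k_{ij} *)
Definition christoffel (g : tensor2) (k i j : dir) (z : C) : R :=
  / 2 * sum_dir (fun l => ginv g k l z *
     (pd i (g j l) z + pd j (g i l) z - pd l (g i j) z)).

(* R^l_{kij}, with the convention R(d_i, d_j) d_k = sum_l R^l_{kij} d_l *)
Definition riemann (g : tensor2) (l k i j : dir) (z : C) : R :=
  pd i (christoffel g l j k) z - pd j (christoffel g l i k) z
  + sum_dir (fun m => christoffel g l i m z * christoffel g m j k z
                      - christoffel g l j m z * christoffel g m i k z).

(* <R(d_x, d_y) d_y, d_x> / det g *)
Definition gauss_curvature (g : tensor2) (z : C) : R :=
  sum_dir (fun l => g dx l z * riemann g l dy dx dy z) / gdet g z.

Definition unit_interval (t : R) : Prop := 0 <= t <= 1.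

Definition velocity (c : R -> C) (t : R) (d : dir) : R :=
  Derive (fun s => coord d (c s)) t.

Definition C1_curve (M : C -> Prop) (p q : C) (c : R -> C) : Prop :=
  c 0 = p /\ c 1 = q /\
  forall t, unit_interval t ->
    M (c t) /\
    forall d, ex_derive (fun s => coord d (c s)) t /\
              continuous (fun s => velocity c s d) t.

Definition curve_length (g : tensor2) (c : R -> C) : R :=
  RInt (fun t => sqrt (quad g (c t) (velocity c t))) 0 1.

(* C^1 curves are not required to be regular, so piecewise C^1 curves can be
   reparametrized as C^1 ones and give the same infimum. *)
Definition riem_dist (M : C -> Prop) (g : tensor2) (p q : C) : Rbar :=
  Glb_Rbar (fun L => exists c, C1_curve M p q c /\ L = curve_length g c).

Definition complete_metric (M : C -> Prop) (g : tensor2) : Prop :=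
  riemannian M g /\
  forall s : nat -> C,
    (forall k, M (s k)) ->
    (forall eps : posreal, exists N : nat, forall m n : nat,
        (N <= m)%nat -> (N <= n)%nat ->
        Rbar_lt (riem_dist M g (s m) (s n)) (Finite eps)) ->
    exists q, M q /\
      forall eps : posreal, exists N : nat, forall n : nat,
        (N <= n)%nat -> Rbar_lt (riem_dist M g (s n) q) (Finite eps).

Definition compact_set {T : UniformSpace} (K : T -> Prop) : Prop :=
  forall F : (T -> Prop) -> Prop,
    (forall O, F O -> open O) ->
    (forall x, K x -> exists O, F O /\ O x) ->
    exists l : list (T -> Prop),
      (forall O, In O l -> F O) /\ (forall x, K x -> exists O, In O l /\ O x).

(** * Flat fronts; [M] is an open connected subset of C *)

Definition is_front (M : C -> Prop) (f n : C -> L4) : Prop :=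
  smooth_map M f /\ smooth_map M n /\
  forall z, M z ->
    in_H3 (f z) /\
    lorentz (f z) (n z) = 0 /\
    lorentz (n z) (n z) = 1 /\
    (forall d, lorentz (dmap d f z) (n z) = 0) /\
    (forall a b : R,
      (forall mu, a * dmap dx f z mu + b * dmap dy f z mu = 0) ->
      (forall mu, a * dmap dx n z mu + b * dmap dy n z mu = 0) ->
      a = 0 /\ b = 0).

Definition parallel (f n : C -> L4) (t : R) : C -> L4 :=
  fun z mu => cosh t * f z mu + sinh t * n z mu.

Definition flat_immersion_at (M : C -> Prop) (h : C -> L4) (p : C) : Prop :=
  locally p (fun z => M z /\ immersed_at h z /\
                      gauss_curvature (induced h) z = 0).

Definition is_flat_front (M : C -> Prop) (f n : C -> L4) : Prop :=
  is_front M f n /\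
  forall p, M p -> exists t : R, flat_immersion_at M (parallel f n t) p.

Definition complete_front (M : C -> Prop) (f : C -> L4) : Prop :=
  exists (T : tensor2) (K : C -> Prop),
    symmetric_tensor M T /\
    compact_set K /\ (forall z, K z -> M z) /\
    (forall i j z, M z -> ~ K z -> T i j z = 0) /\
    complete_metric M (tensor_add (induced f) T).

(** * The Riemann sphere; [None] is the point at infinity *)

Definition Chat : Type := option C.

(* a / b as a point of the sphere, for (a, b) <> (0, 0) *)
Definition hat_div (a b : C) : Chat :=
  if Ceq_dec b (RtoC 0) then None else Some (a / b)%C.

Definition holo_at (h : C -> C) (z : C) : Prop :=
  locally z (fun w => exists l : C, is_derive h w l).

Definition sphere_holo_at (h : C -> Chat) (z : C) : Prop :=
  exists u : C -> C, holo_at u z /\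
    (locally z (fun w => h w = Some (u w)) \/
     locally z (fun w => h w = hat_div (RtoC 1) (u w))).

(** * The universal cover and the hyperbolic Gauss maps *)

Definition path_from (M : C -> Prop) (p0 : C) (c : R -> C) : Prop :=
  c 0 = p0 /\ continuous_on unit_interval c /\
  forall t, unit_interval t -> M (c t).

Definition homotopic (M : C -> Prop) (c c' : R -> C) : Prop :=
  exists H : R * R -> C,
    continuous_on (fun st => unit_interval (fst st) /\ unit_interval (snd st)) H
    /\ forall s t, unit_interval s -> unit_interval t ->
         M (H (s, t)) /\
         H (0, t) = c t /\ H (1, t) = c' t /\
         H (s, 0) = c 0 /\ H (s, 1) = c 1.

Definition extend_path (c : R -> C) (w : C) : R -> C :=
  fun t => if Rle_dec t (1 / 2) then c (2 * t)
           else (c 1 + RtoC (2 * t - 1) * (w - c 1))%C.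

(* The universal cover of M is the set of homotopy classes, relative to the
   endpoints, of paths c in M from a base point p0, with projection c |-> c 1;
   a map on it is a map on such paths that respects homotopy.  The local
   section of the projection near c 1 through the class of c is
   w |-> [extend_path c w], so the derivative of E at [c] in the coordinate z
   is the derivative of w |-> E (extend_path c w) at c 1. *)
Definition holomorphic_lift (M : C -> Prop) (p0 : C) (f n : C -> L4)
    (E : (R -> C) -> Mat) : Prop :=
  (forall c c', path_from M p0 c -> path_from M p0 c' ->
     homotopic M c c' -> E c = E c') /\
  (forall c, path_from M p0 c ->
     mdet (E c) = RtoC 1 /\
     herm (f (c 1)) = mmul (E c) (adjoint (E c)) /\
     herm (n (c 1)) = mmul (mmul (E c) e3) (adjoint (E c)) /\
     exists E' : Mat,
       (forall i j : nat, (i < 2)%nat -> (j < 2)%nat ->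
          is_derive (fun w : C => entry (E (extend_path c w)) i j)
                    (c 1) (entry E' i j)) /\
       (exists i j : nat, entry E' i j <> RtoC 0) /\
       entry (mmul (minv (E c)) E') 0 0 = RtoC 0 /\
       entry (mmul (minv (E c)) E') 1 1 = RtoC 0).

Definition hyperbolic_gauss_maps (M : C -> Prop) (f n : C -> L4)
    (G Gs : C -> Chat) : Prop :=
  forall p0, M p0 ->
    exists E, holomorphic_lift M p0 f n E /\
      forall c, path_from M p0 c ->
        G (c 1) = hat_div (entry (E c) 0 0) (entry (E c) 1 0) /\
        Gs (c 1) = hat_div (entry (E c) 0 1) (entry (E c) 1 1).

(** * Totally ramified value number *)

Definition multiplicity (h : C -> Chat) (z : C) (m : nat) : Prop :=
  (1 <= m)%nat /\
  exists u : C -> C, holo_at u z /\ u z <> RtoC 0 /\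
    match h z with
    | Some b => locally z (fun w => h w = Some (b + (w - z) ^ m * u w)%C)
    | None => locally z (fun w => h w = hat_div (RtoC 1) ((w - z) ^ m * u w)%C)
    end.

Definition exceptional (M : C -> Prop) (h : C -> Chat) (b : Chat) : Prop :=
  forall z, M z -> h z <> b.

Definition totally_ramified (M : C -> Prop) (h : C -> Chat) (b : Chat) : Prop :=
  forall z, M z -> h z = b -> exists m, (2 <= m)%nat /\ multiplicity h z m.

Definition min_multiplicity (M : C -> Prop) (h : C -> Chat) (b : Chat)
    (nu : nat) : Prop :=
  (exists z, M z /\ h z = b /\ multiplicity h z nu) /\
  (forall z m, M z -> h z = b -> multiplicity h z m -> (nu <= m)%nat).

Definition ramified_number (M : C -> Prop) (h : C -> Chat) (x : R) : Prop :=
  exists (exc : list Chat) (tot : list (Chat * nat)),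
    NoDup exc /\ NoDup tot /\
    (forall a, In a exc <-> exceptional M h a) /\
    (forall b nu, In (b, nu) tot <->
       totally_ramified M h b /\ ~ exceptional M h b /\
       min_multiplicity M h b nu) /\
    x = INR (length exc) +
        fold_right (fun bn s => 1 - / INR (snd bn) + s) 0 tot.

(** * Ends of a front on M, where M is the sphere minus finitely many points *)

Definition end_chart (p : Chat) (w : C) : C :=
  match p with
  | Some a => (a + w)%C
  | None => (/ w)%C
  end.

Definition regular_end (M : C -> Prop) (G : C -> Chat) (p : Chat) : Prop :=
  exists (r : posreal) (H : C -> Chat),
    (forall w : C, Cmod w < r -> sphere_holo_at H w) /\
    (forall w : C, 0 < Cmod w < r ->
       M (end_chart p w) /\ H w = G (end_chart p w)).

Definition punctured_disc (p : Chat) (r : R) (z : C) : Prop :=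
  exists w : C, 0 < Cmod w < r /\ z = end_chart p w.

(* smooth embedding: an injective immersion with continuous inverse *)
Definition embedding_on (U : C -> Prop) (f : C -> L4) : Prop :=
  smooth_map U f /\
  (forall z, U z -> immersed_at f z) /\
  (forall z w, U z -> U w -> (forall mu, f z mu = f w mu) -> z = w) /\
  (forall z, U z -> forall eps : posreal, exists delta : posreal,
     forall w, U w -> (forall mu, Rabs (f w mu - f z mu) < delta) ->
       Cmod (w - z)%C < eps).

Definition embedded_end (M : C -> Prop) (f : C -> L4) (p : Chat) : Prop :=
  exists r : posreal,
    (forall z, punctured_disc p r z -> M z) /\
    embedding_on (punctured_disc p r) f.

(** * The domain and the Gauss maps of the example *)

Definition M0 (z : C) : Prop :=
  z <> RtoC 0 /\ z <> RtoC 1 /\ z <> RtoC (-2) /\ z <> RtoC (-3 / 2).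

Definition G0 (z : C) : Chat := Some (z ^ 3)%C.

Definition Gs0 (z : C) : Chat :=
  hat_div (z * (z + RtoC 6))%C (RtoC 2 * z + RtoC 5)%C.

Definition ends0 : list Chat :=
  Some (RtoC 0) :: Some (RtoC 1) :: Some (RtoC (-2)) :: Some (RtoC (-3 / 2))
  :: None :: nil.

(* Main.v *)
From Stdlib Require Import Lra Lia Psatz Factorial ClassicalEpsilon.
From Coquelicot Require Import Compactness.
Require Import Defs.

(** A frame e in SL(2, C) with hyperbolic Gauss maps G and G_* has the columns
    (G, 1) / xi and (G_*, 1) xi / (G - G_* ), and e^-1 de is off-diagonal exactly when
    d log xi = dG / (G - G_* ). For the given pair this form is
    3 z (2 z + 5) dz / ((z - 1) (z + 2) (2 z + 3)). Its residues 7/5, -2 and 18/5 are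
    real, so |xi| is single-valued, and the phase of xi cancels in f = e e^* and
    n = e e3 e^*: these are defined on the punctured plane although the frame is not.

    Flatness. With omega and theta the entries of e^-1 de, every parallel front is
    e diag(d1, d2) e^* and has the first fundamental form |d2 theta + d1 conj omega|^2.
    It is the pull-back of the Euclidean metric by a harmonic developing map, hence flat
    where it does not degenerate ([flat_gauss_curvature]); as omega has no zeros, one of
    the fronts t = 0 and t = 1 is immersed at a given point ([fr_is_flat_front]).

    Completeness. The first fundamental form is at least (|theta| - |omega|)^2. At a
    finite end one of omega, theta is at least of order r^-2 in the distance r to the end,
    according to the size of |xi|, and their product omega theta has a double pole at most;
    so the difference of the norms is at least of order 1/r ([dominance], [end_metric]). At
    infinity theta dominates, and the metric is bounded below by a multiple of |dz|^2. After
    the addition of a cut-off tensor the metric dominates (1 + sum of r^-2) |dz|^2, in which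
    log r and the coordinates are Lipschitz ([length_lower]); Cauchy sequences therefore
    converge in the plane, and not to an end ([gcomp_complete]).

    Embeddedness. The entries of the Hermitian matrix f satisfy f12 / f22 = weighted mean
    of G and G_*, with the squared moduli of the lower entries of e as weights. At a finite
    end one weight dominates, and the mean is a perturbation, with small Lipschitz constant,
    of the Gauss map that carries it. That map satisfies a lower Lipschitz bound at the end,
    which the mean inherits ([mean_lipschitz_below]). So f has a continuous
    inverse ([chart_embedding]). At infinity the same holds in the coordinate 1/z for
    f21 / f11 and the reciprocals of the Gauss maps.

    Gauss maps. The values of e on the universal cover come from the continuation of
    log (z - 1) and log (z + 3/2) along paths ([log_lift_exists]), which depends on the
    homotopy class only ([end_log_homotopic]).

    Ramification. G = z^3 omits 0 and infinity, and has no critical point off the ends. G_*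
    has degree two and takes every value off the ends; its critical points are the two
    roots of z^2 + 5 z + 15, which are not real, and each contributes 1/2. *)

(** * Differentiability in the plane *)

Definition cder (h : C -> C) (z l : C) : Prop :=
  forall eps : R, 0 < eps -> exists d : R, 0 < d /\ forall w, Cmod (w - z) < d ->
    Cmod (h w - h z - l * (w - z)) <= eps * Cmod (w - z).

Lemma locally_Cmod (z : C) (P : C -> Prop) :
  locally z P <-> exists d : R, 0 < d /\ forall w, Cmod (w - z) < d -> P w.
Proof.
  split.
  - intros [d Hd]. exists d. split; [apply cond_pos|].
    intros w Hw. apply Hd.
    pose proof (Rmax_Cmod (w - z)%C) as H.
    split; apply Rle_lt_trans with (2 := Hw); eapply Rle_trans; [|apply H| |apply H].
    + apply (Rmax_l (Rabs (fst (w - z)%C)) _).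
    + apply Rmax_r.
  - intros [d [Hd H]].
    apply locally_C. exists (mkposreal d Hd). intros w Hw. apply H. exact Hw.
Qed.

Lemma is_derive_cder (h : C -> C) (z l : C) : cder h z l <-> is_derive h z l.
Proof.
  split.
  - intros H. split.
    + apply is_linear_scal_l.
    + intros x Hx eps.
      apply (@is_filter_lim_locally_unique C_AbsRing (AbsRing_NormedModule C_AbsRing)) in Hx. subst x.
      destruct (H eps (cond_pos eps)) as [d [Hd Hw]].
      exists (mkposreal d Hd). intros w Hwz.
      specialize (Hw w Hwz).
      refine (eq_ind _ (fun r => r <= eps * Cmod (w - z)) Hw _ _).
      change (Cmod (h w - h z - l * (w - z)) = Cmod ((h w - h z) - (w - z) * l)).
      f_equal. ring.
  - intros [_ H] eps Heps.
    destruct (H z (fun P HP => HP) (mkposreal eps Heps)) as [d Hd].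
    exists d. split; [apply cond_pos|]. intros w Hw. specialize (Hd w Hw).
    refine (eq_ind _ (fun r => r <= eps * Cmod (w - z)) Hd _ _).
    change (Cmod ((h w - h z) - (w - z) * l) = Cmod (h w - h z - l * (w - z))).
    f_equal. ring.
Qed.

(** Total real differentiability, with the two partial derivatives as data.
    Every rule for [cder] below is a real rule for this predicate combined with
    the Cauchy-Riemann equations. *)
Definition rder (u : C -> R) (z : C) (p q : R) : Prop :=
  differentiable_pt_lim (fun x y => u (x, y)) (fst z) (snd z) p q.

Lemma rder_eq u z p q p' q' : rder u z p q -> p = p' -> q = q' -> rder u z p' q'.
Proof. intros H -> ->. exact H. Qed.

Lemma locally_2d_C (z : C) (P : C -> Prop) :
  locally z P <-> locally_2d (fun x y => P (x, y)) (fst z) (snd z).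
Proof.
  split; intros [d Hd]; exists d.
  - intros u v Hu Hv. apply Hd. split; [exact Hu | exact Hv].
  - intros [u v] [Hu Hv]. apply Hd; [exact Hu | exact Hv].
Qed.

Lemma rder_ext u v z p q : locally z (fun w => u w = v w) -> rder u z p q -> rder v z p q.
Proof.
  intros H. apply differentiable_pt_lim_ext.
  apply (locally_2d_C z (fun w => u w = v w)), H.
Qed.

Lemma differentiable_pt_lim_affine a b c x y :
  differentiable_pt_lim (fun u v => a * u + b * v + c) x y a b.
Proof.
  intros eps. exists (mkposreal 1 Rlt_0_1). intros u v _ _.
  replace (a * u + b * v + c - (a * x + b * y + c) - (a * (u - x) + b * (v - y))) with 0 by ring.
  rewrite Rabs_R0. apply Rmult_le_pos; [left; apply cond_pos|].
  eapply Rle_trans; [|apply Rmax_l]. apply Rabs_pos.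
Qed.

Lemma rder_affine a b c u z : (forall w, a * fst w + b * snd w + c = u w) -> rder u z a b.
Proof.
  intros H. apply (rder_ext (fun w => a * fst w + b * snd w + c)).
  apply filter_forall, H. apply differentiable_pt_lim_affine.
Qed.

Lemma rder_const c z : rder (fun _ => c) z 0 0.
Proof. apply (rder_affine 0 0 c). intros; ring. Qed.

Lemma rder_fst z : rder (fun w => fst w) z 1 0.
Proof. apply (rder_affine 1 0 0). intros; ring. Qed.

Lemma rder_snd z : rder (fun w => snd w) z 0 1.
Proof. apply (rder_affine 0 1 0). intros; ring. Qed.

Lemma differentiable_pt_lim_Rmult x y : differentiable_pt_lim Rmult x y y x.
Proof.
  intros eps. exists eps. intros u v Hu Hv.
  replace (u * v - x * y - (y * (u - x) + x * (v - y))) with ((u - x) * (v - y)) by ring.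
  rewrite Rabs_mult. apply Rmult_le_compat; try apply Rabs_pos.
  now left. apply Rmax_r.
Qed.

Lemma rder_plus u v z p q p' q' : rder u z p q -> rder v z p' q' ->
  rder (fun w => u w + v w) z (p + p') (q + q').
Proof.
  intros Hu Hv.
  assert (H := differentiable_pt_lim_comp _ _ _ _ _ _ _ _ _ _ _
    (differentiable_pt_lim_affine 1 1 0 _ _) Hu Hv).
  apply (rder_ext (fun w => 1 * u (fst w, snd w) + 1 * v (fst w, snd w) + 0)).
  apply filter_forall. intros [a b]. simpl. ring.
  eapply rder_eq; [exact H | ring | ring].
Qed.

Lemma rder_mult u v z p q p' q' : rder u z p q -> rder v z p' q' ->
  rder (fun w => u w * v w) z (p * v z + u z * p') (q * v z + u z * q').
Proof.
  intros Hu Hv. destruct z as [x y].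
  assert (H := differentiable_pt_lim_comp Rmult _ _ _ _ _ _ _ _ _ _
    (differentiable_pt_lim_Rmult _ _) Hu Hv).
  eapply rder_eq; [exact H | simpl; ring | simpl; ring].
Qed.

Lemma rder_comp (g : R -> R) u z p q l : is_derive g (u z) l -> rder u z p q ->
  rder (fun w => g (u w)) z (l * p) (l * q).
Proof.
  intros Hg Hu. destruct z as [x y].
  apply is_derive_Reals in Hg.
  assert (H := differentiable_pt_lim_comp (fun a _ => g a) _ (fun _ _ => 0) _ _ _ _ _ _ _ _
    (differentiable_pt_lim_proj1_0 g _ 0 _ Hg) Hu (rder_const 0 (x, y))).
  eapply rder_eq; [exact H | ring | ring].
Qed.

Lemma rder_opp u z p q : rder u z p q -> rder (fun w => - u w) z (- p) (- q).
Proof.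
  intros Hu. eapply rder_eq; [apply (rder_comp Ropp u z p q (-1)); [|exact Hu] | ring | ring].
  auto_derive; auto.
Qed.

Lemma rder_minus u v z p q p' q' : rder u z p q -> rder v z p' q' ->
  rder (fun w => u w - v w) z (p - p') (q - q').
Proof. intros Hu Hv. apply rder_plus; [exact Hu | now apply rder_opp]. Qed.

Lemma rder_inv u z p q : u z <> 0 -> rder u z p q ->
  rder (fun w => / u w) z (- p / (u z)^2) (- q / (u z)^2).
Proof.
  intros H0 Hu.
  eapply rder_eq; [apply (rder_comp Rinv u z p q (- / (u z)^2)); [|exact Hu] | |].
  auto_derive; auto. field; auto. field; auto. field; auto.
Qed.

Ltac rder_tac := repeat first
  [ eassumption | apply rder_const | apply rder_fst | apply rder_snd
  | apply rder_plus | apply rder_minus | apply rder_opp | apply rder_mult ].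

Lemma rder_chain u z p q (c1 c2 : R -> R) t a b :
  z = (c1 t, c2 t) -> rder u z p q -> is_derive c1 t a -> is_derive c2 t b ->
  is_derive (fun s => u (c1 s, c2 s)) t (p * a + q * b).
Proof.
  intros -> Hu H1 H2. apply is_derive_Reals. apply is_derive_Reals in H1, H2.
  exact (derivable_pt_lim_comp_2d (fun x y => u (x, y)) c1 c2 t p q a b Hu H1 H2).
Qed.

Lemma rder_slice u z p q d : rder u z p q ->
  is_derive (slice d u z) (coord d z) (match d with dx => p | dy => q end).
Proof.
  intros H. destruct z as [x y], d; simpl; evar_last.
  - apply (rder_chain u (x, y) p q (fun s => s) (fun _ => y) x 1 0); trivial.
    apply (is_derive_id x). apply (is_derive_const y x).
  - simpl. ring.
  - apply (rder_chain u (x, y) p q (fun _ => x) (fun s => s) y 0 1); trivial.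
    apply (is_derive_const x y). apply (is_derive_id y).
  - simpl. ring.
Qed.

Lemma rder_ex_pd u z p q d : rder u z p q -> ex_pd d u z.
Proof. intros H. eexists. eapply rder_slice, H. Qed.

Lemma rder_pd u z p q d : rder u z p q -> pd d u z = match d with dx => p | dy => q end.
Proof. intros H. apply is_derive_unique, rder_slice, H. Qed.

Lemma rder_continuous u z p q : rder u z p q -> continuous u z.
Proof.
  intros H. destruct z as [x y]. apply filterdiff_differentiable_pt_lim in H.
  simpl in H.
  apply (continuous_ext (fun w : C => u (fst w, snd w))).
  now intros [a b].
  apply (filterdiff_continuous (K:=R_AbsRing)
    (U:=prod_NormedModule _ R_NormedModule R_NormedModule) (V:=R_NormedModule)).
  eexists. exact H.
Qed.

Lemma locally_gt (u : C -> R) z c : continuous u z -> c < u z -> locally z (fun w => c < u w).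
Proof. intros H Hc. apply (H (fun t => c < t)). now apply open_gt. Qed.

Lemma locally_lt (u : C -> R) z c : continuous u z -> u z < c -> locally z (fun w => u w < c).
Proof. intros H Hc. apply (H (fun t => t < c)). now apply open_lt. Qed.

Lemma locally_neq (u : C -> R) z c : continuous u z -> u z <> c -> locally z (fun w => u w <> c).
Proof. intros H Hc. apply (H (fun t => t <> c)). now apply open_neq. Qed.

(** * Complex derivatives, exponential and logarithm *)

Lemma C_ext (a b : C) : fst a = fst b -> snd a = snd b -> a = b.
Proof. destruct a, b; simpl; intros -> ->; reflexivity. Qed.

Lemma RtoC_neq0 r : r <> 0 -> RtoC r <> 0.
Proof. intros H E. apply H, RtoC_inj, E. Qed.

Lemma Cmod_le_sum (z : C) : Cmod z <= Rabs (fst z) + Rabs (snd z).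
Proof.
  unfold Cmod. rewrite <- (sqrt_pow2 (Rabs (fst z) + Rabs (snd z))).
  2: apply Rplus_le_le_0_compat; apply Rabs_pos.
  apply sqrt_le_1_alt. rewrite <- (pow2_abs (fst z)), <- (pow2_abs (snd z)).
  pose proof (Rabs_pos (fst z)); pose proof (Rabs_pos (snd z)). nra.
Qed.

(** The Cauchy-Riemann criterion. *)
Lemma cder_rder h z l : cder h z l <->
  rder (fun w => fst (h w)) z (fst l) (- snd l) /\
  rder (fun w => snd (h w)) z (snd l) (fst l).
Proof.
  split.
  - intros H.
    assert (K : forall pr : C -> R, (forall w, Rabs (pr w) <= Cmod w) ->
       (forall v w, pr (v - w)%C = pr v - pr w) ->
       forall eps : posreal, locally z (fun w => Rabs (pr (h w) - pr (h z) - pr (l * (w - z))%C)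
         <= eps * Rmax (Rabs (fst w - fst z)) (Rabs (snd w - snd z)))).
    { intros pr Hpr Hlin eps. apply locally_Cmod.
      destruct (H (eps / 2)) as [d [Hd Hw]]. pose proof (cond_pos eps); lra.
      exists d. split; trivial. intros w Hwz. specialize (Hw w Hwz).
      rewrite <- !Hlin. eapply Rle_trans. apply Hpr. eapply Rle_trans. apply Hw.
      pose proof (Cmod_le_sum (w - z)%C) as Hs.
      change (Rabs (fst (w - z)%C)) with (Rabs (fst w - fst z)) in Hs.
      change (Rabs (snd (w - z)%C)) with (Rabs (snd w - snd z)) in Hs.
      pose proof (Rmax_l (Rabs (fst w - fst z)) (Rabs (snd w - snd z))).
      pose proof (Rmax_r (Rabs (fst w - fst z)) (Rabs (snd w - snd z))).
      pose proof (cond_pos eps). nra. }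
    split; intros eps;
      [ specialize (K fst (fun w => Rle_trans _ _ _ (Rmax_l _ _) (Rmax_Cmod w)) (fun _ _ => eq_refl) eps)
      | specialize (K snd (fun w => Rle_trans _ _ _ (Rmax_r _ _) (Rmax_Cmod w)) (fun _ _ => eq_refl) eps) ];
      apply locally_2d_C in K; destruct z as [x y]; simpl in *;
      revert K; apply locally_2d_impl, locally_2d_forall; intros u v K;
      (eapply Rle_trans; [|exact K]); right; f_equal; ring.
  - intros [H1 H2] eps Heps. destruct z as [x y].
    assert (He : 0 < eps / 2) by lra.
    specialize (H1 (mkposreal _ He)). specialize (H2 (mkposreal _ He)).
    apply (locally_Cmod (x, y)).
    apply (locally_2d_C (x, y) (fun w => Cmod (h w - h (x, y) - l * (w - (x, y))) <= eps * Cmod (w - (x, y)))).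
    simpl in *. assert (K := locally_2d_and _ _ _ _ H1 H2).
    revert K. apply locally_2d_impl, locally_2d_forall. intros u v [K1 K2].
    eapply Rle_trans. apply Cmod_le_sum. simpl.
    pose proof (Rmax_Cmod ((u, v) - (x, y))%C) as Hs. simpl in Hs.
    unfold Rminus in *.
    replace (fst (h (u, v)) + - fst (h (x, y)) + - (fst l * (u + - x) + - (snd l * (v + - y)))) with
     (fst (h (u, v)) + - fst (h (x, y)) + - (fst l * (u + - x) + - snd l * (v + - y))) by ring.
    replace (snd (h (u, v)) + - snd (h (x, y)) + - (fst l * (v + - y) + snd l * (u + - x))) with
     (snd (h (u, v)) + - snd (h (x, y)) + - (snd l * (u + - x) + fst l * (v + - y))) by ring.
    change (Cmod ((u, v) - (x, y))) with (Cmod (u + - x, v + - y)) in *. nra.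
Qed.

Lemma cder_eq h z l l' : cder h z l -> l = l' -> cder h z l'.
Proof. now intros H <-. Qed.

Lemma cder_ext h k z l : locally z (fun w => h w = k w) -> cder h z l -> cder k z l.
Proof.
  rewrite !cder_rder. intros H [H1 H2].
  split; (eapply rder_ext; [|eassumption]);
   apply (filter_imp (fun w => h w = k w)); trivial; intros w ->; reflexivity.
Qed.

Lemma cder_unique h z l l' : cder h z l -> cder h z l' -> l = l'.
Proof.
  rewrite !cder_rder. intros [H1 H2] [K1 K2]. apply C_ext.
  - now rewrite <- (rder_pd _ _ _ _ dx H1), <- (rder_pd _ _ _ _ dx K1).
  - now rewrite <- (rder_pd _ _ _ _ dx H2), <- (rder_pd _ _ _ _ dx K2).
Qed.

Lemma cder_const c z : cder (fun _ => c) z 0.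
Proof. apply cder_rder; split; (eapply rder_eq; [apply rder_const| simpl; ring ..]). Qed.

Lemma cder_id z : cder (fun w => w) z 1.
Proof.
  apply cder_rder; split; (eapply rder_eq; [apply rder_fst || apply rder_snd | simpl; ring ..]).
Qed.

Lemma cder_plus h k z l m : cder h z l -> cder k z m -> cder (fun w => h w + k w)%C z (l + m).
Proof.
  rewrite !cder_rder. intros [H1 H2] [K1 K2].
  split; simpl; (eapply rder_eq; [apply rder_plus; eassumption | simpl; ring ..]).
Qed.

Lemma cder_opp h z l : cder h z l -> cder (fun w => - h w)%C z (- l).
Proof.
  rewrite !cder_rder. intros [H1 H2].
  split; simpl; (eapply rder_eq; [apply rder_opp; eassumption | simpl; ring ..]).
Qed.

Lemma cder_minus h k z l m : cder h z l -> cder k z m -> cder (fun w => h w - k w)%C z (l - m).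
Proof. intros H K. apply cder_plus; trivial. now apply cder_opp. Qed.

Lemma cder_mult h k z l m : cder h z l -> cder k z m ->
  cder (fun w => h w * k w)%C z (l * k z + h z * m).
Proof.
  rewrite !cder_rder. intros [H1 H2] [K1 K2]. split; simpl.
  eapply rder_eq; [apply rder_minus; apply rder_mult; eassumption | simpl; ring ..].
  eapply rder_eq; [apply rder_plus; apply rder_mult; eassumption | simpl; ring ..].
Qed.

Lemma rder_cder_comp u k z p q m : rder u (k z) p q -> cder k z m ->
  rder (fun w => u (k w)) z (p * fst m + q * snd m) (- p * snd m + q * fst m).
Proof.
  rewrite cder_rder. intros H [K1 K2]. destruct z as [x y].
  assert (H' := differentiable_pt_lim_comp (fun a b => u (a, b)) _ _ _ _ _ _ _ _ _ _ H K1 K2).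
  apply (rder_ext (fun w => u (fst (k (fst w, snd w)), snd (k (fst w, snd w))))).
  apply filter_forall. intros [a b]. simpl. now destruct (k (a, b)).
  eapply rder_eq; [exact H' | ring | ring].
Qed.

Lemma cder_comp h k z l m : cder h (k z) l -> cder k z m -> cder (fun w => h (k w)) z (l * m).
Proof.
  intros H K. apply cder_rder. apply cder_rder in H. destruct H as [H1 H2].
  split; (eapply rder_eq; [apply (rder_cder_comp (fun w => fst (h w))) || apply (rder_cder_comp (fun w => snd (h w))); eassumption
    | simpl; ring ..]).
Qed.

Lemma cneq0_norm (z : C) : z <> 0 -> 0 < fst z ^ 2 + snd z ^ 2.
Proof.
  intros H. destruct z as [x y]; simpl.
  destruct (Req_dec x 0) as [->|]; destruct (Req_dec y 0) as [->|]; try nra.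
  now contradict H.
Qed.

Lemma cder_Cinv (z : C) : z <> 0 -> cder Cinv z (- / (z * z)).
Proof.
  intros H. apply cneq0_norm in H as H'. destruct z as [x y].
  apply cder_rder. simpl in *.
  split; (eapply rder_eq; [apply rder_mult; [rder_tac |
    apply (rder_inv (fun w => fst w * (fst w * 1) + snd w * (snd w * 1))); [simpl; lra | rder_tac]] | |]);
   simpl; field; nra.
Qed.

Lemma cder_inv (h : C -> C) z l : h z <> 0 -> cder h z l -> cder (fun w => / h w)%C z (- l / (h z * h z)).
Proof.
  intros H0 H. eapply cder_eq. apply (cder_comp Cinv h); [|exact H]. now apply cder_Cinv.
  field. exact H0.
Qed.

Lemma cder_div (h k : C -> C) z l m : k z <> 0 -> cder h z l -> cder k z m ->
  cder (fun w => h w / k w)%C z ((l * k z - h z * m) / (k z * k z)).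
Proof.
  intros H0 H K. eapply cder_eq. apply cder_mult. exact H. apply cder_inv; eassumption.
  simpl. field. exact H0.
Qed.

Lemma cder_pow h z l n : cder h z l -> cder (fun w => h w ^ n)%C z (RtoC (INR n) * l * h z ^ pred n).
Proof.
  intros H. induction n as [|n IH].
  - eapply cder_eq. exact (cder_const 1 z). simpl. ring.
  - eapply cder_eq. exact (cder_mult _ _ _ _ _ H IH).
    rewrite S_INR. destruct n; simpl; rewrite ?RtoC_plus; ring.
Qed.

Ltac cder_tac := repeat first
  [ eassumption | apply cder_id | apply cder_const
  | apply cder_plus | apply cder_minus | apply cder_opp | apply cder_mult ].

Lemma continuous_C_pair {U : UniformSpace} (u v : U -> R) x :
  continuous u x -> continuous v x -> continuous (fun y => (u y, v y) : C) x.
Proof.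
  intros Hu Hv. apply (continuous_comp_2 u v (fun a b => (a, b) : C) x Hu Hv).
  apply (continuous_ext (fun w => w)). now intros [a b]. apply continuous_id.
Qed.

Lemma cder_continuous h z l : cder h z l -> continuous h z.
Proof.
  rewrite cder_rder. intros [H1 H2]. apply rder_continuous in H1, H2.
  apply (continuous_ext (fun w => (fst (h w), snd (h w)))).
  intros w; now destruct (h w). now apply continuous_C_pair.
Qed.

Definition cexp (z : C) : C := (exp (fst z) * cos (snd z), exp (fst z) * sin (snd z)).

Lemma cexp_plus a b : cexp (a + b) = (cexp a * cexp b)%C.
Proof. apply C_ext; simpl; rewrite exp_plus, ?cos_plus, ?sin_plus; ring. Qed.

Lemma Cmod_sqr (z : C) : Cmod z ^ 2 = fst z ^ 2 + snd z ^ 2.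
Proof. unfold Cmod. apply pow2_sqrt. nra. Qed.

Lemma cexp_0 : cexp 0 = 1.
Proof. unfold cexp; simpl. rewrite exp_0, cos_0, sin_0. apply C_ext; simpl; ring. Qed.

Lemma Cmod_cexp z : Cmod (cexp z) = exp (fst z).
Proof.
  unfold Cmod, cexp; simpl.
  replace (_ + _) with (exp (fst z) ^ 2). apply sqrt_pow2. left; apply exp_pos.
  generalize (sin2_cos2 (snd z)); unfold Rsqr. intros H.
  transitivity (exp (fst z) ^ 2 * (sin (snd z) * sin (snd z) + cos (snd z) * cos (snd z))).
  rewrite H; ring. ring.
Qed.

Lemma cexp_neq0 z : cexp z <> 0.
Proof.
  intros H. pose proof (Cmod_cexp z) as K. rewrite H, Cmod_0 in K.
  pose proof (exp_pos (fst z)). lra.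
Qed.

Lemma cder_cexp z : cder cexp z (cexp z).
Proof.
  apply cder_rder. unfold cexp; simpl.
  assert (E := rder_comp exp (fun w => fst w) z 1 0 _ (is_derive_exp _) (rder_fst z)).
  assert (Co := rder_comp cos (fun w => snd w) z 0 1 _ (is_derive_cos _) (rder_snd z)).
  assert (Si := rder_comp sin (fun w => snd w) z 0 1 _ (is_derive_sin _) (rder_snd z)).
  split; (eapply rder_eq; [apply rder_mult; eassumption | cbv beta; ring ..]).
Qed.

(** The principal logarithm, used on the right half plane only. *)
Definition clog (z : C) : C :=
  (/ 2 * ln (fst z * fst z + snd z * snd z), atan (snd z * / fst z)).

Lemma cexp_clog z : 0 < fst z -> cexp (clog z) = z.
Proof.
  destruct z as [x y]; simpl. intros Hx. unfold cexp, clog; simpl.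
  assert (Hn : 0 < x * x + y * y) by nra.
  assert (E : exp (/ 2 * ln (x * x + y * y)) = sqrt (x * x + y * y)).
  { rewrite Rmult_comm. rewrite <- Rpower_sqrt by trivial. unfold Rpower. f_equal. ring. }
  rewrite E, cos_atan, sin_atan.
  assert (F : sqrt (1 + (y * / x)²) = sqrt (x * x + y * y) / x).
  { transitivity (sqrt (x * x + y * y) / sqrt (x * x)).
    rewrite <- sqrt_div_alt by nra. f_equal. unfold Rsqr. field. lra.
    f_equal. apply sqrt_square. lra. }
  rewrite F. assert (0 < sqrt (x * x + y * y)) by now apply sqrt_lt_R0.
  apply C_ext; simpl; field; lra.
Qed.

Lemma clog_1 : clog 1 = 0.
Proof.
  unfold clog; simpl. apply C_ext; simpl.
  replace (1 * 1 + 0 * 0) with 1 by ring. rewrite ln_1; ring. rewrite Rmult_0_l. apply atan_0.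
Qed.

Lemma cder_clog z : 0 < fst z -> cder clog z (/ z).
Proof.
  destruct z as [x y]; simpl. intros Hx. assert (Hn : 0 < x * x + y * y) by nra.
  apply cder_rder. unfold clog; simpl. split.
  - eapply rder_eq. apply rder_mult. apply rder_const.
    apply (rder_comp ln (fun w => fst w * fst w + snd w * snd w)); [apply is_derive_ln; simpl; lra|].
    rder_tac. simpl. field. nra. simpl. field. nra.
  - eapply rder_eq. apply (rder_comp atan (fun w => snd w * / fst w)). apply is_derive_atan.
    apply rder_mult. apply rder_snd. apply rder_inv. simpl; lra. apply rder_fst.
    unfold Rsqr; simpl. field. repeat split; nra.
    unfold Rsqr; simpl. field. repeat split; nra.
Qed.

Lemma cexp_surj (z : C) : z <> 0 -> exists l, cexp l = z.
Proof.
  intros H.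
  set (q := (0, PI / 2) : C).
  assert (K1 : cexp q = Ci).
  { unfold cexp, q; simpl. rewrite exp_0, cos_PI2, sin_PI2. apply C_ext; simpl; ring. }
  (* one of z, -iz, -z, iz has positive real part *)
  destruct (Rlt_dec 0 (fst z)) as [Hx|Hx].
  { exists (clog z). now apply cexp_clog. }
  destruct (Rlt_dec 0 (snd z)) as [Hy|Hy].
  { exists (clog (- Ci * z) + q)%C. rewrite cexp_plus, cexp_clog, K1.
    destruct z; apply C_ext; simpl; ring. destruct z; simpl in *; lra. }
  destruct (Rlt_dec (fst z) 0) as [Hx'|Hx'].
  { exists (clog (- z) + (q + q))%C. rewrite !cexp_plus, cexp_clog, K1.
    destruct z; apply C_ext; simpl; ring. destruct z; simpl in *; lra. }
  exists (clog (Ci * z) + (q + (q + q)))%C.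
  rewrite !cexp_plus, cexp_clog, K1.
  destruct z; apply C_ext; simpl; ring. destruct z as [x y]; simpl in *.
  destruct (Req_dec y 0) as [->|]. exfalso. apply H. apply C_ext; simpl; lra. lra.
Qed.

(** * Smooth functions *)

(** C^k in the sense of total derivatives; unlike the iterated partial derivatives
    in [smooth_on], this form is stable under products and compositions by a plain
    induction on [k]. *)
Fixpoint Ck (k : nat) (U : C -> Prop) (u : C -> R) : Prop :=
  match k with
  | O => forall z, U z -> continuous u z
  | S k' => exists p q : C -> R, (forall z, U z -> rder u z (p z) (q z)) /\
      Ck k' U p /\ Ck k' U q
  end.

Definition Cinf (U : C -> Prop) (u : C -> R) : Prop := forall k, Ck k U u.

Lemma Ck_continuous k U u z : Ck k U u -> U z -> continuous u z.
Proof.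
  destruct k; simpl. now auto. intros (p & q & H & _) Hz. eapply rder_continuous, H, Hz.
Qed.

Lemma Ck_pred k U u : Ck (S k) U u -> Ck k U u.
Proof.
  revert u. induction k as [|k IH]; intros u H.
  - intros z. now apply Ck_continuous with (k := 1%nat).
  - destruct H as (p & q & H & Hp & Hq). exists p, q; auto.
Qed.

Lemma Ck_ext k U u v : open U -> (forall z, U z -> u z = v z) -> Ck k U u -> Ck k U v.
Proof.
  intros HU E. assert (L : forall z, U z -> locally z (fun w => u w = v w)).
  { intros z Hz. apply (filter_imp U). exact E. now apply HU. }
  destruct k; simpl.
  - intros H z Hz. apply continuous_ext_loc with u. now apply L. now apply H.
  - intros (p & q & H & Hpq). exists p, q; split; trivial. intros z Hz.
    apply rder_ext with u; auto.
Qed.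

Lemma Ck_pd k U u d : open U -> Ck (S k) U u -> Ck k U (pd d u).
Proof.
  intros HU (p & q & H & Hp & Hq).
  destruct d; [apply Ck_ext with p | apply Ck_ext with q]; trivial;
    intros z Hz; symmetry; exact (rder_pd u z _ _ _ (H z Hz)).
Qed.

Lemma Cinf_pd U u d : open U -> Cinf U u -> Cinf U (pd d u).
Proof. intros HU H k. apply Ck_pd; trivial. Qed.

Lemma Cinf_smooth U u : open U -> Cinf U u -> smooth_on U u.
Proof.
  intros HU H l. assert (K : Cinf U (pds l u)) by (induction l; [exact H | now apply Cinf_pd]).
  intros z Hz. split. now apply (Ck_continuous 0 U _ z (K 0%nat)).
  intros d. destruct (K 1%nat) as (p & q & L & _). eapply rder_ex_pd, L, Hz.
Qed.

Lemma Cinf_ext U u v : open U -> (forall z, U z -> u z = v z) -> Cinf U u -> Cinf U v.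
Proof. intros HU E H k. apply Ck_ext with u; trivial. Qed.

Lemma Ck_const k U c : Ck k U (fun _ => c).
Proof.
  revert c. induction k; intros c; simpl.
  - intros z _. apply continuous_const.
  - exists (fun _ => 0), (fun _ => 0). repeat split; trivial. intros; apply rder_const.
Qed.

Lemma Ck_plus k U u v : Ck k U u -> Ck k U v -> Ck k U (fun z => u z + v z).
Proof.
  revert u v. induction k; intros u v; simpl.
  - intros Hu Hv z Hz. apply (continuous_plus (V:=R_NormedModule)); auto.
  - intros (p & q & H & Hp & Hq) (p' & q' & H' & Hp' & Hq').
    exists (fun z => p z + p' z), (fun z => q z + q' z). repeat split; auto.
    intros z Hz. apply rder_plus; auto.
Qed.

Lemma Ck_mult k U u v : Ck k U u -> Ck k U v -> Ck k U (fun z => u z * v z).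
Proof.
  revert u v. induction k; intros u v Hu Hv.
  - intros z Hz. apply (continuous_mult (K:=R_AbsRing)); auto.
  - apply Ck_pred in Hu as Hu'. apply Ck_pred in Hv as Hv'.
    destruct Hu as (p & q & H & Hp & Hq), Hv as (p' & q' & H' & Hp' & Hq').
    exists (fun z => p z * v z + u z * p' z), (fun z => q z * v z + u z * q' z).
    repeat split; try apply Ck_plus; auto. intros z Hz. apply rder_mult; auto.
Qed.

(** Chain rule for a family [g] of functions of one variable whose derivatives are
    combinations of two members of the family: this one induction covers the
    exponential and the flat functions t^-m exp(-1/t). *)
Lemma Ck_comp_family {I : Type} (g : I -> R -> R) (c : I -> nat -> R) (s : I -> nat -> I)
    (V : R -> Prop) U u :
  (forall i t, V t -> is_derive (g i) t (c i 0%nat * g (s i 0%nat) t + c i 1%nat * g (s i 1%nat) t)) ->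
  (forall z, U z -> V (u z)) ->
  forall k i, Ck k U u -> Ck k U (fun z => g i (u z)).
Proof.
  intros Hg HV. induction k as [|k IH]; intros i Hu.
  - intros z Hz. apply continuous_comp. now apply Hu.
    apply (ex_derive_continuous (K:=R_AbsRing) (V:=R_NormedModule)).
    eexists. apply Hg; auto.
  - apply Ck_pred in Hu as Hu'. destruct Hu as (p & q & H & Hp & Hq).
    exists (fun z => (c i 0%nat * g (s i 0%nat) (u z) + c i 1%nat * g (s i 1%nat) (u z)) * p z).
    exists (fun z => (c i 0%nat * g (s i 0%nat) (u z) + c i 1%nat * g (s i 1%nat) (u z)) * q z).
    repeat split.
    + intros z Hz. apply rder_comp; auto.
    + apply Ck_mult; trivial. apply Ck_plus; apply Ck_mult; auto using Ck_const.
    + apply Ck_mult; trivial. apply Ck_plus; apply Ck_mult; auto using Ck_const.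
Qed.

Lemma Cinf_const U c : Cinf U (fun _ => c).
Proof. intros k. apply Ck_const. Qed.

Lemma Cinf_plus U u v : Cinf U u -> Cinf U v -> Cinf U (fun z => u z + v z).
Proof. intros Hu Hv k. now apply Ck_plus. Qed.

Lemma Cinf_mult U u v : Cinf U u -> Cinf U v -> Cinf U (fun z => u z * v z).
Proof. intros Hu Hv k. now apply Ck_mult. Qed.

Lemma Cinf_opp U u : Cinf U u -> Cinf U (fun z => - u z).
Proof.
  intros Hu k.
  refine (Ck_comp_family (fun (b : bool) t => if b then - t else 1)
    (fun b j => if b then match j with O => -1 | _ => 0 end else 0) (fun b j => false) (fun _ => True) U u _ (fun _ _ => I) k true (Hu k)).
  intros [|] t _; auto_derive; auto; ring.
Qed.

Lemma Cinf_minus U u v : Cinf U u -> Cinf U v -> Cinf U (fun z => u z - v z).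
Proof. intros Hu Hv. apply Cinf_plus; trivial. now apply Cinf_opp. Qed.

Lemma Cinf_fst U : Cinf U (fun z => fst z).
Proof.
  intros [|k]. intros z _. apply continuous_fst.
  exists (fun _ => 1), (fun _ => 0). repeat split; try apply Ck_const. intros; apply rder_fst.
Qed.

Lemma Cinf_snd U : Cinf U (fun z => snd z).
Proof.
  intros [|k]. intros z _. apply continuous_snd.
  exists (fun _ => 0), (fun _ => 1). repeat split; try apply Ck_const. intros; apply rder_snd.
Qed.

Lemma Ck_inv k U u : (forall z, U z -> u z <> 0) -> Ck k U u -> Ck k U (fun z => / u z).
Proof.
  intros H0. induction k as [|k IH]; intros Hu.
  - intros z Hz. apply continuous_comp. now apply Hu.
    apply (ex_derive_continuous (K:=R_AbsRing) (V:=R_NormedModule)). auto_derive; auto.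
  - apply Ck_pred in Hu as Hu'. specialize (IH Hu'). destruct Hu as (p & q & H & Hp & Hq).
    exists (fun z => (-1 * p z) * (/ u z * / u z)), (fun z => (-1 * q z) * (/ u z * / u z)).
    repeat split; repeat apply Ck_mult; auto using Ck_const.
    intros z Hz. eapply rder_eq. apply rder_inv; auto. field; auto. field; auto.
Qed.

Lemma Cinf_inv U u : (forall z, U z -> u z <> 0) -> Cinf U u -> Cinf U (fun z => / u z).
Proof. intros H0 Hu k. now apply Ck_inv. Qed.

Lemma Cinf_exp U u : Cinf U u -> Cinf U (fun z => exp (u z)).
Proof.
  intros Hu k.
  refine (Ck_comp_family (fun (_ : unit) t => exp t)
    (fun b j => match j with O => 1 | _ => 0 end) (fun b j => b) (fun _ => True) U u _ (fun _ _ => I) k tt (Hu k)).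
  intros _ t _; auto_derive; auto; ring.
Qed.

Lemma Cinf_ln U u : (forall z, U z -> 0 < u z) -> Cinf U u -> Cinf U (fun z => ln (u z)).
Proof.
  intros H0 Hu [|k].
  - intros z Hz. apply continuous_comp. now apply (Hu 0%nat).
    apply (ex_derive_continuous (K:=R_AbsRing) (V:=R_NormedModule)). auto_derive; auto.
  - destruct (Hu (S k)) as (p & q & H & Hp & Hq).
    exists (fun z => / u z * p z), (fun z => / u z * q z).
    assert (Ck k U (fun z => / u z)). { apply Ck_inv; trivial. intros z Hz. specialize (H0 z Hz); lra. }
    repeat split; try (apply Ck_mult; trivial).
    intros z Hz. apply rder_comp; auto. apply is_derive_ln; auto.
Qed.

Definition CCinf (U : C -> Prop) (h : C -> C) : Prop :=
  Cinf U (fun z => fst (h z)) /\ Cinf U (fun z => snd (h z)).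

Lemma CCinf_const U c : CCinf U (fun _ => c).
Proof. split; apply Cinf_const. Qed.
Lemma CCinf_id U : CCinf U (fun z => z).
Proof. split; [apply Cinf_fst | apply Cinf_snd]. Qed.
Lemma CCinf_plus U h k : CCinf U h -> CCinf U k -> CCinf U (fun z => h z + k z)%C.
Proof. intros [] []. split; simpl; now apply Cinf_plus. Qed.
Lemma CCinf_mult U h k : CCinf U h -> CCinf U k -> CCinf U (fun z => h z * k z)%C.
Proof.
  intros [] []. split; simpl; [apply Cinf_minus|apply Cinf_plus]; now apply Cinf_mult.
Qed.
Lemma CCinf_opp U h : CCinf U h -> CCinf U (fun z => - h z)%C.
Proof. intros []. split; simpl; now apply Cinf_opp. Qed.
Lemma CCinf_conj U h : CCinf U h -> CCinf U (fun z => Cconj (h z)).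
Proof. intros []. split; simpl; [trivial | now apply Cinf_opp]. Qed.
Lemma CCinf_RtoC U u : Cinf U u -> CCinf U (fun z => RtoC (u z)).
Proof. split; simpl; [trivial | apply Cinf_const]. Qed.
Lemma Cinf_pow U u n : Cinf U u -> Cinf U (fun z => u z ^ n).
Proof. intros H; induction n; simpl. apply Cinf_const. now apply Cinf_mult. Qed.

Definition cdot (a b : C) : R := fst a * fst b + snd a * snd b.

Definition sqn (w : C) : R := cdot w w.

Lemma sqn_Cmod w : sqn w = Cmod w ^ 2.
Proof. rewrite Cmod_sqr. unfold sqn, cdot. ring. Qed.

Lemma sqn_mult a b : sqn (a * b) = sqn a * sqn b.
Proof. unfold sqn, cdot; simpl; ring. Qed.

Lemma sqn_pos (w : C) : w <> 0 -> 0 < sqn w.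
Proof. intros H. apply cneq0_norm in H. unfold sqn, cdot. lra. Qed.

Lemma sqn_ge0 w : 0 <= sqn w.
Proof. unfold sqn, cdot. nra. Qed.

Lemma sqn_neq0 (w : C) : 0 < sqn w -> w <> 0.
Proof. intros H ->. unfold sqn, cdot in H; simpl in H. lra. Qed.

Lemma sqn_RtoC r : sqn (RtoC r) = r * r.
Proof. unfold sqn, cdot; simpl; ring. Qed.

Lemma sqn_div a (b : C) : b <> 0 -> sqn (a / b) = sqn a / sqn b.
Proof.
  intros H. apply sqn_pos in H as H'. apply Rmult_eq_reg_r with (sqn b); [|lra].
  rewrite <- sqn_mult. replace (a / b * b)%C with a by (field; exact H). field. lra.
Qed.

Lemma sqn_inv (w : C) : w <> 0 -> sqn (/ w) = / sqn w.
Proof.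
  intros H. replace (/ w)%C with (1 / w)%C by (field; trivial). rewrite sqn_div, sqn_RtoC by trivial.
  apply sqn_pos in H. field. lra.
Qed.

Lemma sqn_cexp w : sqn (cexp w) = exp (2 * fst w).
Proof. rewrite sqn_Cmod, Cmod_cexp. simpl. rewrite Rmult_1_r, <- exp_plus. f_equal. ring. Qed.

Lemma CCinf_ext U h k : open U -> (forall z, U z -> h z = k z) -> CCinf U h -> CCinf U k.
Proof.
  intros HU E [H1 H2].
  split; [eapply Cinf_ext with (3 := H1) | eapply Cinf_ext with (3 := H2)]; trivial;
    intros z Hz; now rewrite (E z Hz).
Qed.

Lemma Cinf_sqn U h : CCinf U h -> Cinf U (fun z => sqn (h z)).
Proof. intros [H1 H2]. unfold sqn, cdot. apply Cinf_plus; now apply Cinf_mult. Qed.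

Lemma CCinf_minus U h k : CCinf U h -> CCinf U k -> CCinf U (fun z => h z - k z)%C.
Proof. intros H K. apply CCinf_plus; trivial. now apply CCinf_opp. Qed.

Lemma CCinf_inv U (h : C -> C) : open U -> (forall z, U z -> h z <> 0) -> CCinf U h -> CCinf U (fun z => / h z)%C.
Proof.
  intros HU H0 H. apply (CCinf_ext U (fun z => Cconj (h z) * RtoC (/ sqn (h z)))%C); trivial.
  - intros z Hz. specialize (H0 z Hz). apply cneq0_norm in H0.
    apply C_ext; unfold sqn, cdot; simpl in *; field; lra.
  - apply CCinf_mult. now apply CCinf_conj. apply CCinf_RtoC, Cinf_inv.
    intros z Hz. apply Rgt_not_eq, sqn_pos. auto. now apply Cinf_sqn.
Qed.

Lemma CCinf_div U (h k : C -> C) : open U -> (forall z, U z -> k z <> 0) ->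
  CCinf U h -> CCinf U k -> CCinf U (fun z => h z / k z)%C.
Proof. intros HU H0 H K. apply CCinf_mult; trivial. now apply CCinf_inv. Qed.

Ltac cinf_tac := repeat first [ eassumption | apply CCinf_id | apply CCinf_const | apply CCinf_plus
  | apply CCinf_minus | apply CCinf_opp | apply CCinf_mult ].

Ltac cinf_real := repeat first [ eassumption | apply Cinf_const
  | match goal with |- Cinf _ (fun z => sqn _) => apply Cinf_sqn end
  | apply Cinf_plus | apply Cinf_minus | apply Cinf_opp | apply Cinf_mult
  | apply Cinf_pow | apply Cinf_inv | apply Cinf_exp | apply Cinf_ln
  | (cinf_tac; fail) ].

Lemma Cinf_continuous U u z : Cinf U u -> U z -> continuous u z.
Proof. intros H Hz. exact (H 0%nat z Hz). Qed.

Lemma locally_neq0 (h : C -> C) z : CCinf (fun _ => True) h -> h z <> 0 -> locally z (fun w => h w <> 0).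
Proof.
  intros Hh H0. assert (L : locally z (fun w => 0 < sqn (h w))).
  { apply locally_gt. apply (Cinf_continuous (fun _ => True)); trivial. now apply Cinf_sqn. now apply sqn_pos. }
  revert L. apply filter_imp. intros w. apply sqn_neq0.
Qed.

(** The flat functions t^-m exp(-1/t), extended by zero; [bump 0] is the cut-off
    function of the completeness proof. *)
Definition bump (m : nat) (t : R) : R :=
  if Rle_dec t 0 then 0 else / t ^ m * exp (- / t).

Lemma bump_small m : exists c, forall t, Rabs (bump m t) <= c * t ^ 2.
Proof.
  exists (INR (fact (m + 2))). intros t. unfold bump. destruct (Rle_dec t 0) as [Ht|Ht].
  - rewrite Rabs_R0. apply Rmult_le_pos. apply pos_INR. nra.
  - assert (Ht' : 0 < t) by lra.
    assert (0 < t ^ m) by now apply pow_lt.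
    rewrite Rabs_pos_eq. 2: apply Rmult_le_pos; [left; now apply Rinv_0_lt_compat | left; apply exp_pos].
    assert (K : (/ t) ^ (m + 2) / INR (fact (m + 2)) <= exp (/ t)).
    { assert (Hi : 0 < / t) by now apply Rinv_0_lt_compat. revert Hi. generalize (/ t) (m + 2)%nat. intros x n Hx.
      clear -Hx. assert (P : forall k, 0 < x ^ k / INR (fact k)).
      { intros k. apply Rdiv_lt_0_compat. now apply pow_lt. apply INR_fact_lt_0. }
      assert (S : infinite_sum (fun i => / INR (fact i) * x ^ i) (exp x)) by (unfold exp; now destruct (exist_exp x)).
      apply Rle_trans with (sum_f_R0 (fun i => / INR (fact i) * x ^ i) n).
      - destruct n. simpl. specialize (P 0%nat). simpl in P. lra.
        rewrite tech5. assert (0 <= sum_f_R0 (fun i => / INR (fact i) * x ^ i) n).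
        apply cond_pos_sum. intros k. specialize (P k). unfold Rdiv in P. lra.
        unfold Rdiv. lra.
      - apply sum_incr. exact S. intros k. specialize (P k). unfold Rdiv in P. lra. }
    rewrite exp_Ropp. pose proof (exp_pos (/ t)). pose proof (INR_fact_lt_0 (m + 2)).
    assert (K2 : / exp (/ t) <= INR (fact (m + 2)) * t ^ (m + 2)).
    { replace (INR (fact (m + 2)) * t ^ (m + 2)) with (/ ((/ t) ^ (m + 2) / INR (fact (m + 2)))).
      apply Rinv_le_contravar; trivial. apply Rdiv_lt_0_compat; trivial. apply pow_lt. now apply Rinv_0_lt_compat.
      rewrite pow_inv. assert (0 < t ^ (m + 2)) by now apply pow_lt. field. lra. }
    apply Rmult_le_reg_l with (t ^ m); trivial.
    replace (t ^ m * (/ t ^ m * / exp (/ t))) with (/ exp (/ t)) by (field; lra).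
    rewrite pow_add in K2. lra.
Qed.

Lemma is_derive_bump m t :
  is_derive (bump m) t ((- INR m) * bump (S m) t + 1 * bump (S (S m)) t).
Proof.
  destruct (Rlt_dec t 0) as [Ht|Ht]; [|destruct (Rlt_dec 0 t) as [Ht'|Ht']].
  - unfold bump at 2 3. destruct (Rle_dec t 0); [|lra].
    apply (is_derive_ext_loc (fun _ => 0)).
    exists (mkposreal (- t) ltac:(lra)). intros y Hy. unfold bump. destruct (Rle_dec y 0); trivial.
    change (Rabs (y - t) < - t) in Hy. apply Rabs_lt_between in Hy. lra.
    evar_last. apply (is_derive_const 0 t). simpl. change (0 = - INR m * 0 + 1 * 0). ring.
  - unfold bump at 2 3. destruct (Rle_dec t 0); [lra|].
    apply (is_derive_ext_loc (fun t => / t ^ m * exp (- / t))).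
    exists (mkposreal t Ht'). intros y Hy. unfold bump. destruct (Rle_dec y 0); trivial.
    change (Rabs (y - t) < t) in Hy. apply Rabs_lt_between in Hy. lra.
    assert (0 < t ^ m) by now apply pow_lt.
    auto_derive. repeat split; lra.
    destruct m. simpl. field. lra.
    simpl pred. rewrite S_INR. simpl pow. assert (0 < t ^ m) by now apply pow_lt.
    field. lra.
  - assert (t = 0) by lra. subst t. unfold bump at 2 3. destruct (Rle_dec 0 0); [|lra].
    replace (- INR m * 0 + 1 * 0) with 0 by ring.
    destruct (bump_small m) as [c Hc].
    assert (Hc0 : 0 <= c). { specialize (Hc 1). pose proof (Rabs_pos (bump m 1)). lra. }
    apply is_derive_Reals. intros eps Heps.
    assert (Hp : 0 < eps / (c + 1)) by (apply Rdiv_lt_0_compat; lra).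
    exists (mkposreal _ Hp). intros h Hh0 Hh. simpl in Hh.
    rewrite Rplus_0_l, Rminus_0_r. replace (bump m 0) with 0.
    2: unfold bump; destruct (Rle_dec 0 0); lra. rewrite Rminus_0_r.
    unfold Rdiv. rewrite Rabs_mult, Rabs_inv.
    pose proof (Rabs_pos_lt h Hh0) as Hh1. apply Rmult_lt_reg_r with (Rabs h); trivial.
    rewrite Rmult_assoc, Rinv_l, Rmult_1_r by lra.
    eapply Rle_lt_trans. apply Hc. rewrite <- (pow2_abs h).
    apply (Rmult_lt_compat_r (c + 1)) in Hh; [|lra]. unfold Rdiv in Hh. rewrite Rmult_assoc, Rinv_l, Rmult_1_r in Hh by lra.
    nra.
Qed.

Lemma Cinf_bump U u : Cinf U u -> Cinf U (fun z => bump 0 (u z)).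
Proof.
  intros Hu k.
  refine (Ck_comp_family bump (fun m j => match j with O => - INR m | _ => 1 end)
     (fun m j => match j with O => S m | _ => S (S m) end) (fun _ => True) U u _ (fun _ _ => I) k 0%nat (Hu k)).
  intros m t _. apply is_derive_bump.
Qed.

Lemma bump_pos t : 0 < t -> 0 < bump 0 t.
Proof. intros H. unfold bump. destruct (Rle_dec t 0). lra. simpl. rewrite Rinv_1, Rmult_1_l. apply exp_pos. Qed.
Lemma bump_0 t : t <= 0 -> bump 0 t = 0.
Proof. intros H. unfold bump. destruct (Rle_dec t 0); [trivial|lra]. Qed.
Lemma bump_ge_0 t : 0 <= bump 0 t.
Proof. destruct (Rle_dec t 0). rewrite bump_0; lra. left; apply bump_pos; lra. Qed.
Lemma bump_incr s t : s <= t -> bump 0 s <= bump 0 t.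
Proof.
  intros H. destruct (Rle_dec s 0). rewrite (bump_0 s) by trivial. apply bump_ge_0.
  unfold bump. destruct (Rle_dec s 0); [lra|]. destruct (Rle_dec t 0); [lra|]. simpl.
  rewrite Rinv_1, !Rmult_1_l. assert (/ t <= / s) by (apply Rinv_le_contravar; lra).
  destruct (Req_dec (- / s) (- / t)) as [->|]. lra. left. apply exp_increasing. lra.
Qed.

(** * Hermitian frames *)

(** The vector whose Hermitian matrix is e diag(d1, d2) e^*. The front e e^* has
    (d1, d2) = (1, 1), its normal (1, -1), and its parallel fronts d1 d2 = 1, so that one
    computation gives all their first fundamental forms. *)
Definition hvec (d1 d2 : R) (e11 e12 e21 e22 : C) : L4 := fun mu =>
  match mu with
  | t0 => (d1 * (cdot e11 e11 + cdot e21 e21) + d2 * (cdot e12 e12 + cdot e22 e22)) * / 2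
  | t3 => (d1 * (cdot e11 e11 - cdot e21 e21) + d2 * (cdot e12 e12 - cdot e22 e22)) * / 2
  | t1 => d1 * cdot e11 e21 + d2 * cdot e12 e22
  | t2 => d1 * (snd e11 * fst e21 - fst e11 * snd e21) + d2 * (snd e12 * fst e22 - fst e12 * snd e22)
  end.

Lemma mmul_entries (a b c d a' b' c' d' : C) :
  mmul [[a, b], [c, d]] [[a', b'], [c', d']] =
  [[ (a * a' + b * c')%C, (a * b' + b * d')%C ], [ (c * a' + d * c')%C, (c * b' + d * d')%C ]].
Proof.
  unfold mmul, Mmult, mk_matrix, sum_n, sum_n_m, Iter.iter_nat, Iter.iter, coeff_mat; simpl.
  repeat (apply f_equal2; trivial); apply C_ext; simpl; ring.
Qed.

Lemma herm_hvec d1 d2 e11 e12 e21 e22 :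
  herm (hvec d1 d2 e11 e12 e21 e22) =
  mmul (mmul [[e11, e12], [e21, e22]] [[RtoC d1, RtoC 0], [RtoC 0, RtoC d2]])
    (adjoint [[e11, e12], [e21, e22]]).
Proof.
  change (adjoint [[e11, e12], [e21, e22]]) with [[Cconj e11, Cconj e21], [Cconj e12, Cconj e22]].
  rewrite !mmul_entries. unfold herm.
  repeat (apply f_equal2; trivial); apply C_ext; simpl; unfold cdot; simpl; field.
Qed.

(** The derivative of [hvec] when the entries of the frame move with velocities [l]. *)
Definition dhvec (d1 d2 : R) (e11 e12 e21 e22 l11 l12 l21 l22 : C) : L4 := fun mu =>
  match mu with
  | t0 => d1 * (cdot e11 l11 + cdot e21 l21) + d2 * (cdot e12 l12 + cdot e22 l22)
  | t3 => d1 * (cdot e11 l11 - cdot e21 l21) + d2 * (cdot e12 l12 - cdot e22 l22)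
  | t1 => d1 * (cdot l11 e21 + cdot e11 l21) + d2 * (cdot l12 e22 + cdot e12 l22)
  | t2 => d1 * (snd l11 * fst e21 - fst l11 * snd e21 + snd e11 * fst l21 - fst e11 * snd l21)
     + d2 * (snd l12 * fst e22 - fst l12 * snd e22 + snd e12 * fst l22 - fst e12 * snd l22)
  end.

Lemma rder_hvec d1 d2 (e11 e12 e21 e22 : C -> C) l11 l12 l21 l22 z mu :
  cder e11 z l11 -> cder e12 z l12 -> cder e21 z l21 -> cder e22 z l22 ->
  rder (fun w => hvec d1 d2 (e11 w) (e12 w) (e21 w) (e22 w) mu) z
   (dhvec d1 d2 (e11 z) (e12 z) (e21 z) (e22 z) l11 l12 l21 l22 mu)
   (dhvec d1 d2 (e11 z) (e12 z) (e21 z) (e22 z) (Ci * l11) (Ci * l12) (Ci * l21) (Ci * l22) mu).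
Proof.
  rewrite !cder_rder. intros [] [] [] [].
  destruct mu; unfold hvec, cdot; (eapply rder_eq; [rder_tac | simpl; unfold dhvec, cdot; simpl; field ..]).
Qed.

(** The partial derivatives d2 b + d1 conj a and i (d2 b - d1 conj a) of the
    developing map: a primitive of d2 b dz + conj (d1 a dz), where a dz and b dz are
    the two off-diagonal entries of e^-1 de. *)
Definition dev (d1 d2 : R) (a b : C) (i : dir) : C :=
  match i with
  | dx => (d1 * fst a + d2 * fst b, d2 * snd b - d1 * snd a)
  | dy => (- d1 * snd a - d2 * snd b, d2 * fst b - d1 * fst a)
  end.

Definition cdir (i : dir) : C := match i with dx => 1 | dy => Ci end.

(** On Hermitian matrices the Lorentz form is the polarization of minus the
    determinant, so the frame [e] drops out and the off-diagonal entry of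
    D e^-1 de + (D e^-1 de)^* remains. *)
Lemma lorentz_dhvec d1 d2 e11 e12 e21 e22 a b i j :
  (e11 * e22 - e12 * e21 = 1)%C ->
  let D i := dhvec d1 d2 e11 e12 e21 e22 (cdir i * (e12 * a)) (cdir i * (e11 * b)) (cdir i * (e22 * a)) (cdir i * (e21 * b)) in
  lorentz (D i) (D j) = cdot (dev d1 d2 a b i) (dev d1 d2 a b j).
Proof.
  intros Hdet. cbv zeta.
  transitivity (cdot (e11 * e22 - e12 * e21)%C (e11 * e22 - e12 * e21)%C * cdot (dev d1 d2 a b i) (dev d1 d2 a b j)).
  2: { rewrite Hdet. unfold cdot at 1; simpl; ring. }
  clear Hdet. destruct e11, e12, e21, e22, a, b.
  destruct i, j; unfold lorentz, dhvec, cdot, dev; simpl; ring.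
Qed.

Section Frame.
Variables (e11 e12 e21 e22 : C -> C) (a b z : C).
Hypothesis He11 : cder e11 z (e12 z * a).
Hypothesis He12 : cder e12 z (e11 z * b).
Hypothesis He21 : cder e21 z (e22 z * a).
Hypothesis He22 : cder e22 z (e21 z * b).
Hypothesis Hdet : (e11 z * e22 z - e12 z * e21 z = 1)%C.
Variables (d1 d2 : R) (h : C -> L4).
Hypothesis Hh : forall mu, locally z (fun w => h w mu = hvec d1 d2 (e11 w) (e12 w) (e21 w) (e22 w) mu).

Lemma frame_dmap i mu : dmap i h z mu = dhvec d1 d2 (e11 z) (e12 z) (e21 z) (e22 z)
  (cdir i * (e12 z * a)) (cdir i * (e11 z * b)) (cdir i * (e22 z * a)) (cdir i * (e21 z * b)) mu.
Proof.
  assert (H : rder (fun w => h w mu) z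
   (dhvec d1 d2 (e11 z) (e12 z) (e21 z) (e22 z) (e12 z * a) (e11 z * b) (e22 z * a) (e21 z * b) mu)
   (dhvec d1 d2 (e11 z) (e12 z) (e21 z) (e22 z) (Ci * (e12 z * a)) (Ci * (e11 z * b)) (Ci * (e22 z * a)) (Ci * (e21 z * b)) mu)).
  { eapply rder_ext. 2: apply rder_hvec; eassumption.
    generalize (Hh mu). apply filter_imp. intros w Hw. symmetry. exact Hw. }
  unfold dmap. rewrite (rder_pd _ _ _ _ i H). destruct i; unfold cdir; now rewrite ?Cmult_1_l.
Qed.

Lemma frame_induced i j : induced h i j z = cdot (dev d1 d2 a b i) (dev d1 d2 a b j).
Proof.
  unfold induced. unfold lorentz. rewrite !frame_dmap.
  now apply lorentz_dhvec.
Qed.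
End Frame.

Lemma lorentz_hvec_dhvec e11 e12 e21 e22 a b i :
  lorentz (dhvec 1 1 e11 e12 e21 e22 (cdir i * (e12 * a)) (cdir i * (e11 * b)) (cdir i * (e22 * a)) (cdir i * (e21 * b)))
    (hvec 1 (-1) e11 e12 e21 e22) = 0.
Proof.
  destruct e11, e12, e21, e22, a, b.
  destruct i; unfold lorentz, dhvec, hvec, cdot; simpl; field.
Qed.

Lemma lorentz_hvec d1 d2 c1 c2 e11 e12 e21 e22 :
  (e11 * e22 - e12 * e21 = 1)%C ->
  lorentz (hvec d1 d2 e11 e12 e21 e22) (hvec c1 c2 e11 e12 e21 e22) = - (d1 * c2 + d2 * c1) * / 2.
Proof.
  intros Hdet.
  transitivity (cdot (e11 * e22 - e12 * e21)%C (e11 * e22 - e12 * e21)%C * (- (d1 * c2 + d2 * c1) * / 2)).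
  2: { rewrite Hdet. unfold cdot at 1; simpl; ring. }
  clear Hdet. destruct e11, e12, e21, e22.
  unfold lorentz, hvec, cdot; simpl; field.
Qed.

(** * Flatness of the pulled back Euclidean metric *)

Definition wedge (v w : C) : R := fst v * snd w - snd v * fst w.

Definition dev2 (da db : C) (i j : dir) : C :=
  match i, j with
  | dx, dx => (fst da + fst db, snd db - snd da)
  | dy, dy => (- (fst da + fst db), - (snd db - snd da))
  | _, _ => (- (snd db + snd da), fst db - fst da)
  end.

(** The Levi-Civita connection of the metric pulled back by a local diffeomorphism
    [W] is the pull-back of d: sum_k W_k Gamma^k_ij = W_ij, solved here by Cramer's rule. *)
Definition flat_christoffel (a b da db : C) (k i j : dir) : R :=
  match k with
  | dx => wedge (dev2 da db i j) (dev 1 1 a b dy) * / wedge (dev 1 1 a b dx) (dev 1 1 a b dy)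
  | dy => wedge (dev 1 1 a b dx) (dev2 da db i j) * / wedge (dev 1 1 a b dx) (dev 1 1 a b dy)
  end.

Lemma flat_metric_pd (a b : C -> C) da db (g : tensor2) z :
  (forall i j, locally z (fun w => g i j w = cdot (dev 1 1 (a w) (b w) i) (dev 1 1 (a w) (b w) j))) ->
  cder a z da -> cder b z db -> forall k i j,
  pd k (g i j) z = cdot (dev2 da db k i) (dev 1 1 (a z) (b z) j) + cdot (dev 1 1 (a z) (b z) i) (dev2 da db k j).
Proof.
  rewrite !cder_rder. intros Hg [] [] k i j.
  assert (K : forall p q, rder (fun w => cdot (dev 1 1 (a w) (b w) i) (dev 1 1 (a w) (b w) j)) z p q ->
    pd k (g i j) z = match k with dx => p | dy => q end).
  { intros p q HK. apply rder_pd. eapply rder_ext; [|exact HK].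
    generalize (Hg i j). apply filter_imp. now intros w ->. }
  destruct i, j; (erewrite K; [|unfold cdot; simpl; rder_tac]);
  destruct k; unfold cdot; simpl; ring.
Qed.

Lemma flat_christoffel_eq (a b : C -> C) da db (g : tensor2) z :
  (forall i j, locally z (fun w => g i j w = cdot (dev 1 1 (a w) (b w) i) (dev 1 1 (a w) (b w) j))) ->
  cder a z da -> cder b z db ->
  wedge (dev 1 1 (a z) (b z) dx) (dev 1 1 (a z) (b z) dy) <> 0 -> forall k i j,
  christoffel g k i j z = flat_christoffel (a z) (b z) da db k i j.
Proof.
  intros Hg Ha Hb HD k i j. unfold christoffel, sum_dir, ginv, gdet.
  rewrite !(flat_metric_pd a b da db g z Hg Ha Hb).
  assert (E : forall i j, g i j z = cdot (dev 1 1 (a z) (b z) i) (dev 1 1 (a z) (b z) j)).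
  { intros i' j'. exact (locally_singleton _ _ (Hg i' j')). }
  rewrite !E. unfold flat_christoffel. revert HD. clear.
  generalize (a z) (b z). clear. intros [a1 a2] [b1 b2]. destruct da as [c1 c2], db as [d1 d2].
  unfold wedge, cdot.
  destruct k, i, j; simpl; intros HD; field; repeat split;
   (intros E; apply HD; ((rewrite <- E; ring) || (apply Rsqr_0_uniq; rewrite <- E; unfold Rsqr; ring))).
Qed.

(** With a dz and b dz holomorphic the developing map is harmonic, hence smooth, and its
    connection has no curvature; the proof differentiates the explicit Christoffel
    symbols once more. *)
Lemma flat_gauss_curvature (a b a' b' : C -> C) a'' b'' (g : tensor2) z :
  locally z (fun w => forall i j, g i j w = cdot (dev 1 1 (a w) (b w) i) (dev 1 1 (a w) (b w) j)) ->
  locally z (fun w => cder a w (a' w)) -> locally z (fun w => cder b w (b' w)) ->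
  cder a' z a'' -> cder b' z b'' ->
  wedge (dev 1 1 (a z) (b z) dx) (dev 1 1 (a z) (b z) dy) <> 0 ->
  gauss_curvature g z = 0.
Proof.
  intros Hg Ha Hb Ha' Hb' HD.
  assert (Hc : forall k i j, locally z (fun w => flat_christoffel (a w) (b w) (a' w) (b' w) k i j = christoffel g k i j w)).
  { intros k i j.
    assert (Hg' := locally_locally _ _ Hg).
    assert (L : locally z (fun w => wedge (dev 1 1 (a w) (b w) dx) (dev 1 1 (a w) (b w) dy) <> 0)).
    { apply locally_singleton in Ha, Hb. apply cder_rder in Ha, Hb. destruct Ha, Hb.
      assert (K : exists p q, rder (fun w => wedge (dev 1 1 (a w) (b w) dx) (dev 1 1 (a w) (b w) dy)) z p q).
      { do 2 eexists. unfold wedge; simpl. rder_tac. }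
      destruct K as (p & q & K). apply rder_continuous in K.
      now apply locally_neq. }
    generalize (filter_and _ _ (filter_and _ _ Hg' L) (filter_and _ _ Ha Hb)).
    apply filter_imp. intros w [[G1 G2] [G3 G4]]. symmetry. apply flat_christoffel_eq; trivial.
    intros i' j'. revert G1. apply filter_imp. auto. }
  apply locally_singleton in Ha, Hb.
  assert (Hg0 := locally_singleton _ _ Hg). simpl in Hg0.
  assert (Hc0 : forall k i j, christoffel g k i j z = flat_christoffel (a z) (b z) (a' z) (b' z) k i j)
    by (intros; symmetry; exact (locally_singleton _ _ (Hc k i j))).
  assert (P : forall l k i j p q, rder (fun w => flat_christoffel (a w) (b w) (a' w) (b' w) k i j) z p q ->
    pd l (christoffel g k i j) z = match l with dx => p | dy => q end).
  { intros l k i j p q HK. apply rder_pd. eapply rder_ext; [|exact HK]. apply Hc. }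
  unfold gauss_curvature.
  replace (sum_dir _) with 0. unfold Rdiv; ring. symmetry.
  apply cder_rder in Ha, Hb, Ha', Hb'.
  destruct Ha as [Ha1 Ha2], Hb as [Hb1 Hb2], Ha' as [Ha1' Ha2'], Hb' as [Hb1' Hb2'].
  assert (forall l, riemann g l dy dx dy z = 0) as R0.
  2:{ unfold sum_dir. rewrite !R0. ring. }
  intros l. unfold riemann, sum_dir.
  destruct l.
  all: erewrite (P dx) by (unfold flat_christoffel, wedge; simpl;
         apply rder_mult; [rder_tac | apply rder_inv; [exact HD | rder_tac]]).
  all: erewrite (P dy) by (unfold flat_christoffel, wedge; simpl;
         apply rder_mult; [rder_tac | apply rder_inv; [exact HD | rder_tac]]).
  all: rewrite !Hc0; unfold flat_christoffel; revert HD; unfold wedge; clear;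
    destruct (a z), (b z), (a' z), (b' z), a'', b''; simpl; intros HD;
    field; intros E; apply HD; rewrite <- E; ring.
Qed.

(** * The holomorphic frame *)

(** G - G_* = z Qp / (2 z + 5). *)
Definition Qp (z : C) : C := ((z - 1) * (z + 2) * (2 * z + 3))%C.

Lemma M0_factors z : M0 z -> z <> 0 /\ (z - 1)%C <> 0 /\ (z + 2)%C <> 0 /\
  (2 * z + 3)%C <> 0 /\ (z + RtoC (3/2))%C <> RtoC 0.
Proof.
  intros (H0 & H1 & H2 & H3). destruct z as [x y]. repeat split; trivial; intros E;
  [apply H1 | apply H2 | apply H3 | apply H3];
  apply (f_equal fst) in E as E1; apply (f_equal snd) in E as E2; simpl in *; apply C_ext; simpl; lra.
Qed.

Lemma Qp_neq0 z : M0 z -> Qp z <> RtoC 0.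
Proof.
  intros H. destruct (M0_factors z H) as (H0 & H1 & H2 & H3 & _).
  unfold Qp. repeat apply Cmult_neq_0; trivial.
Qed.

Lemma open_neq_C (c : C) : open (fun z : C => z <> c).
Proof.
  intros z Hz. apply Cminus_eq_contra in Hz. assert (L := locally_neq0 (fun w => w - c)%C z ltac:(cinf_tac) Hz).
  revert L. apply filter_imp. intros w Hw ->. apply Hw. ring.
Qed.

Lemma open_M0 : open M0.
Proof.
  apply open_and. apply open_neq_C. apply open_and. apply open_neq_C.
  apply open_and; apply open_neq_C.
Qed.

(** The modulus of the multivalued function xi = (z - 1)^(7/5) (z + 2)^(-2) (z + 3/2)^(18/5),
    which satisfies d log xi = dG / (G - G_* ); the real exponents make it single-valued. *)
Definition rad (z : C) : R :=
  exp (7/10 * ln (sqn (z - 1)) + 9/5 * ln (sqn (z + RtoC (3/2)))) * / sqn (z + 2).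

Lemma rad_pos z : z <> RtoC (-2) -> 0 < rad z.
Proof.
  intros H. unfold rad. apply Rmult_lt_0_compat. apply exp_pos. apply Rinv_0_lt_compat, sqn_pos.
  intros E. apply H. apply (f_equal fst) in E as E1; apply (f_equal snd) in E as E2; simpl in *.
  apply C_ext; simpl; lra.
Qed.

Lemma rad_pos_M0 z : M0 z -> 0 < rad z.
Proof. intros (_ & _ & H & _). now apply rad_pos. Qed.

(** The local branch of xi(z) / xi(p) with value 1 at [p]. *)
Definition branch (p z : C) : C :=
  (cexp (RtoC (7/5) * clog ((z - 1) / (p - 1)) + RtoC (18/5) * clog ((z + RtoC (3/2)) / (p + RtoC (3/2))))
   * ((p + 2) / (z + 2) * ((p + 2) / (z + 2))))%C.

(** The logarithmic derivative of xi. *)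
Definition eta (z : C) : C := (3 * z * (2 * z + 5) / Qp z)%C.

Definition branch_dom (p z : C) : Prop :=
  M0 z /\ 0 < fst ((z - 1) / (p - 1))%C /\ 0 < fst ((z + RtoC (3/2)) / (p + RtoC (3/2)))%C.

Lemma branch_self p : M0 p -> branch p p = RtoC 1.
Proof.
  intros H. destruct (M0_factors p H) as (H0 & H1 & H2 & H3 & H4).
  unfold branch. replace ((p - 1) / (p - 1))%C with (RtoC 1) by (field; trivial).
  replace ((p + RtoC (3/2)) / (p + RtoC (3/2)))%C with (RtoC 1) by (field; trivial).
  rewrite clog_1, !Cmult_0_r, Cplus_0_r, cexp_0. field. trivial.
Qed.

Lemma cder_branch p z : M0 p -> branch_dom p z -> cder (branch p) z (eta z * branch p z).
Proof.
  intros Hp (Hz & L1 & L2). destruct (M0_factors p Hp) as (P0 & P1 & P2 & P3 & P4).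
  destruct (M0_factors z Hz) as (Z0 & Z1 & Z2 & Z3 & Z4).
  eapply cder_eq.
  - unfold branch. apply cder_mult.
    + apply (cder_comp cexp). apply cder_cexp.
      apply cder_plus; (apply cder_mult; [apply cder_const|]).
      * apply (cder_comp clog). apply cder_clog; exact L1. apply cder_div; [trivial|cder_tac..].
      * apply (cder_comp clog). apply cder_clog; exact L2. apply cder_div; [trivial|cder_tac..].
    + apply cder_mult; (apply cder_div; [trivial|cder_tac..]).
  - unfold branch, eta, Qp.
    set (ee := cexp _). simpl.
    assert (Z4' : (z + 3 / 2)%C <> 0). { rewrite <- RtoC_div by lra. exact Z4. }
    assert (P4' : (p + 3 / 2)%C <> 0). { rewrite <- RtoC_div by lra. exact P4. }
    rewrite !RtoC_div by lra.
    field.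
    repeat split; trivial; try (intros E; apply RtoC_inj in E; lra).
    rewrite (Cmult_comm p); exact P3.
Qed.

Lemma fst_clog_div a b : sqn a <> 0 -> sqn b <> 0 -> fst (clog (a / b)) = / 2 * (ln (sqn a) - ln (sqn b)).
Proof.
  intros Ha Hb. pose proof (sqn_ge0 a). pose proof (sqn_ge0 b).
  unfold clog; simpl fst. f_equal. change (ln (sqn (a / b)%C) = ln (sqn a) - ln (sqn b)).
  rewrite sqn_div by (apply sqn_neq0; lra). apply ln_div; lra.
Qed.

Lemma sqn_branch p z : M0 p -> M0 z -> sqn (branch p z) * (rad p * rad p) = rad z * rad z.
Proof.
  intros Hp Hz. destruct (M0_factors p Hp) as (P0 & P1 & P2 & P3 & P4).
  destruct (M0_factors z Hz) as (Z0 & Z1 & Z2 & Z3 & Z4).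
  apply sqn_pos in P1, P2, P4, Z1, Z2, Z4.
  unfold branch. rewrite !sqn_mult, !sqn_div, sqn_cexp by (now apply sqn_neq0).
  assert (E : fst (RtoC (7/5) * clog ((z - 1) / (p - 1)) + RtoC (18/5) * clog ((z + RtoC (3/2)) / (p + RtoC (3/2))))%C
     = 7/5 * (/ 2 * (ln (sqn (z - 1)) - ln (sqn (p - 1)))) + 18/5 * (/ 2 * (ln (sqn (z + RtoC (3/2))) - ln (sqn (p + RtoC (3/2)))))).
  { rewrite <- !fst_clog_div by lra. simpl. ring. }
  rewrite E. unfold rad. set (l1 := ln (sqn (z - 1))). set (l2 := ln (sqn (p - 1))).
  set (l3 := ln (sqn (z + RtoC (3/2)))). set (l4 := ln (sqn (p + RtoC (3/2)))).
  replace (2 * (7 / 5 * (/ 2 * (l1 - l2)) + 18 / 5 * (/ 2 * (l3 - l4)))) with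
   ((7/10 * l1 + 9/5 * l3) + (7/10 * l1 + 9/5 * l3) + - (7/10 * l2 + 9/5 * l4) + - (7/10 * l2 + 9/5 * l4)) by field.
  rewrite !(exp_plus _ (- _)), (exp_plus (7/10 * l1 + 9/5 * l3) (7/10 * l1 + 9/5 * l3)), !exp_Ropp.
  pose proof (exp_pos (7/10 * l2 + 9/5 * l4)). field. lra.
Qed.

(** The entries of the frame, as functions of the value [x] of xi and of [z]: the columns
    are (G, 1) / xi and (G_*, 1) xi / (G - G_* ), cleared of the pole of G_* at -5/2. *)
Definition e11 (x z : C) : C := (z * z * z / x)%C.
Definition e12 (x z : C) : C := (x * (z + 6) / Qp z)%C.
Definition e21 (x z : C) : C := (/ x)%C.
Definition e22 (x z : C) : C := (x * (2 * z + 5) / (z * Qp z))%C.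
(** The off-diagonal entries omega = - dG / xi^2 and theta = xi^2 dG_* / (G - G_* )^2
    of the Maurer-Cartan form of the frame. *)
Definition om (x z : C) : C := (- 3 * z * z / (x * x))%C.
Definition th (x z : C) : C := (2 * (z * z + 5 * z + 15) * (x * x) / (z * z * (Qp z * Qp z)))%C.

Lemma e_det (x z : C) : M0 z -> x <> 0 -> (e11 x z * e22 x z - e12 x z * e21 x z = 1)%C.
Proof.
  intros Hz Hx. destruct (M0_factors z Hz) as (Z0 & Z1 & Z2 & Z3 & Z4).
  unfold e11, e12, e21, e22, Qp. field. auto.
Qed.

Lemma om_neq0 (x z : C) : M0 z -> x <> 0 -> om x z <> 0.
Proof.
  intros Hz Hx E. apply (Cmult_neq_0 (-3 * z) z); [|apply Hz|].
  apply Cmult_neq_0; [apply RtoC_neq0; lra | apply Hz].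
  transitivity (om x z * (x * x))%C. unfold om; field; trivial. rewrite E. ring.
Qed.

Lemma Qp_cder z : cder Qp z (6 * z * z + 10 * z - 1)%C.
Proof. eapply cder_eq. unfold Qp. cder_tac. simpl. ring. Qed.

Section Dev.
Variables (xi : C -> C) (z : C).
Hypothesis Hz : M0 z.
Hypothesis Hxi0 : xi z <> RtoC 0.
Hypothesis Hxi : cder xi z (eta z * xi z).

Let F := M0_factors z Hz.

Lemma cder_e11 : cder (fun w => e11 (xi w) w) z (e12 (xi z) z * om (xi z) z).
Proof.
  destruct F as (Z0 & Z1 & Z2 & Z3 & Z4). eapply cder_eq. unfold e11. apply cder_div; [trivial|cder_tac..].
  unfold e12, om, eta, Qp. field. auto.
Qed.
Lemma cder_e21 : cder (fun w => e21 (xi w) w) z (e22 (xi z) z * om (xi z) z).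
Proof.
  destruct F as (Z0 & Z1 & Z2 & Z3 & Z4). eapply cder_eq. unfold e21. apply cder_inv; [trivial|cder_tac..].
  unfold e22, om, eta, Qp. field. auto.
Qed.
Lemma cder_e12 : cder (fun w => e12 (xi w) w) z (e11 (xi z) z * th (xi z) z).
Proof.
  destruct F as (Z0 & Z1 & Z2 & Z3 & Z4). eapply cder_eq. unfold e12. apply cder_div; [now apply Qp_neq0|cder_tac|apply Qp_cder].
  unfold e11, th, eta, Qp. simpl. field. auto.
Qed.
Lemma cder_e22 : cder (fun w => e22 (xi w) w) z (e21 (xi z) z * th (xi z) z).
Proof.
  destruct F as (Z0 & Z1 & Z2 & Z3 & Z4). eapply cder_eq. unfold e22. apply cder_div; [|cder_tac|apply cder_mult; [apply cder_id | apply Qp_cder]].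
  apply Cmult_neq_0; trivial. now apply Qp_neq0.
  unfold e21, th, eta, Qp. simpl. field. auto.
Qed.

(** The derivatives of [om] and [th] along a branch of xi. *)
Definition dom (x z : C) : C := (om x z * (2 / z - 2 * eta z))%C.
Definition dth (x z : C) : C := (2 * (x * x) *
   (2 * eta z * (z * z + 5 * z + 15) + (2 * z + 5)
     - 2 * (z * z + 5 * z + 15) * (/ z + (6 * z * z + 10 * z - 1) / Qp z)) / (z * z * (Qp z * Qp z)))%C.

Lemma cder_om : cder (fun w => om (xi w) w) z (dom (xi z) z).
Proof.
  destruct F as (Z0 & Z1 & Z2 & Z3 & Z4). eapply cder_eq. unfold om. apply cder_div; [now apply Cmult_neq_0|cder_tac..].
  unfold dom, om, eta, Qp. simpl. field. auto.
Qed.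
Lemma cder_th : cder (fun w => th (xi w) w) z (dth (xi z) z).
Proof.
  destruct F as (Z0 & Z1 & Z2 & Z3 & Z4). assert (HQ := Qp_neq0 z Hz).
  eapply cder_eq. unfold th. apply cder_div; [repeat apply Cmult_neq_0; trivial|cder_tac|
   apply cder_mult; [cder_tac|apply cder_mult; apply Qp_cder]].
  unfold dth. simpl. field. auto.
Qed.

Lemma ex_cder_eta : exists l, cder eta z l.
Proof. eexists. unfold eta. apply cder_div; [now apply Qp_neq0|cder_tac|apply Qp_cder]. Qed.

Lemma ex_cder_dom : exists l, cder (fun w => dom (xi w) w) z l.
Proof.
  destruct F as (Z0 & Z1 & Z2 & Z3 & Z4). destruct ex_cder_eta as [l Hl]. eexists. unfold dom. apply cder_mult. apply cder_om.
  apply cder_minus. apply cder_div; [trivial|cder_tac..]. apply cder_mult; [apply cder_const|exact Hl].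
Qed.
Lemma ex_cder_dth : exists l, cder (fun w => dth (xi w) w) z l.
Proof.
  destruct F as (Z0 & Z1 & Z2 & Z3 & Z4). assert (HQ := Qp_neq0 z Hz). destruct ex_cder_eta as [l Hl].
  eexists. unfold dth. apply cder_div.
  repeat apply Cmult_neq_0; trivial.
  2: apply cder_mult; [cder_tac|apply cder_mult; apply Qp_cder].
  apply cder_mult. cder_tac.
  apply cder_minus. cder_tac.
  apply cder_mult. cder_tac. apply cder_plus. apply cder_inv. trivial. cder_tac.
  apply cder_div; [trivial|cder_tac|apply Qp_cder].
Qed.
End Dev.

(** * The flat front *)

(** The frame evaluated at |xi| in place of xi: the phase of xi cancels in
    e diag(d1, d2) e^*, so the front is single-valued although the frame is not. *)
Definition fr (d1 d2 : R) (z : C) : L4 :=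
  hvec d1 d2 (e11 (rad z) z) (e12 (rad z) z) (e21 (rad z) z) (e22 (rad z) z).

Lemma hvec_phase d1 d2 x z mu : M0 z -> sqn x = rad z * rad z ->
  hvec d1 d2 (e11 x z) (e12 x z) (e21 x z) (e22 x z) mu = fr d1 d2 z mu.
Proof.
  intros Hz Hx. pose proof (rad_pos_M0 z Hz) as Hr.
  destruct (M0_factors z Hz) as (Z0 & Z1 & Z2 & Z3 & Z4). assert (HQ := Qp_neq0 z Hz).
  set (r := RtoC (rad z)). assert (Hr0 : r <> 0) by (apply RtoC_neq0; lra).
  set (u := (x / r)%C). assert (Hxu : x = (u * r)%C) by (unfold u; field; trivial).
  assert (Hu : sqn u = 1). { unfold u. rewrite sqn_div, Hx by trivial. unfold r. rewrite sqn_RtoC. field. lra. }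
  assert (Hu0 : u <> 0) by (apply sqn_neq0; lra).
  clearbody u.
  assert (Hi : (/ u)%C = Cconj u).
  { assert (Hc : (Cconj u * u)%C = 1) by (apply C_ext; [simpl; rewrite <- Hu; unfold sqn, cdot; ring | simpl; ring]).
    transitivity ((Cconj u * u) * / u)%C; [rewrite Hc; ring | field; trivial]. }
  unfold fr. fold r.
  replace (e11 x z) with (Cconj u * e11 r z)%C by (rewrite <- Hi; unfold e11; rewrite Hxu; field; auto).
  replace (e21 x z) with (Cconj u * e21 r z)%C by (rewrite <- Hi; unfold e21; rewrite Hxu; field; auto).
  replace (e12 x z) with (u * e12 r z)%C by (unfold e12; rewrite Hxu; field; auto).
  replace (e22 x z) with (u * e22 r z)%C by (unfold e22; rewrite Hxu; field; auto).
  generalize (e11 r z) (e12 r z) (e21 r z) (e22 r z). clear - Hu. intros a b c d.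
  rewrite <- (Rmult_1_l (hvec d1 d2 a b c d mu)). rewrite <- Hu.
  destruct mu; unfold hvec, sqn, cdot; simpl; field.
Qed.

(** The branch of xi near [p] with value [x0] at [p]. *)
Definition xi_of (x0 p z : C) : C := (x0 * branch p z)%C.

Definition xi_spec (x0 p z : C) : Prop :=
  M0 z /\ xi_of x0 p z <> 0 /\ sqn (xi_of x0 p z) = rad z * rad z /\
  cder (xi_of x0 p) z (eta z * xi_of x0 p z).

Lemma locally_branch_dom p : M0 p -> locally p (branch_dom p).
Proof.
  intros Hp. destruct (M0_factors p Hp) as (P0 & P1 & P2 & P3 & P4).
  assert (K : forall b : C, (p + b)%C <> 0 -> locally p (fun z => 0 < fst ((z + b) / (p + b))%C)).
  { intros b Hb. apply locally_gt.
    assert (H : exists l, cder (fun z => (z + b) / (p + b))%C p l) by (eexists; apply cder_div; [trivial|cder_tac..]).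
    destruct H as [l H]. apply cder_rder in H. eapply rder_continuous, H.
    replace ((p + b) / (p + b))%C with (RtoC 1) by (field; trivial). simpl; lra. }
  apply filter_and; [now apply open_M0|]. apply filter_and; now apply K.
Qed.

Lemma locally_xi_spec x0 p : M0 p -> sqn x0 = rad p * rad p -> locally p (xi_spec x0 p).
Proof.
  intros Hp Hx. pose proof (rad_pos_M0 p Hp) as Hrp.
  generalize (locally_branch_dom p Hp). apply filter_imp. intros z Hd. assert (Hz := proj1 Hd).
  pose proof (rad_pos_M0 z Hz) as Hrz.
  assert (E : sqn (xi_of x0 p z) = rad z * rad z).
  { unfold xi_of. rewrite sqn_mult, Hx, Rmult_comm. now apply sqn_branch. }
  repeat split; trivial; try apply Hz.
  - apply sqn_neq0. rewrite E. nra.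
  - eapply cder_eq. unfold xi_of. apply cder_mult. apply cder_const. apply cder_branch; trivial.
    unfold xi_of. ring.
Qed.

Lemma xi_of_self x0 p : M0 p -> xi_of x0 p p = x0.
Proof. intros H. unfold xi_of. rewrite branch_self by trivial. ring. Qed.

Lemma fr_local d1 d2 x0 p mu z : locally z (xi_spec x0 p) ->
  locally z (fun w => fr d1 d2 w mu = hvec d1 d2 (e11 (xi_of x0 p w) w) (e12 (xi_of x0 p w) w)
     (e21 (xi_of x0 p w) w) (e22 (xi_of x0 p w) w) mu).
Proof.
  apply filter_imp. intros w (Hw & _ & E & _). symmetry. now apply hvec_phase.
Qed.

Lemma fr_dmap_spec d1 d2 x0 p z i mu : locally z (xi_spec x0 p) -> let x := xi_of x0 p z in
  dmap i (fr d1 d2) z mu = dhvec d1 d2 (e11 x z) (e12 x z) (e21 x z) (e22 x z)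
  (cdir i * (e12 x z * om x z)) (cdir i * (e11 x z * th x z))
  (cdir i * (e22 x z * om x z)) (cdir i * (e21 x z * th x z)) mu.
Proof.
  intros H x. destruct (locally_singleton _ _ H) as (Hz & Hx & Hs & Hc).
  apply (frame_dmap (fun w => e11 (xi_of x0 p w) w) (fun w => e12 (xi_of x0 p w) w)
    (fun w => e21 (xi_of x0 p w) w) (fun w => e22 (xi_of x0 p w) w)).
  now apply cder_e11. now apply cder_e12. now apply cder_e21. now apply cder_e22.
  intros mu'. now apply fr_local.
Qed.

Lemma fr_induced_spec d1 d2 x0 p z i j : locally z (xi_spec x0 p) -> let x := xi_of x0 p z in
  induced (fr d1 d2) i j z = cdot (dev d1 d2 (om x z) (th x z) i) (dev d1 d2 (om x z) (th x z) j).
Proof.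
  intros H x. destruct (locally_singleton _ _ H) as (Hz & Hx & Hs & Hc).
  apply (frame_induced (fun w => e11 (xi_of x0 p w) w) (fun w => e12 (xi_of x0 p w) w)
    (fun w => e21 (xi_of x0 p w) w) (fun w => e22 (xi_of x0 p w) w)).
  now apply cder_e11. now apply cder_e12. now apply cder_e21. now apply cder_e22.
  now apply e_det.
  intros mu'. now apply fr_local.
Qed.

Lemma sqn_rad z : sqn (RtoC (rad z)) = rad z * rad z.
Proof. apply sqn_RtoC. Qed.

Definition omr (z : C) : C := om (rad z) z.
Definition thr (z : C) : C := th (rad z) z.

Lemma fr_dmap d1 d2 z i mu : M0 z -> let x := RtoC (rad z) in
  dmap i (fr d1 d2) z mu = dhvec d1 d2 (e11 x z) (e12 x z) (e21 x z) (e22 x z)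
  (cdir i * (e12 x z * omr z)) (cdir i * (e11 x z * thr z))
  (cdir i * (e22 x z * omr z)) (cdir i * (e21 x z * thr z)) mu.
Proof.
  intros Hz x. rewrite (fr_dmap_spec d1 d2 x z z).
  now rewrite !xi_of_self. apply locally_xi_spec; trivial. apply sqn_rad.
Qed.

Lemma fr_induced d1 d2 z i j : M0 z ->
  induced (fr d1 d2) i j z = cdot (dev d1 d2 (omr z) (thr z) i) (dev d1 d2 (omr z) (thr z) j).
Proof.
  intros Hz. rewrite (fr_induced_spec d1 d2 (rad z) z z).
  now rewrite !xi_of_self. apply locally_xi_spec; trivial. apply sqn_rad.
Qed.

Lemma rad_neq0 z : M0 z -> RtoC (rad z) <> 0.
Proof. intros Hz. apply RtoC_neq0, Rgt_not_eq, rad_pos_M0, Hz. Qed.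

Lemma omr_neq0 z : M0 z -> omr z <> 0.
Proof. intros Hz. now apply om_neq0, rad_neq0. Qed.

Lemma sum_sqr_0 x y : x ^ 2 + y ^ 2 = 0 -> x = 0 /\ y = 0.
Proof. intros H. split; nra. Qed.

(** A direction killed by dh is a null direction of the first fundamental form, and so
    it is killed by the developing map. *)
Lemma fr_kernel d1 d2 z a b : M0 z ->
  (forall mu, a * dmap dx (fr d1 d2) z mu + b * dmap dy (fr d1 d2) z mu = 0) ->
  a * fst (dev d1 d2 (omr z) (thr z) dx) + b * fst (dev d1 d2 (omr z) (thr z) dy) = 0 /\
  a * snd (dev d1 d2 (omr z) (thr z) dx) + b * snd (dev d1 d2 (omr z) (thr z) dy) = 0.
Proof.
  intros Hz H.
  assert (K : a * a * induced (fr d1 d2) dx dx z + a * b * induced (fr d1 d2) dx dy z + a * b * induced (fr d1 d2) dy dx z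
    + b * b * induced (fr d1 d2) dy dy z = 0).
  { unfold induced. set (X := dmap dx (fr d1 d2) z) in *. set (Y := dmap dy (fr d1 d2) z) in *.
    transitivity (lorentz (fun mu => a * X mu + b * Y mu) (fun mu => a * X mu + b * Y mu)).
    unfold lorentz; ring. unfold lorentz. rewrite !H. ring. }
  rewrite !fr_induced in K by trivial.
  destruct (dev d1 d2 (omr z) (thr z) dx) as [u v], (dev d1 d2 (omr z) (thr z) dy) as [r s].
  unfold cdot in K; simpl in *.
  apply sum_sqr_0. rewrite <- K; ring.
Qed.

Lemma fr_immersed d1 d2 z : M0 z -> wedge (dev d1 d2 (omr z) (thr z) dx) (dev d1 d2 (omr z) (thr z) dy) <> 0 ->
  immersed_at (fr d1 d2) z.
Proof.
  intros Hz HD a b H. apply fr_kernel in H; trivial. destruct H as [H1 H2].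
  destruct (dev d1 d2 (omr z) (thr z) dx) as [u v], (dev d1 d2 (omr z) (thr z) dy) as [r s].
  unfold wedge in HD; simpl in *.
  assert (E1 : a * (u * s - v * r) = 0) by (transitivity (s * (a * u + b * r) - r * (a * v + b * s)); [ring | rewrite H1, H2; ring]).
  assert (E2 : b * (u * s - v * r) = 0) by (transitivity (u * (a * v + b * s) - v * (a * u + b * r)); [ring | rewrite H1, H2; ring]).
  split; [apply Rmult_integral in E1 | apply Rmult_integral in E2]; tauto.
Qed.

Lemma wedge_dev d1 d2 a b : wedge (dev d1 d2 a b dx) (dev d1 d2 a b dy) = d2 * d2 * sqn b - d1 * d1 * sqn a.
Proof. unfold wedge, sqn, cdot; simpl; ring. Qed.

Lemma fr_curvature d1 d2 z : M0 z -> wedge (dev d1 d2 (omr z) (thr z) dx) (dev d1 d2 (omr z) (thr z) dy) <> 0 ->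
  gauss_curvature (induced (fr d1 d2)) z = 0.
Proof.
  intros Hz HD. set (x0 := RtoC (rad z)).
  assert (L : locally z (xi_spec x0 z)) by (apply locally_xi_spec; [trivial | apply sqn_rad]).
  set (xi := xi_of x0 z).
  destruct (locally_singleton _ _ L) as (_ & Hx & Hs & Hc).
  destruct (ex_cder_dom xi z Hz Hx Hc) as [l1 Hl1]. destruct (ex_cder_dth xi z Hz Hc) as [l2 Hl2].
  apply (flat_gauss_curvature (fun w => d1 * om (xi w) w)%C (fun w => d2 * th (xi w) w)%C
    (fun w => d1 * dom (xi w) w)%C (fun w => d2 * dth (xi w) w)%C (0 * dom (xi z) z + d1 * l1)%C (0 * dth (xi z) z + d2 * l2)%C).
  - generalize (locally_locally _ _ L). apply filter_imp. intros w Hw i j.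
    rewrite (fr_induced_spec d1 d2 x0 z w) by trivial. fold xi.
    generalize (om (xi w) w) (th (xi w) w). clear. intros o s.
    destruct i, j; unfold cdot; simpl; ring.
  - revert L. apply filter_imp. intros w (Hw & Hxw & _ & Hcw). fold xi in Hxw, Hcw. eapply cder_eq. apply cder_mult.
    apply cder_const. apply cder_om; trivial. cbv beta. ring.
  - revert L. apply filter_imp. intros w (Hw & Hxw & _ & Hcw). fold xi in Hxw, Hcw. eapply cder_eq. apply cder_mult.
    apply cder_const. apply cder_th; trivial. cbv beta. ring.
  - exact (cder_mult (fun _ => RtoC d1) _ z _ _ (cder_const _ _) Hl1).
  - exact (cder_mult (fun _ => RtoC d2) _ z _ _ (cder_const _ _) Hl2).
  - unfold xi. rewrite xi_of_self by trivial. change (om x0 z) with (omr z). change (th x0 z) with (thr z). intros E. apply HD. rewrite <- E.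
    generalize (omr z) (thr z). clear. intros o s. unfold wedge; simpl; ring.
Qed.

Lemma Cinf_rad U : (forall z, U z -> M0 z) -> Cinf U rad.
Proof.
  intros HU. assert (F := fun z Hz => M0_factors z (HU z Hz)).
  unfold rad. cinf_real; intros z Hz; try apply Rgt_not_eq; apply sqn_pos, F, Hz.
Qed.

Lemma CCinf_Qp U : CCinf U Qp.
Proof. unfold Qp. cinf_tac. Qed.

Lemma Cinf_fr (U : C -> Prop) d1 d2 mu : open U -> (forall z, U z -> M0 z) -> Cinf U (fun z => fr d1 d2 z mu).
Proof.
  intros HO HU. assert (Hr := Cinf_rad U HU). assert (HQ := CCinf_Qp U).
  assert (Hrc : CCinf U (fun z => RtoC (rad z))) by now apply CCinf_RtoC.
  assert (Hr0 : forall z, U z -> RtoC (rad z) <> 0).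
  { intros z Hz E. apply RtoC_inj in E. pose proof (rad_pos_M0 z (HU z Hz)). lra. }
  assert (HQ0 : forall z, U z -> Qp z <> 0) by (intros z Hz; apply Qp_neq0; auto).
  assert (Hz0 : forall z, U z -> z <> 0) by (intros z Hz; apply (M0_factors z); auto).
  assert (H11 : CCinf U (fun z => e11 (rad z) z)) by (unfold e11; apply CCinf_div; trivial; cinf_tac).
  assert (H21 : CCinf U (fun z => e21 (rad z) z)) by (unfold e21; apply CCinf_inv; trivial; cinf_tac).
  assert (H12 : CCinf U (fun z => e12 (rad z) z)) by (unfold e12; apply CCinf_div; trivial; cinf_tac).
  assert (H22 : CCinf U (fun z => e22 (rad z) z)).
  { unfold e22; apply CCinf_div; trivial; cinf_tac. intros z Hz. apply Cmult_neq_0; auto. }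
  destruct H11, H12, H21, H22.
  destruct mu; unfold fr, hvec, cdot; cinf_real.
Qed.

Lemma Cinf_induced U h i j : open U -> (forall mu, Cinf U (fun z => h z mu)) -> Cinf U (induced h i j).
Proof.
  intros HU H. unfold induced, lorentz, dmap.
  repeat first [ apply Cinf_plus | apply Cinf_opp | apply Cinf_mult | apply Cinf_pd ]; auto.
Qed.

Lemma parallel_fr t : parallel (fr 1 1) (fr 1 (-1)) t = fr (cosh t + sinh t) (cosh t - sinh t).
Proof.
  apply FunctionalExtensionality.functional_extensionality. intros z.
  apply FunctionalExtensionality.functional_extensionality. intros mu.
  unfold parallel, fr. destruct mu; unfold hvec; ring.
Qed.

(** The determinant of the first fundamental form is the square of
    |d2 theta|^2 - |d1 omega|^2. *)
Lemma fr_flat_immersion d1 d2 p : M0 p -> d2 * d2 * sqn (thr p) - d1 * d1 * sqn (omr p) <> 0 ->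
  flat_immersion_at M0 (fr d1 d2) p.
Proof.
  intros Hp HD. rewrite <- wedge_dev in HD.
  assert (K : forall z, M0 z -> gdet (induced (fr d1 d2)) z = wedge (dev d1 d2 (omr z) (thr z) dx) (dev d1 d2 (omr z) (thr z) dy) ^ 2).
  { intros z Hz. unfold gdet. rewrite !fr_induced by trivial. unfold wedge, cdot. ring. }
  assert (L : locally p (fun z => gdet (induced (fr d1 d2)) z <> 0)).
  { apply locally_neq. 2: rewrite K by trivial; now apply pow_nonzero.
    assert (Cs : forall i j, Cinf M0 (induced (fr d1 d2) i j)).
    { intros i j. apply Cinf_induced. apply open_M0. intros mu. apply Cinf_fr; auto using open_M0. }
    apply (Cinf_continuous M0); trivial.
    apply Cinf_minus; apply Cinf_mult; apply Cs. }
  unfold flat_immersion_at. generalize (filter_and _ _ L (open_M0 p Hp)). apply filter_imp. intros z [Hz1 Hz].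
  rewrite K in Hz1 by trivial.
  assert (wedge (dev d1 d2 (omr z) (thr z) dx) (dev d1 d2 (omr z) (thr z) dy) <> 0).
  { intros E. apply Hz1. rewrite E. ring. }
  split; trivial. split. now apply fr_immersed. now apply fr_curvature.
Qed.

(** (f, n) is an immersion: a common kernel direction of df and dn annihilates omega,
    which has no zero. *)
Lemma fr_kernel_pair z a b : M0 z ->
  (forall mu, a * dmap dx (fr 1 1) z mu + b * dmap dy (fr 1 1) z mu = 0) ->
  (forall mu, a * dmap dx (fr 1 (-1)) z mu + b * dmap dy (fr 1 (-1)) z mu = 0) -> a = 0 /\ b = 0.
Proof.
  intros Hz H H0. apply fr_kernel in H, H0; trivial. pose proof (sqn_pos _ (omr_neq0 z Hz)) as Ho.
  destruct (omr z) as [o1 o2], (thr z) as [s1 s2]. unfold sqn, cdot in Ho. simpl in *.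
  destruct H as [K1 K2], H0 as [K3 K4].
  assert (E1 : a * o1 - b * o2 = 0) by lra. assert (E2 : a * o2 + b * o1 = 0) by lra.
  assert (E : (a * a + b * b) * (o1 * o1 + o2 * o2) = 0).
  { transitivity ((a * o1 - b * o2) ^ 2 + (a * o2 + b * o1) ^ 2). ring. rewrite E1, E2; ring. }
  apply Rmult_integral in E. destruct E; [apply sum_sqr_0 | ]; lra.
Qed.

Lemma fr_is_front : is_front M0 (fr 1 1) (fr 1 (-1)).
Proof.
  split; [|split].
  - intros mu. apply Cinf_smooth. apply open_M0. apply Cinf_fr; auto using open_M0.
  - intros mu. apply Cinf_smooth. apply open_M0. apply Cinf_fr; auto using open_M0.
  - intros z Hz. pose proof (rad_pos_M0 z Hz) as Hr.
    assert (Hr0 : RtoC (rad z) <> 0) by (apply RtoC_neq0; lra).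
    assert (Hdet := e_det (rad z) z Hz Hr0).
    repeat split.
    + exists [[e11 (rad z) z, e12 (rad z) z], [e21 (rad z) z, e22 (rad z) z]]. split.
      * exact Hdet.
      * unfold fr. rewrite herm_hvec, (mmul_entries (e11 _ _)). do 2 f_equal; repeat (apply f_equal2; trivial); ring.
    + unfold fr. rewrite lorentz_hvec by trivial. field.
    + unfold fr. rewrite lorentz_hvec by trivial. field.
    + intros d. unfold lorentz. rewrite !fr_dmap by trivial. unfold fr.
      apply (lorentz_hvec_dhvec (e11 (rad z) z) (e12 (rad z) z) (e21 (rad z) z) (e22 (rad z) z)).
    + apply (fr_kernel_pair z a b); trivial.
    + apply (fr_kernel_pair z a b); trivial.
Qed.

(** Where |theta| and |omega| agree the front itself is singular, but its parallel fronts
    are not, since omega does not vanish. *)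
Lemma fr_is_flat_front : is_flat_front M0 (fr 1 1) (fr 1 (-1)).
Proof.
  split. apply fr_is_front.
  intros p Hp.
  pose proof (sqn_pos _ (omr_neq0 p Hp)) as Ho.
  destruct (Req_dec (sqn (thr p)) (sqn (omr p))) as [E|E].
  - exists 1. rewrite parallel_fr. apply fr_flat_immersion; trivial. rewrite E.
    replace (cosh 1 + sinh 1) with (exp 1) by (unfold cosh, sinh; field).
    replace (cosh 1 - sinh 1) with (exp (- (1))) by (unfold cosh, sinh; field).
    assert (exp (- (1)) < exp 1) by (apply exp_increasing; lra). pose proof (exp_pos (-(1))).
    assert (exp (- (1)) * exp (- (1)) < exp 1 * exp 1) by nra. nra.
  - exists 0. rewrite parallel_fr. apply fr_flat_immersion; trivial.
    rewrite cosh_0, sinh_0. intros K. apply E. lra.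
Qed.

(** * Behaviour at the ends *)

(** The norms of omega and theta with respect to |dz|. *)
Definition norm_om (z : C) : R := Cmod (omr z).
Definition norm_th (z : C) : R := Cmod (thr z).

(** Half the numerator of dG_*; its roots are the critical points of G_*. *)
Definition crit_poly (z : C) : C := (z * z + 5 * z + 15)%C.

Lemma norm_om_sqr z : M0 z -> norm_om z ^ 2 = 9 * sqn z ^ 2 / rad z ^ 4.
Proof.
  intros Hz. pose proof (rad_pos_M0 z Hz) as Hr.
  assert (Hr0 : RtoC (rad z) <> RtoC 0) by (apply RtoC_neq0; lra).
  unfold norm_om. rewrite <- sqn_Cmod. unfold omr, om.
  rewrite sqn_div by (now apply Cmult_neq_0). rewrite !sqn_mult, sqn_RtoC.
  rewrite ?sqn_RtoC. field. lra.
Qed.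

Lemma norm_th_sqr z : M0 z -> norm_th z ^ 2 = 4 * sqn (crit_poly z) * rad z ^ 4 / (sqn z * sqn (Qp z)) ^ 2.
Proof.
  intros Hz. pose proof (rad_pos_M0 z Hz) as Hr. assert (HQ := Qp_neq0 z Hz). assert (H0 := proj1 (M0_factors z Hz)).
  unfold norm_th. rewrite <- sqn_Cmod. unfold thr, th.
  rewrite sqn_div by (repeat first [assumption | apply Cmult_neq_0]).
  rewrite !sqn_mult, !sqn_RtoC. fold (crit_poly z). apply sqn_pos in HQ, H0. field. lra.
Qed.

Lemma norm_om_pos z : M0 z -> 0 < norm_om z.
Proof. intros Hz. apply Cmod_gt_0. now apply omr_neq0. Qed.

Lemma norm_th_ge0 z : 0 <= norm_th z.
Proof. apply Cmod_ge_0. Qed.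

Lemma fr_immersed_norms z : M0 z -> 0 < (norm_th z - norm_om z) ^ 2 -> immersed_at (fr 1 1) z.
Proof.
  intros Hz H. apply fr_immersed; trivial. rewrite wedge_dev, !sqn_Cmod. fold (norm_th z) (norm_om z).
  pose proof (norm_om_pos z Hz). pose proof (norm_th_ge0 z). intros E.
  assert (K : (norm_th z - norm_om z) * (norm_th z + norm_om z) = 0) by lra.
  apply Rmult_integral in K. destruct K as [K|K]; [rewrite K in H|]; lra.
Qed.

(** Statements about punctured neighbourhoods; the squared modulus is the natural
    variable because all the estimates are rational in it. *)
Definition Near (a : C) (P : C -> Prop) : Prop :=
  exists d, 0 < d /\ forall z, 0 < sqn (z - a) < d -> P z.

Lemma Near_and a P Q : Near a P -> Near a Q -> Near a (fun z => P z /\ Q z).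
Proof.
  intros (d & Hd & H) (e & He & K). exists (Rmin d e). split. now apply Rmin_glb_lt.
  intros z [H1 H2]. pose proof (Rmin_l d e). pose proof (Rmin_r d e). split; [apply H | apply K]; lra.
Qed.

Lemma Near_imp a (P Q : C -> Prop) : (forall z, P z -> Q z) -> Near a P -> Near a Q.
Proof. intros I (d & Hd & H). exists d; auto. Qed.

Lemma Near_small a e : 0 < e -> Near a (fun z => 0 < sqn (z - a) < e).
Proof. intros He. exists e. auto. Qed.

Lemma locally_Near a P : locally a P -> Near a P.
Proof.
  intros H. apply locally_Cmod in H. destruct H as (d & Hd & H). exists (d ^ 2). split. nra.
  intros z [_ Hz]. apply H. rewrite sqn_Cmod in Hz. pose proof (Cmod_ge_0 (z - a)). nra.
Qed.

(** The radius 1/10 separates the finite ends from each other and from the point -5/2; at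
    infinity, with w = 1/z, it excludes the ends other than infinity and the zero of 1 + 6 w. *)
Definition Ball (a : C) (z : C) : Prop := sqn (z - a) < 1 / 100.

Lemma locally_sqn_lt a e : 0 < e -> forall z, sqn (z - a) < e -> locally z (fun w => sqn (w - a) < e).
Proof.
  intros He z Hz. apply locally_lt; trivial. apply (Cinf_continuous (fun _ => True)); trivial. cinf_real.
Qed.

Lemma open_Ball a : open (Ball a).
Proof. intros z. apply locally_sqn_lt. lra. Qed.

Lemma sqn_self a : sqn (a - a) = 0.
Proof. replace (a - a)%C with (RtoC 0) by ring. rewrite sqn_RtoC. ring. Qed.

Lemma Ball_self a : Ball a a.
Proof. unfold Ball. rewrite sqn_self. lra. Qed.

Lemma Near_Ball a : Near a (Ball a).
Proof. apply locally_Near, open_Ball, Ball_self. Qed.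

Lemma Near_lower a k : Cinf (Ball a) k -> 0 < k a -> exists c, 0 < c /\ Near a (fun z => c <= k z).
Proof.
  intros H Hk. apply (Cinf_continuous _ _ a) in H; [|apply Ball_self].
  exists (k a / 2). split. lra. apply locally_Near.
  assert (L : locally a (fun z => k a / 2 < k z)) by (apply locally_gt; trivial; lra).
  revert L. apply filter_imp. intros; lra.
Qed.

Lemma Near_upper a k : Cinf (Ball a) k -> exists c, 0 < c /\ Near a (fun z => k z <= c).
Proof.
  intros H. apply (Cinf_continuous _ _ a) in H; [|apply Ball_self].
  exists (Rabs (k a) + 1). split. pose proof (Rabs_pos (k a)); lra. apply locally_Near.
  assert (L : locally a (fun z => k z < Rabs (k a) + 1)). { apply locally_lt; trivial. pose proof (Rle_abs (k a)); lra. }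
  revert L. apply filter_imp. intros; lra.
Qed.

Lemma Near_Cmod_upper a h : CCinf (Ball a) h -> exists B, 0 <= B /\ Near a (fun z => Cmod (h z) <= B).
Proof.
  intros H. destruct (Near_upper a (fun z => sqn (h z))) as (c & Hc & K). now apply Cinf_sqn.
  exists (sqrt c). split. apply sqrt_pos. revert K. apply Near_imp. intros z Hz. rewrite sqn_Cmod in Hz.
  apply Rsqr_incr_0_var; [|apply sqrt_pos]. rewrite Rsqr_sqrt by lra. unfold Rsqr. lra.
Qed.

(** If one of omega, theta is at least of order N^-1 in the squared distance [N] to the
    end while their product is at most of that order, then it dominates the other, and
    the difference of the norms is at least of order N^(-1/2). *)
Lemma dominance D S N c C : 0 < c -> 0 < C -> 0 < N < Rmin 1 (c / (2 * (C + 1))) -> 0 <= D -> 0 <= S ->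
  c <= D ^ 2 * N ^ 2 -> (D * S) ^ 2 * N ^ 2 <= C -> c / 4 <= (D - S) ^ 2 * N.
Proof.
  intros Hc HC [HN HN2] HD HS H1 H2.
  pose proof (Rmin_l 1 (c / (2 * (C + 1)))). pose proof (Rmin_r 1 (c / (2 * (C + 1)))).
  assert (K : N * (2 * (C + 1)) <= c). { apply Rmult_le_reg_r with (/ (2 * (C + 1))). apply Rinv_0_lt_compat; lra.
    rewrite Rmult_assoc, Rinv_r, Rmult_1_r by lra. unfold Rdiv in *. lra. }
  assert (HSD : S <= D / 2).
  { apply Rnot_lt_le. intros L.
    assert (K1 : c ^ 2 <= (D ^ 2 * N ^ 2) ^ 2) by (apply pow_incr; lra).
    assert (K2 : D ^ 2 <= 4 * S ^ 2) by nra.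
    assert (K3 : D ^ 2 * D ^ 2 <= D ^ 2 * (4 * S ^ 2)) by (apply Rmult_le_compat_l; nra).
    assert (K4 : (D ^ 2 * N ^ 2) ^ 2 <= 4 * C * N ^ 2).
    { replace ((D ^ 2 * N ^ 2) ^ 2) with ((D ^ 2 * D ^ 2) * (N ^ 2 * N ^ 2)) by ring.
      apply Rle_trans with (D ^ 2 * (4 * S ^ 2) * (N ^ 2 * N ^ 2)).
      apply Rmult_le_compat_r; nra.
      replace (D ^ 2 * (4 * S ^ 2) * (N ^ 2 * N ^ 2)) with (4 * N ^ 2 * ((D * S) ^ 2 * N ^ 2)) by ring. nra. }
    assert (K5 : (N * (2 * (C + 1))) ^ 2 <= c ^ 2) by (apply pow_incr; nra).
    assert (0 < N ^ 2) by nra. nra. }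
  assert (K6 : D ^ 2 / 4 <= (D - S) ^ 2) by nra.
  assert (K7 : c <= D ^ 2 * N) by (apply Rle_trans with (1 := H1); simpl; nra).
  nra.
Qed.

(** The square |e21 / e22|^2 of the ratio of the lower entries of the frame. *)
Definition tau (z : C) : R := sqn z * sqn (Qp z) / (rad z ^ 4 * sqn (2 * z + 5)).

(** At a finite end [a] the polynomial z Qp has a simple zero, with cofactor [h]. The
    type of the end is decided by |xi|: theta dominates where |xi| is bounded below, and
    omega where |xi| is at most of the order of the distance. *)
Record finite_end (a : C) (h : C -> C) : Prop := {
  fe_cofactor : forall z, (z * Qp z = (z - a) * h z)%C;
  fe_neq0 : forall z, Ball a z -> h z <> 0;
  fe_smooth : CCinf (Ball a) h;
  fe_pole : forall z, Ball a z -> (2 * z + 5)%C <> 0;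
  fe_M0 : Near a M0 }.

Lemma sqn_cofactor a h z : finite_end a h -> sqn z * sqn (Qp z) = sqn (z - a) * sqn (h z).
Proof. intros He. now rewrite <- !sqn_mult, (fe_cofactor a h He). Qed.

Lemma CCinf_crit_poly U : CCinf U crit_poly.
Proof. unfold crit_poly. cinf_tac. Qed.

(** The Hopf differential omega theta has a pole of order two at most. *)
Lemma end_product_upper a h : finite_end a h -> exists C, 0 < C /\ Near a (fun z => (norm_th z * norm_om z) ^ 2 * sqn (z - a) ^ 2 <= C).
Proof.
  intros He. assert (Hh := fe_smooth a h He). assert (Hp := CCinf_crit_poly (Ball a)).
  destruct (Near_upper a (fun z => 36 * sqn (crit_poly z) * sqn z ^ 2 * / sqn (h z) ^ 2)) as (C & HC & N).
  { cinf_real. intros z Hz. apply pow_nonzero, Rgt_not_eq, sqn_pos, (fe_neq0 a h He z Hz). }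
  exists C. split; trivial. generalize (Near_and _ _ _ (Near_and _ _ _ N (Near_Ball a)) (Near_and _ _ _ (fe_M0 a h He) (Near_small a _ Rlt_0_1))).
  apply Near_imp. intros z [[K HB] [Hz [HN _]]]. eapply Rle_trans; [|exact K]. right.
  rewrite Rpow_mult_distr, norm_th_sqr, norm_om_sqr, (sqn_cofactor a h z He) by trivial.
  pose proof (rad_pos_M0 z Hz). pose proof (sqn_pos _ (fe_neq0 a h He z HB)). field. lra.
Qed.

Lemma theta_end_metric a h c : finite_end a h -> 0 < c -> Near a (fun z => c <= rad z ^ 4) -> crit_poly a <> 0 ->
  exists c, 0 < c /\ Near a (fun z => c <= (norm_th z - norm_om z) ^ 2 * sqn (z - a)).
Proof.
  intros He Hc Hr Hpa. destruct (end_product_upper a h He) as (C & HC & NC).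
  assert (Hh := fe_smooth a h He). assert (Hp := CCinf_crit_poly (Ball a)).
  assert (Hk : forall z, Ball a z -> 0 < sqn (h z) ^ 2) by (intros z Hz; apply pow_lt, sqn_pos, (fe_neq0 a h He z Hz)).
  destruct (Near_lower a (fun z => 4 * sqn (crit_poly z) * / sqn (h z) ^ 2)) as (b & Hb & NL).
  { cinf_real. intros z Hz. apply Rgt_not_eq, Hk, Hz. }
  { apply sqn_pos in Hpa. apply Rmult_lt_0_compat; [lra | apply Rinv_0_lt_compat, Hk, Ball_self]. }
  assert (Hbc : 0 < b * c) by now apply Rmult_lt_0_compat.
  assert (Hm : 0 < Rmin 1 (b * c / (2 * (C + 1)))) by (apply Rmin_glb_lt; [lra | apply Rdiv_lt_0_compat; lra]).
  exists (b * c / 4). split. lra.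
  generalize (Near_and _ _ _ (Near_and _ _ _ NL NC) (Near_and _ _ _ (Near_and _ _ _ Hr (Near_Ball a)) (Near_and _ _ _ (fe_M0 a h He) (Near_small a _ Hm)))).
  apply Near_imp. intros z [[K1 K2] [[K3 HB] [Hz HN]]].
  apply (dominance _ _ _ (b * c) C); trivial. apply norm_th_ge0. apply Cmod_ge_0.
  rewrite norm_th_sqr, (sqn_cofactor a h z He) by trivial.
  apply Rle_trans with (4 * sqn (crit_poly z) * / sqn (h z) ^ 2 * rad z ^ 4). apply Rmult_le_compat; lra.
  right. specialize (Hk z HB). assert (sqn (h z) <> 0) by (intros E; rewrite E in Hk; simpl in Hk; lra). field. lra.
Qed.

Lemma omega_end_metric a h c : finite_end a h -> 0 < c -> Near a (fun z => rad z ^ 4 <= c * sqn (z - a) ^ 2) -> a <> 0 ->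
  exists c, 0 < c /\ Near a (fun z => c <= (norm_th z - norm_om z) ^ 2 * sqn (z - a)).
Proof.
  intros He Hc Hr Ha. destruct (end_product_upper a h He) as (C & HC & NC).
  destruct (Near_lower a (fun z => 9 * sqn z ^ 2)) as (b & Hb & NL).
  { cinf_real. } { apply sqn_pos in Ha. nra. }
  assert (Hbc : 0 < b / c) by now apply Rdiv_lt_0_compat.
  assert (Hm : 0 < Rmin 1 (b / c / (2 * (C + 1)))) by (apply Rmin_glb_lt; [lra | apply Rdiv_lt_0_compat; lra]).
  exists (b / c / 4). split. lra.
  generalize (Near_and _ _ _ (Near_and _ _ _ NL NC) (Near_and _ _ _ Hr (Near_and _ _ _ (fe_M0 a h He) (Near_small a _ Hm)))).
  apply Near_imp. intros z [[K1 K2] [K3 [Hz HN]]].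
  replace ((norm_th z - norm_om z) ^ 2) with ((norm_om z - norm_th z) ^ 2) by ring.
  apply (dominance _ _ _ (b / c) C); trivial. apply Cmod_ge_0. apply norm_th_ge0.
  - rewrite norm_om_sqr by trivial. pose proof (pow_lt _ 4 (rad_pos_M0 z Hz)) as Hrp.
    apply Rmult_le_reg_r with (c * rad z ^ 4). nra.
    replace (b / c * (c * rad z ^ 4)) with (b * rad z ^ 4) by (field; lra).
    replace (9 * sqn z ^ 2 / rad z ^ 4 * sqn (z - a) ^ 2 * (c * rad z ^ 4)) with (9 * sqn z ^ 2 * (c * sqn (z - a) ^ 2)) by (field; pose proof (rad_pos_M0 z Hz); lra).
    apply Rmult_le_compat; lra.
  - now rewrite (Rmult_comm (norm_om z)).
Qed.

Lemma theta_end_tau a h c : finite_end a h -> 0 < c -> Near a (fun z => c <= rad z ^ 4) ->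
  exists c, 0 < c /\ Near a (fun z => tau z <= c * sqn (z - a)).
Proof.
  intros He Hc Hr. assert (Hh := fe_smooth a h He).
  assert (H5 : forall z, Ball a z -> 0 < sqn (2 * z + 5)) by (intros z Hz; apply sqn_pos, (fe_pole a h He z Hz)).
  destruct (Near_upper a (fun z => sqn (h z) * / sqn (2 * z + 5))) as (b & Hb & NL).
  { cinf_real. intros z Hz. apply Rgt_not_eq, H5, Hz. }
  exists (b / c). split. now apply Rdiv_lt_0_compat.
  generalize (Near_and _ _ _ (Near_and _ _ _ NL Hr) (Near_and _ _ _ (Near_Ball a) (Near_small a _ Rlt_0_1))).
  apply Near_imp. intros z [[K1 K2] [HB HN]]. specialize (H5 z HB).
  unfold tau. rewrite (sqn_cofactor a h z He).
  replace (sqn (z - a) * sqn (h z) / (rad z ^ 4 * sqn (2 * z + 5))) with (sqn (h z) * / sqn (2 * z + 5) * / rad z ^ 4 * sqn (z - a)).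
  2: { assert (rad z <> 0) by (intros E; rewrite E in K2; simpl in K2; lra). field. lra. }
  apply Rmult_le_compat_r. lra. unfold Rdiv.
  assert (0 <= sqn (h z) * / sqn (2 * z + 5)) by (apply Rmult_le_pos; [apply sqn_ge0 | left; now apply Rinv_0_lt_compat]).
  apply Rmult_le_compat; trivial. left; apply Rinv_0_lt_compat; lra. apply Rinv_le_contravar; lra.
Qed.

Lemma omega_end_tau a h c : finite_end a h -> 0 < c -> Near a (fun z => rad z ^ 4 <= c * sqn (z - a) ^ 2) ->
  exists c, 0 < c /\ Near a (fun z => / tau z <= c * sqn (z - a)).
Proof.
  intros He Hc Hr. assert (Hh := fe_smooth a h He).
  assert (Hk : forall z, Ball a z -> 0 < sqn (h z)) by (intros z Hz; apply sqn_pos, (fe_neq0 a h He z Hz)).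
  assert (H5 : forall z, Ball a z -> 0 < sqn (2 * z + 5)) by (intros z Hz; apply sqn_pos, (fe_pole a h He z Hz)).
  destruct (Near_upper a (fun z => sqn (2 * z + 5) * / sqn (h z))) as (b & Hb & NL).
  { cinf_real. intros z Hz. apply Rgt_not_eq, Hk, Hz. }
  exists (c * b). split. now apply Rmult_lt_0_compat.
  generalize (Near_and _ _ _ (Near_and _ _ _ NL Hr) (Near_and _ _ _ (Near_Ball a) (Near_and _ _ _ (fe_M0 a h He) (Near_small a _ Rlt_0_1)))).
  apply Near_imp. intros z [[K1 K2] [HB [Hz HN]]]. specialize (H5 z HB). specialize (Hk z HB).
  pose proof (rad_pos_M0 z Hz) as Hrp. unfold tau. rewrite (sqn_cofactor a h z He).
  replace (/ (sqn (z - a) * sqn (h z) / (rad z ^ 4 * sqn (2 * z + 5)))) with (rad z ^ 4 * (sqn (2 * z + 5) * / sqn (h z) * / sqn (z - a))) by (field; lra).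
  replace (c * b * sqn (z - a)) with (c * sqn (z - a) ^ 2 * (b * / sqn (z - a))) by (field; lra).
  pose proof (Rinv_0_lt_compat _ (proj1 HN)). pose proof (Rinv_0_lt_compat _ Hk).
  apply Rmult_le_compat; trivial. left; now apply pow_lt. apply Rmult_le_pos; [nra|lra]. apply Rmult_le_compat_r; lra.
Qed.

(** ** |xi| at the four finite ends *)

Lemma exp_ln_le al N : 1 / 2 <= al -> 0 < N <= 1 -> exp (al * ln N) ^ 4 <= N ^ 2.
Proof.
  intros Ha [HN HN1].
  assert (ln N <= 0) by (rewrite <- ln_1; now apply ln_le).
  assert (E : exp (1 / 2 * ln N) ^ 4 = N ^ 2).
  { rewrite <- (exp_ln N) at 2 by trivial. simpl. rewrite !Rmult_1_r, <- !exp_plus. f_equal. field. }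
  rewrite <- E. apply pow_incr. split. left; apply exp_pos.
  destruct (Req_dec (al * ln N) (1/2 * ln N)) as [->|]. lra. left. apply exp_increasing. nra.
Qed.

Lemma minus_m2 z : (z - RtoC (-2) = z + 2)%C.
Proof. apply C_ext; simpl; lra. Qed.
Lemma minus_m3 z : (z - RtoC (-3/2) = z + RtoC (3/2))%C.
Proof. apply C_ext; simpl; lra. Qed.
Lemma sqn_minus_0 z : sqn (z - 0) = sqn z.
Proof. f_equal. ring. Qed.

Lemma M0_sqn z : M0 z -> 0 < sqn z /\ 0 < sqn (z - 1) /\ 0 < sqn (z + 2) /\ 0 < sqn (z + RtoC (3/2)).
Proof. intros H. destruct (M0_factors z H) as (H0 & H1 & H2 & H3 & H4). repeat split; now apply sqn_pos. Qed.

Lemma Ball_coords a z : Ball (RtoC a) z -> - 1/10 < fst z - a < 1/10 /\ - 1/10 < snd z < 1/10.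
Proof.
  unfold Ball, sqn, cdot; simpl. intros H.
  assert (H' : (fst z - a) * (fst z - a) + snd z * snd z < 1 / 100) by (replace (snd z) with (snd z + - 0) by ring; exact H).
  clear H. generalize dependent (fst z - a). intros u H.
  repeat split; apply Rnot_le_lt; intros L; nra.
Qed.

(* a number close to one end is different from the zeros of the other factors *)
Ltac far H := apply Ball_coords in H; let E := fresh in intros E;
  apply (f_equal fst) in E; simpl in E; lra.
Ltac far_factors := intros z HB; repeat (apply Cmult_neq_0); far HB.

Lemma Near_M0 (a : R) : In a (0 :: 1 :: -2 :: -3/2 :: nil) -> Near (RtoC a) M0.
Proof.
  intros Ha. generalize (Near_and _ _ _ (Near_Ball (RtoC a)) (Near_small (RtoC a) 1 Rlt_0_1)). apply Near_imp.
  intros z [HB [HN _]]. apply sqn_neq0 in HN. assert (Hne : z <> RtoC a) by (intros ->; apply HN; ring).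
  destruct Ha as [<-|[<-|[<-|[<-|[]]]]]; repeat split; trivial; far HB.
Qed.

Definition h0 (z : C) : C := Qp z.
Definition h1 (z : C) : C := (z * (z + 2) * (2 * z + 3))%C.
Definition h2 (z : C) : C := (z * (z - 1) * (2 * z + 3))%C.
Definition h3 (z : C) : C := (2 * z * (z - 1) * (z + 2))%C.

Lemma finite_end0 : finite_end 0 h0.
Proof.
  split; [intros; unfold h0; ring | unfold h0, Qp; far_factors | apply CCinf_Qp | intros z H; far H | apply Near_M0; simpl; tauto].
Qed.
Lemma finite_end1 : finite_end 1 h1.
Proof.
  split; [intros; unfold h1, Qp; ring | unfold h1; far_factors | unfold h1; cinf_tac | intros z H; far H | apply Near_M0; simpl; tauto].
Qed.
Lemma finite_end2 : finite_end (RtoC (-2)) h2.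
Proof.
  split; [intros; rewrite minus_m2; unfold h2, Qp; ring | unfold h2; far_factors | unfold h2; cinf_tac | intros z H; far H | apply Near_M0; simpl; tauto].
Qed.
Lemma finite_end3 : finite_end (RtoC (-3/2)) h3.
Proof.
  split; [intros; rewrite minus_m3; unfold h3, Qp; apply C_ext; simpl; field | unfold h3; far_factors | unfold h3; cinf_tac | intros z H; far H | apply Near_M0; simpl; tauto].
Qed.

Lemma rad_end0 : exists c, 0 < c /\ Near 0 (fun z => c <= rad z ^ 4).
Proof.
  apply Near_lower.
  - unfold rad. cinf_real; intros z H; try apply Rgt_not_eq; apply sqn_pos; far H.
  - apply pow_lt, rad_pos. intros E. apply RtoC_inj in E. lra.
Qed.

Lemma rad_end1 : exists c, 0 < c /\ Near 1 (fun z => rad z ^ 4 <= c * sqn (z - 1) ^ 2).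
Proof.
  destruct (Near_upper 1 (fun z => (exp (9/5 * ln (sqn (z + RtoC (3/2)))) * / sqn (z + 2)) ^ 4)) as (c & Hc & N).
  { cinf_real; intros z H; try apply Rgt_not_eq; apply sqn_pos; far H. }
  exists c. split; trivial. generalize (Near_and _ _ _ N (Near_small 1 _ Rlt_0_1)). apply Near_imp. intros z [K HN].
  unfold rad. rewrite exp_plus, Rmult_assoc, Rpow_mult_distr, Rmult_comm.
  apply Rmult_le_compat; trivial; try (apply pow_le, Rlt_le, exp_pos); try (apply exp_ln_le; lra).
  set (u := _ * _). replace (u ^ 4) with ((u ^ 2) ^ 2) by ring. apply pow2_ge_0.
Qed.

Lemma rad_end3 : exists c, 0 < c /\ Near (RtoC (-3/2)) (fun z => rad z ^ 4 <= c * sqn (z - RtoC (-3/2)) ^ 2).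
Proof.
  destruct (Near_upper (RtoC (-3/2)) (fun z => (exp (7/10 * ln (sqn (z - 1))) * / sqn (z + 2)) ^ 4)) as (c & Hc & N).
  { cinf_real; intros z H; try apply Rgt_not_eq; apply sqn_pos; far H. }
  exists c. split; trivial. generalize (Near_and _ _ _ N (Near_small (RtoC (-3/2)) _ Rlt_0_1)). apply Near_imp. intros z [K HN].
  rewrite minus_m3 in *. unfold rad. rewrite Rplus_comm, exp_plus, Rmult_assoc, Rpow_mult_distr, Rmult_comm.
  apply Rmult_le_compat; trivial; try (apply pow_le, Rlt_le, exp_pos); try (apply exp_ln_le; lra).
  set (u := _ * _). replace (u ^ 4) with ((u ^ 2) ^ 2) by ring. apply pow2_ge_0.
Qed.

Lemma rad_end2 : exists c, 0 < c /\ Near (RtoC (-2)) (fun z => c <= rad z ^ 4).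
Proof.
  destruct (Near_lower (RtoC (-2)) (fun z => exp (7/10 * ln (sqn (z - 1)) + 9/5 * ln (sqn (z + RtoC (3/2)))) ^ 4)) as (c & Hc & N).
  { cinf_real; intros z H; apply sqn_pos; far H. } { apply pow_lt, exp_pos. }
  exists c. split; trivial. generalize (Near_and _ _ _ N (Near_small (RtoC (-2)) _ Rlt_0_1)). apply Near_imp. intros z [K HN].
  rewrite minus_m2 in HN. unfold rad. rewrite Rpow_mult_distr. apply Rle_trans with (1 := K).
  rewrite <- (Rmult_1_r (_ ^ 4)) at 1. apply Rmult_le_compat_l. apply pow_le, Rlt_le, exp_pos.
  rewrite pow_inv, <- Rinv_1. apply Rinv_le_contravar. apply pow_lt; lra. rewrite <- (pow1 4). apply pow_incr; lra.
Qed.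

Lemma end_metric (a : R) : In a (0 :: 1 :: -2 :: -3/2 :: nil) ->
  exists c, 0 < c /\ Near (RtoC a) (fun z => c <= (norm_th z - norm_om z) ^ 2 * sqn (z - RtoC a)).
Proof.
  intros [<-|[<-|[<-|[<-|[]]]]].
  - destruct rad_end0 as (c & Hc & N). apply (theta_end_metric _ h0 c finite_end0 Hc N).
    intros E. apply (f_equal fst) in E. simpl in E. lra.
  - destruct rad_end1 as (c & Hc & N). apply (omega_end_metric _ h1 c finite_end1 Hc N). apply RtoC_neq0; lra.
  - destruct rad_end2 as (c & Hc & N). apply (theta_end_metric _ h2 c finite_end2 Hc N).
    intros E. apply (f_equal fst) in E. simpl in E. lra.
  - destruct rad_end3 as (c & Hc & N). apply (omega_end_metric _ h3 c finite_end3 Hc N). apply RtoC_neq0; lra.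
Qed.

(** ** The end at infinity, in the coordinate w = 1/z *)

Definition rinf (w : C) : R :=
  exp (7/10 * ln (sqn (1 - w)) + 9/5 * ln (sqn (1 + RtoC (3/2) * w))) * / sqn (1 + 2 * w).
Definition qinf (w : C) : R := sqn (1 - w) * sqn (1 + 2 * w) * (4 * sqn (1 + RtoC (3/2) * w)).
Definition pinf (w : C) : R := sqn (1 + 5 * w + 15 * w * w).

Lemma Ballinf_pos w : Ball 0 w ->
  0 < sqn (1 - w) /\ 0 < sqn (1 + 2 * w) /\ 0 < sqn (1 + RtoC (3/2) * w) /\ 0 < sqn (1 + 6 * w).
Proof. intros H. repeat split; apply sqn_pos; far H. Qed.

Lemma Cinf_rinf : Cinf (Ball 0) rinf.
Proof. unfold rinf. cinf_real; intros z H; try apply Rgt_not_eq; now apply Ballinf_pos. Qed.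

Lemma rinf_pos w : Ball 0 w -> 0 < rinf w.
Proof. intros H. apply Rmult_lt_0_compat. apply exp_pos. apply Rinv_0_lt_compat. now apply Ballinf_pos. Qed.

Lemma qinf_pos w : Ball 0 w -> 0 < qinf w.
Proof. intros H. destruct (Ballinf_pos w H) as (H1 & H2 & H3 & _). unfold qinf. repeat apply Rmult_lt_0_compat; lra. Qed.

Section AtInfinity.
Variable w : C.
Hypothesis Hw0 : w <> 0.
Let N := sqn w.
Let HN : 0 < N := sqn_pos w Hw0.

Lemma inf_affine (a b : C) : sqn (a * / w + b) = sqn (a + b * w) / N.
Proof. unfold N. rewrite <- sqn_div by trivial. f_equal. field. trivial. Qed.
Lemma inf_shift (b : C) : sqn (/ w + b) = sqn (1 + b * w) / N.
Proof. rewrite <- inf_affine. f_equal. ring. Qed.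
Lemma inf_1 : sqn (/ w - 1) = sqn (1 - w) / N.
Proof. unfold Cminus. rewrite inf_shift. do 2 f_equal. ring. Qed.
Lemma inf_p : sqn (crit_poly (/ w)) = pinf w / N ^ 2.
Proof.
  unfold N, pinf. replace (sqn w ^ 2) with (sqn (w * w)) by (rewrite sqn_mult; ring).
  rewrite <- sqn_div by (now apply Cmult_neq_0). f_equal. unfold crit_poly. field. trivial.
Qed.
Lemma inf_q : sqn (Qp (/ w)) = qinf w / N ^ 3.
Proof.
  unfold Qp. rewrite !sqn_mult, inf_1, inf_shift, inf_affine. unfold qinf.
  replace (2 + 3 * w)%C with (2 * (1 + RtoC (3/2) * w))%C by (apply C_ext; simpl; field).
  rewrite (sqn_mult 2), sqn_RtoC. field. lra.
Qed.

Lemma inf_rad : Ball 0 w -> rad (/ w) ^ 4 = rinf w ^ 4 / N ^ 6.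
Proof.
  intros HB. destruct (Ballinf_pos w HB) as (H1 & H2 & H3 & H6).
  unfold rad, rinf. rewrite inf_1, !inf_shift. rewrite !ln_div by lra.
  set (l1 := ln (sqn (1 - w))). set (l3 := ln (sqn (1 + RtoC (3/2) * w))).
  replace (7 / 10 * (l1 - ln N) + 9 / 5 * (l3 - ln N)) with ((7/10 * l1 + 9/5 * l3) + - (5/2 * ln N)) by field.
  rewrite exp_plus, exp_Ropp.
  assert (E : exp (5/2 * ln N) ^ 4 = N ^ 10).
  { rewrite <- (exp_ln N) at 2 by trivial. simpl. rewrite !Rmult_1_r, <- !exp_plus. f_equal. field. }
  pose proof (exp_pos (5/2 * ln N)).
  transitivity (exp (7 / 10 * l1 + 9 / 5 * l3) ^ 4 * / (exp (5/2 * ln N) ^ 4) * N ^ 4 * / sqn (1 + 2 * w) ^ 4).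
  field. lra. rewrite E. field. lra.
Qed.
End AtInfinity.

Lemma endinf_M0 : Near 0 (fun w => M0 (/ w)).
Proof.
  generalize (Near_and _ _ _ (Near_Ball 0) (Near_small 0 1 Rlt_0_1)). apply Near_imp.
  intros w [H [H1 _]]. rewrite sqn_minus_0 in H1. apply sqn_neq0 in H1.
  assert (E : forall c : C, (/ w)%C = c -> (c * w = 1)%C) by (intros c <-; field; trivial).
  repeat split; intros K; apply E in K; revert K; far H.
Qed.

(** As z = 1/w tends to infinity, |theta/dz| tends to a positive limit and |omega/dz|
    to 0; so the metric dominates a multiple of |dz|^2. *)
Lemma endinf_metric : exists c, 0 < c /\ Near 0 (fun w => c <= (norm_th (/ w) - norm_om (/ w)) ^ 2).
Proof.
  assert (Hr := Cinf_rinf).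
  assert (Lo : exists c, 0 < c /\ Near 0 (fun w => c <= 4 * pinf w * rinf w ^ 4 * / qinf w ^ 2)).
  { apply Near_lower.
    - unfold pinf, qinf. cinf_real. intros w Hw. apply pow_nonzero, Rgt_not_eq, qinf_pos, Hw.
    - assert (0 < pinf 0) by (unfold pinf, sqn, cdot; simpl; lra).
      pose proof (pow_lt _ 4 (rinf_pos _ (Ball_self 0))).
      apply Rmult_lt_0_compat. nra. apply Rinv_0_lt_compat, pow_lt, qinf_pos, Ball_self. }
  assert (Up : exists c, 0 < c /\ Near 0 (fun w => 9 * sqn w ^ 3 * / rinf w ^ 4 <= c)).
  { apply Near_upper. cinf_real. intros w Hw. apply pow_nonzero, Rgt_not_eq. now apply rinf_pos. }
  destruct Lo as (c & Hc & Lo), Up as (c' & Hc' & Up). exists (c / 4). split. lra.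
  assert (Hs : 0 < c / (4 * c')) by (apply Rdiv_lt_0_compat; lra).
  generalize (Near_and _ _ _ (Near_and _ _ _ Lo Up) (Near_and _ _ _ (Near_and _ _ _ (Near_Ball _) (Near_small 0 _ Hs)) endinf_M0)).
  apply Near_imp. intros w [[K1 K2] [[HB HN] HM]]. rewrite sqn_minus_0 in HN.
  assert (Hw := sqn_neq0 w (proj1 HN)).
  pose proof (pow_lt _ 4 (rinf_pos _ HB)) as Hr4. assert (Hq := qinf_pos w HB).
  set (N := sqn w) in *.
  assert (E1 : norm_th (/ w) ^ 2 = 4 * pinf w * rinf w ^ 4 * / qinf w ^ 2).
  { rewrite norm_th_sqr, inf_p, inf_q, inf_rad, sqn_inv by trivial. fold N. field. lra. }
  assert (E2 : norm_om (/ w) ^ 2 = 9 * N ^ 3 * / rinf w ^ 4 * N).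
  { rewrite norm_om_sqr, inf_rad, sqn_inv by trivial. fold N. field. pose proof (rinf_pos w HB). lra. }
  rewrite <- E1 in K1.
  assert (K3 : norm_om (/ w) ^ 2 <= c / 4).
  { rewrite E2. apply Rle_trans with (c' * (c / (4 * c'))). apply Rmult_le_compat; try lra.
    left. apply Rmult_lt_0_compat. pose proof (pow_lt N 3 (proj1 HN)). lra. now apply Rinv_0_lt_compat. right. field. lra. }
  pose proof (Cmod_ge_0 (omr (/ w))) as M1. pose proof (norm_th_ge0 (/ w)) as M2. fold (norm_om (/ w)) in M1.
  assert (norm_om (/ w) <= norm_th (/ w) / 2) by nra. nra.
Qed.

(** The square |e11 / e12|^2 of the ratio of the upper entries of the frame. *)
Definition sigma (z : C) : R := sqn z ^ 3 * sqn (Qp z) / (rad z ^ 4 * sqn (z + 6)).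

Lemma endinf_sigma : exists c, 0 < c /\ Near 0 (fun w => sigma (/ w) <= c * sqn w).
Proof.
  assert (Hr := Cinf_rinf).
  assert (Up : exists c, 0 < c /\ Near 0 (fun w => qinf w * / (rinf w ^ 4 * sqn (1 + 6 * w)) <= c)).
  { apply Near_upper. unfold qinf. cinf_real. intros w Hw. apply Rgt_not_eq, Rmult_lt_0_compat.
    apply pow_lt. now apply rinf_pos. now apply Ballinf_pos. }
  destruct Up as (c & Hc & Up). exists c. split. lra.
  generalize (Near_and _ _ _ Up (Near_and _ _ _ (Near_Ball _) (Near_small 0 1 Rlt_0_1))).
  apply Near_imp. intros w [K1 [HB HN]]. rewrite sqn_minus_0 in HN.
  assert (Hw := sqn_neq0 w (proj1 HN)).
  pose proof (rinf_pos _ HB) as Hr4. destruct (Ballinf_pos w HB) as (H1 & H2 & H3 & H6).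
  unfold sigma. rewrite inf_q, inf_rad, inf_shift, sqn_inv by trivial. set (N := sqn w) in *.
  match goal with |- ?l <= _ => replace l with (qinf w * / (rinf w ^ 4 * sqn (1 + 6 * w)) * N) by (field; lra) end.
  apply Rmult_le_compat_r; lra.
Qed.

(** * Embeddedness of the ends *)

Lemma Rabs_cdot_le a b : Rabs (cdot a b) <= Cmod a * Cmod b.
Proof.
  assert (E : cdot a b = fst (a * Cconj b)%C) by (unfold cdot; simpl; ring).
  rewrite E, <- (Cmod_conj b), <- Cmod_mult. apply re_le_Cmod.
Qed.

(** The mean value inequality on a punctured disc: the segment between two points misses
    the centre or passes through it, where the bound by the distance to it is used. *)
Section Segment.
Variables (a : C) (r0 K : R) (psi : C -> C).
Hypothesis HK : 0 <= K.
Hypothesis Hsmall : forall z, 0 < Cmod (z - a) < r0 -> Cmod (psi z) <= K * Cmod (z - a).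
Hypothesis Hder : forall z, 0 < Cmod (z - a) < r0 -> exists p1 q1 p2 q2,
  rder (fun w => fst (psi w)) z p1 q1 /\ rder (fun w => snd (psi w)) z p2 q2 /\
  forall v : C, Cmod (p1 * fst v + q1 * snd v, p2 * fst v + q2 * snd v) <= K * Cmod v.

Lemma punctured_lipschitz z w : 0 < Cmod (z - a) < r0 -> 0 < Cmod (w - a) < r0 ->
  Cmod (psi w - psi z) <= K * Cmod (w - z).
Proof.
  intros Hz Hw.
  set (sg := fun t : R => (fst z + t * (fst w - fst z), snd z + t * (snd w - snd z)) : C).
  assert (Esg : forall t, sg t = (z + RtoC t * (w - z))%C) by (intros t; apply C_ext; simpl; ring).
  destruct (Classical_Prop.classic (exists t, 0 <= t <= 1 /\ sg t = a)) as [(t & Ht & Ea)|Hno].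
  - assert (E1 : (w - a = RtoC (1 - t) * (w - z))%C) by (rewrite <- Ea, Esg, RtoC_minus; ring).
    assert (E2 : (z - a = RtoC (- t) * (w - z))%C) by (rewrite <- Ea, Esg, RtoC_opp; ring).
    eapply Rle_trans. apply Cmod_triangle. rewrite Cmod_opp.
    apply Rle_trans with (K * Cmod (w - a) + K * Cmod (z - a)).
    apply Rplus_le_compat; now apply Hsmall.
    rewrite E1, E2, !Cmod_mult, !Cmod_R, Rabs_Ropp, !Rabs_pos_eq by lra. right; ring.
  - assert (HP : forall t, 0 <= t <= 1 -> 0 < Cmod (sg t - a) < r0).
    { intros t Ht. split.
      - apply Cmod_gt_0. intros E. apply Hno. exists t. split; trivial.
        replace (sg t) with ((sg t - a) + a)%C by ring. rewrite E. ring.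
      - replace (sg t - a)%C with (RtoC (1 - t) * (z - a) + RtoC t * (w - a))%C by (rewrite Esg, RtoC_minus; ring).
        eapply Rle_lt_trans. apply Cmod_triangle. rewrite !Cmod_mult, !Cmod_R, !Rabs_pos_eq by lra.
        destruct (Req_dec t 0) as [->|]. lra. nra. }
    set (d := (psi w - psi z)%C).
    set (phi := fun t => fst d * fst (psi (sg t)) + snd d * snd (psi (sg t))).
    assert (Hphi : forall t, 0 <= t <= 1 -> exists l, is_derive phi t l /\ Rabs l <= Cmod d * (K * Cmod (w - z))).
    { intros t Ht. destruct (Hder _ (HP t Ht)) as (p1 & q1 & p2 & q2 & D1 & D2 & Hb).
      assert (S1 : is_derive (fun s => fst z + s * (fst w - fst z)) t (fst w - fst z)) by (auto_derive; trivial; ring).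
      assert (S2 : is_derive (fun s => snd z + s * (snd w - snd z)) t (snd w - snd z)) by (auto_derive; trivial; ring).
      assert (C1 := rder_chain _ (sg t) _ _ _ _ t _ _ eq_refl D1 S1 S2).
      assert (C2 := rder_chain _ (sg t) _ _ _ _ t _ _ eq_refl D2 S1 S2).
      exists (cdot d (p1 * (fst w - fst z) + q1 * (snd w - snd z), p2 * (fst w - fst z) + q2 * (snd w - snd z))).
      split.
      - assert (I := is_derive_plus (V:=R_NormedModule) _ _ t _ _
          (is_derive_scal _ t (fst d) _ C1) (is_derive_scal _ t (snd d) _ C2)).
        exact I.
      - eapply Rle_trans. apply Rabs_cdot_le. apply Rmult_le_compat_l. apply Cmod_ge_0.
        exact (Hb (w - z)%C). }
    destruct (MVT_gen phi 0 1 (Derive phi)) as (c & Hc & E).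
    + intros x Hx. rewrite Rmin_left, Rmax_right in Hx by lra. destruct (Hphi x) as (l & Hl & _). lra.
      apply Derive_correct. now exists l.
    + intros x Hx. rewrite Rmin_left, Rmax_right in Hx by lra. destruct (Hphi x Hx) as (l & Hl & _).
      apply continuity_pt_filterlim. apply (ex_derive_continuous (K:=R_AbsRing) (V:=R_NormedModule)). now exists l.
    + rewrite Rmin_left, Rmax_right in Hc by lra. destruct (Hphi c Hc) as (l & Hl & Hlb).
      rewrite (is_derive_unique _ _ _ Hl) in E.
      assert (E' : phi 1 - phi 0 = Cmod d ^ 2).
      { rewrite Cmod_sqr. unfold phi. replace (sg 1) with w by (rewrite Esg; ring). replace (sg 0) with z by (rewrite Esg; ring).
        unfold d; simpl; ring. }
      rewrite E' in E. assert (Hd : Cmod d ^ 2 <= Cmod d * (K * Cmod (w - z))).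
      { rewrite E, Rminus_0_r, Rmult_1_r. eapply Rle_trans; [apply Rle_abs | exact Hlb]. }
      pose proof (Cmod_ge_0 d). destruct (Req_dec (Cmod d) 0) as [Z|Z].
      * fold d. rewrite Z. apply Rmult_le_pos; trivial. apply Cmod_ge_0.
      * apply Rmult_le_reg_l with (Cmod d). lra. simpl in Hd. lra.
Qed.
End Segment.

Lemma rder_sqn k z l : cder k z (k z * l) -> rder (fun w => sqn (k w)) z (2 * sqn (k z) * fst l) (- (2 * sqn (k z) * snd l)).
Proof.
  rewrite cder_rder. intros [H1 H2]. eapply rder_eq. unfold sqn, cdot. rder_tac.
  unfold sqn, cdot; simpl; ring. unfold sqn, cdot; simpl; ring.
Qed.

(** The ratio f12 / f22 of entries of the front is the mean of G and G_* weighted by the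
    squared moduli of the lower entries of the frame. At an end the weight [T] of one of
    them tends to zero, while its logarithmic derivative [ell] has only a pole cancelled
    by the zero of G - G_*; so the mean is a small C1 perturbation of the other Gauss map
    and inherits its bi-Lipschitz lower bound. *)
Section Mean.
Variables (a : C) (r0 B e m : R) (G1 G2 dG1 dG2 ell : C -> C) (T : C -> R).

Record dominated_mean (z : C) : Prop := {
  dm_G1 : cder G1 z (dG1 z) /\ Cmod (dG1 z) <= B;
  dm_G2 : cder G2 z (dG2 z) /\ Cmod (dG2 z) <= B;
  dm_diff : Cmod (G1 z - G2 z) <= B * Cmod (z - a);
  dm_T : 0 < T z <= e;
  dm_Td : rder T z (2 * T z * fst (ell z)) (- (2 * T z * snd (ell z)));
  dm_ell : ((G1 z - G2 z) * ell z = - (dG1 z + dG2 z))%C }.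

Let P z := 0 < Cmod (z - a) < r0.
Hypothesis Hdm : forall z, P z -> dominated_mean z.
Hypothesis HB : 0 <= B.
Hypothesis Hm : 12 * B * e <= m.
Hypothesis Hlow : forall z w, P z -> P w -> m * Cmod (w - z) <= Cmod (G2 w - G2 z).

Definition mean (z : C) : C := (G2 z + (G1 z - G2 z) * RtoC (T z * / (1 + T z)))%C.

Lemma mean_lipschitz_below z w : P z -> P w -> m / 2 * Cmod (w - z) <= Cmod (mean w - mean z).
Proof.
  intros Hz Hw.
  set (psi := fun z => ((G1 z - G2 z) * RtoC (T z * / (1 + T z)))%C).
  assert (He : 0 <= e). { pose proof (dm_T _ (Hdm z Hz)). lra. }
  assert (HK : 0 <= 6 * B * e) by (repeat apply Rmult_le_pos; lra).
  assert (Hs : forall z, P z -> 0 < T z * / (1 + T z) <= e).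
  { intros x Hx. pose proof (dm_T _ (Hdm x Hx)). assert (0 < / (1 + T x) <= 1).
    { split. apply Rinv_0_lt_compat; lra. rewrite <- Rinv_1. apply Rinv_le_contravar; lra. } nra. }
  assert (L : Cmod (psi w - psi z) <= 6 * B * e * Cmod (w - z)).
  { apply (punctured_lipschitz a r0); trivial.
    - intros x Hx. unfold psi. rewrite Cmod_mult, Cmod_R. pose proof (Hs x Hx). rewrite Rabs_pos_eq by lra.
      pose proof (dm_diff _ (Hdm x Hx)). pose proof (Cmod_ge_0 (G1 x - G2 x)). pose proof (Cmod_ge_0 (x - a)).
      apply Rle_trans with (B * Cmod (x - a) * e). apply Rmult_le_compat; lra.
      assert (0 <= B * Cmod (x - a) * e) by (repeat apply Rmult_le_pos; lra). lra.
    - intros x Hx. destruct (dm_G1 _ (Hdm x Hx)) as [D1 B1], (dm_G2 _ (Hdm x Hx)) as [D2 B2].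
      assert (D := cder_minus _ _ _ _ _ D1 D2). apply cder_rder in D. destruct D as [Da Db].
      pose proof (dm_T _ (Hdm x Hx)) as Tx. pose proof (Hs x Hx) as Sx. pose proof (dm_Td _ (Hdm x Hx)) as Td.
      assert (Sd : rder (fun z => T z * / (1 + T z)) x (2 * T x * fst (ell x) * / (1 + T x) ^ 2) (- (2 * T x * snd (ell x)) * / (1 + T x) ^ 2)).
      { eapply rder_eq. apply rder_mult. exact Td. apply rder_inv. lra. apply rder_plus. apply rder_const. exact Td.
        cbv beta. field. lra. cbv beta. field. lra. }
      exists (fst (dG1 x - dG2 x)%C * (T x * / (1 + T x)) + fst (G1 x - G2 x)%C * (2 * T x * fst (ell x) * / (1 + T x) ^ 2)),
        (- snd (dG1 x - dG2 x)%C * (T x * / (1 + T x)) + fst (G1 x - G2 x)%C * (- (2 * T x * snd (ell x)) * / (1 + T x) ^ 2)),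
        (snd (dG1 x - dG2 x)%C * (T x * / (1 + T x)) + snd (G1 x - G2 x)%C * (2 * T x * fst (ell x) * / (1 + T x) ^ 2)),
        (fst (dG1 x - dG2 x)%C * (T x * / (1 + T x)) + snd (G1 x - G2 x)%C * (- (2 * T x * snd (ell x)) * / (1 + T x) ^ 2)).
      split; [|split].
      + apply (rder_ext (fun z => fst (G1 z - G2 z)%C * (T z * / (1 + T z)))).
        apply filter_forall. intros y. unfold psi. simpl. ring.
        eapply rder_eq. exact (rder_mult _ _ _ _ _ _ _ Da Sd). cbv beta. ring. cbv beta. ring.
      + apply (rder_ext (fun z => snd (G1 z - G2 z)%C * (T z * / (1 + T z)))).
        apply filter_forall. intros y. unfold psi. simpl. ring.
        eapply rder_eq. exact (rder_mult _ _ _ _ _ _ _ Db Sd). cbv beta. ring. cbv beta. ring.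
      + intros v. set (s := T x * / (1 + T x)) in *.
        match goal with |- Cmod ?c <= _ => replace c with
          ((dG1 x - dG2 x) * v * RtoC s + (G1 x - G2 x) * RtoC (2 * T x * / (1 + T x) ^ 2 * fst (ell x * v)%C))%C
          by (apply C_ext; simpl; ring) end.
        eapply Rle_trans. apply Cmod_triangle. rewrite !Cmod_mult, !Cmod_R.
        assert (I : 0 < / (1 + T x) ^ 2 <= 1).
        { split. apply Rinv_0_lt_compat. nra. rewrite <- Rinv_1. apply Rinv_le_contravar; nra. }
        rewrite (Rabs_pos_eq s) by lra. rewrite Rabs_mult, (Rabs_pos_eq (2 * T x * / (1 + T x) ^ 2)) by nra.
        assert (A1 : Rabs (fst (ell x * v)%C) <= Cmod (ell x) * Cmod v) by (rewrite <- Cmod_mult; apply re_le_Cmod).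
        assert (A2 : Cmod (G1 x - G2 x) * Cmod (ell x) <= 2 * B).
        { rewrite <- Cmod_mult, (dm_ell _ (Hdm x Hx)), Cmod_opp. eapply Rle_trans. apply Cmod_triangle. lra. }
        assert (A3 : Cmod (dG1 x - dG2 x) <= 2 * B).
        { eapply Rle_trans. apply Cmod_triangle. rewrite Cmod_opp. lra. }
        pose proof (Cmod_ge_0 v). pose proof (Cmod_ge_0 (dG1 x - dG2 x)). pose proof (Cmod_ge_0 (G1 x - G2 x)). pose proof (Cmod_ge_0 (ell x)).
        apply Rle_trans with (2 * B * Cmod v * e + 2 * e * (2 * B * Cmod v)). 2: right; ring.
        apply Rplus_le_compat.
        * apply Rmult_le_compat; try lra. apply Rmult_le_pos; lra. apply Rmult_le_compat_r; lra.
        * apply Rle_trans with (Cmod (G1 x - G2 x) * (2 * T x * / (1 + T x) ^ 2 * (Cmod (ell x) * Cmod v))).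
          apply Rmult_le_compat_l; trivial. apply Rmult_le_compat_l; nra.
          replace (Cmod (G1 x - G2 x) * (2 * T x * / (1 + T x) ^ 2 * (Cmod (ell x) * Cmod v))) with
            (2 * T x * / (1 + T x) ^ 2 * (Cmod (G1 x - G2 x) * Cmod (ell x) * Cmod v)) by ring.
          apply Rmult_le_compat; try nra. repeat apply Rmult_le_pos; lra. }
  assert (Lo := Hlow z w Hz Hw).
  replace (mean w - mean z)%C with ((G2 w - G2 z) + (psi w - psi z))%C by (unfold mean, psi; ring).
  assert (Tr : Cmod (G2 w - G2 z) <= Cmod ((G2 w - G2 z) + (psi w - psi z)) + Cmod (psi w - psi z)).
  { replace (G2 w - G2 z)%C with (((G2 w - G2 z) + (psi w - psi z)) + - (psi w - psi z))%C at 1 by ring.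
    eapply Rle_trans. apply Cmod_triangle. rewrite Cmod_opp. lra. }
  pose proof (Cmod_ge_0 (w - z)).
  assert (6 * B * e * Cmod (w - z) <= m / 2 * Cmod (w - z)) by (apply Rmult_le_compat_r; lra). lra.
Qed.
End Mean.

Lemma quotient_close (a : C) (s e : R) : 0 < s -> 0 < e -> exists d, 0 < d /\ forall a' s',
  Cmod (a' - a) < 2 * d -> Rabs (s' - s) < 2 * d -> Cmod (a' / RtoC s' - a / RtoC s) < e.
Proof.
  intros Hs He. pose proof (Cmod_ge_0 a) as Ha.
  exists (Rmin (s / 4) (e * s ^ 2 / (8 * (s + Cmod a)))).
  assert (H2 : 0 < e * s ^ 2 / (8 * (s + Cmod a))) by (apply Rdiv_lt_0_compat; [apply Rmult_lt_0_compat; [trivial | now apply pow_lt] | lra]).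
  split. apply Rmin_glb_lt; lra.
  intros a' s' H H'. set (d := Rmin _ _) in *.
  assert (D1 : d <= s / 4) by apply Rmin_l. assert (D2 : d <= e * s ^ 2 / (8 * (s + Cmod a))) by apply Rmin_r.
  apply Rabs_lt_between in H' as H''.
  assert (Hs' : s / 2 < s') by lra.
  assert (N : RtoC s <> 0) by (intros E; apply RtoC_inj in E; lra).
  assert (N' : RtoC s' <> 0) by (intros E; apply RtoC_inj in E; lra).
  replace (a' / RtoC s' - a / RtoC s)%C with (((a' - a) * RtoC s - a * RtoC (s' - s)) / RtoC (s' * s))%C
    by (rewrite RtoC_minus, RtoC_mult; field; auto).
  rewrite Cmod_div. 2: rewrite RtoC_mult; now apply Cmult_neq_0.
  rewrite Cmod_R, (Rabs_pos_eq (s' * s)) by nra.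
  apply Rmult_lt_reg_r with (s' * s). nra. unfold Rdiv. rewrite Rmult_assoc, Rinv_l, Rmult_1_r by nra.
  apply Rle_lt_trans with (Cmod (a' - a) * s + Cmod a * Rabs (s' - s)).
  { eapply Rle_trans. apply Cmod_triangle. rewrite Cmod_opp, !Cmod_mult, !Cmod_R, (Rabs_pos_eq s) by lra. lra. }
  apply Rlt_le_trans with (2 * d * (s + Cmod a)).
  { pose proof (Rabs_pos (s' - s)). nra. }
  apply Rle_trans with (e * (s / 2 * s)). 2: apply Rmult_le_compat_l; nra.
  apply Rle_trans with (2 * (e * s ^ 2 / (8 * (s + Cmod a))) * (s + Cmod a)).
  apply Rmult_le_compat_r; lra.
  replace (2 * (e * s ^ 2 / (8 * (s + Cmod a))) * (s + Cmod a)) with (e * s ^ 2 / 4) by (field; lra). nra.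
Qed.

(** The entries f12 and f22 (f21 and f11 for [s = -1]) of the Hermitian matrix of a vector;
    their ratio serves as a coordinate at the ends. *)
Definition chart_num (s : R) (v : L4) : C := (v t1, s * v t2).
Definition chart_den (s : R) (v : L4) : R := v t0 - s * v t3.

(** An inverse that is continuous through the ratio of two coordinates is continuous
    through the coordinates. *)
Lemma chart_embedding s (U : C -> Prop) (h : C -> L4) : s = 1 \/ s = -1 -> smooth_map U h ->
  (forall z, U z -> immersed_at h z) -> (forall z, U z -> 0 < chart_den s (h z)) ->
  let zeta z := (chart_num s (h z) / RtoC (chart_den s (h z)))%C in
  (forall z, U z -> forall eps, 0 < eps -> exists e, 0 < e /\ forall w, U w ->
    Cmod (zeta w - zeta z) < e -> Cmod (w - z) < eps) -> embedding_on U h.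
Proof.
  intros Hs Hsm Him Hpos zeta Hinv.
  assert (Hc : forall z, U z -> forall eps : posreal, exists delta : posreal,
     forall w, U w -> (forall mu, Rabs (h w mu - h z mu) < delta) -> Cmod (w - z)%C < eps).
  { intros z Hz eps. destruct (Hinv z Hz eps (cond_pos eps)) as (e & He & K).
    destruct (quotient_close (chart_num s (h z)) (chart_den s (h z)) e (Hpos z Hz) He) as (d & Hd & Q).
    exists (mkposreal d Hd). intros w Hw Hcl. apply K; trivial. simpl in Hcl.
    pose proof (Hcl t0) as H0. pose proof (Hcl t1) as H1. pose proof (Hcl t2) as H2. pose proof (Hcl t3) as H3.
    apply Q.
    - eapply Rle_lt_trans. apply Cmod_le_sum. simpl. apply Rabs_lt_between in H1, H2.
      apply Rle_lt_trans with (Rabs (h w t1 - h z t1) + Rabs (h w t2 - h z t2)).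
      + apply Rplus_le_compat. right; f_equal; ring. right. destruct Hs as [-> | ->].
        f_equal; ring. rewrite <- Rabs_Ropp. f_equal; ring.
      + apply Rabs_lt_between in H1, H2. lra.
    - unfold chart_den. apply Rabs_lt_between in H0, H3. apply Rabs_lt_between. destruct Hs as [-> | ->]; lra. }
  split; [trivial | split; [trivial | split; [|exact Hc]]].
  intros z w Hz Hw E.
  assert (Z : Cmod (w - z) <= 0).
  { apply Rnot_lt_le. intros L. destruct (Hc z Hz (mkposreal _ L)) as [d Hd].
    specialize (Hd w Hw). simpl in Hd. apply (Rlt_irrefl (Cmod (w - z))). apply Hd.
    intros mu. rewrite E, Rminus_diag, Rabs_R0. apply cond_pos. }
  pose proof (Cmod_ge_0 (w - z)). assert (Z0 : (w - z = 0)%C) by (apply Cmod_eq_0; lra).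
  replace w with ((w - z) + z)%C by ring. rewrite Z0. ring.
Qed.

Lemma Cconj_mul_self a : (a * Cconj a)%C = RtoC (sqn a).
Proof. apply C_ext; unfold sqn, cdot; simpl; ring. Qed.

Lemma chart_num_fin a b c d : chart_num 1 (hvec 1 1 a b c d) = (a * Cconj c + b * Cconj d)%C.
Proof. apply C_ext; unfold chart_num, hvec, cdot; simpl; ring. Qed.
Lemma chart_den_fin a b c d : chart_den 1 (hvec 1 1 a b c d) = sqn c + sqn d.
Proof. unfold chart_den, hvec, sqn. field. Qed.
Lemma chart_num_inf a b c d : chart_num (-1) (hvec 1 1 a b c d) = (c * Cconj a + d * Cconj b)%C.
Proof. apply C_ext; unfold chart_num, hvec, cdot; simpl; ring. Qed.
Lemma chart_den_inf a b c d : chart_den (-1) (hvec 1 1 a b c d) = sqn a + sqn b.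
Proof. unfold chart_den, hvec, sqn. field. Qed.

(** The common factor |y|^2 is taken out, so that only the ratio of the weights remains. *)
Lemma weighted_mean (g1 g2 x y : C) : y <> 0 ->
  ((g1 * RtoC (sqn x) + g2 * RtoC (sqn y)) / RtoC (sqn x + sqn y) =
   g2 + (g1 - g2) * RtoC (sqn x / sqn y * / (1 + sqn x / sqn y)))%C.
Proof.
  intros H. apply sqn_pos in H. pose proof (sqn_ge0 x).
  replace (sqn x / sqn y * / (1 + sqn x / sqn y)) with (sqn x / (sqn x + sqn y)) by (field; lra).
  rewrite RtoC_div, RtoC_plus by lra.
  assert (RtoC (sqn x) + RtoC (sqn y) <> 0)%C by (rewrite <- RtoC_plus; apply RtoC_neq0; lra).
  field. trivial.
Qed.

Definition Gf (z : C) : C := (z * z * z)%C.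
Definition Gsf (z : C) : C := (z * (z + 6) / (2 * z + 5))%C.
Definition dGf (z : C) : C := (3 * z * z)%C.
Definition dGsf (z : C) : C := ((2 * (z * z + 5 * z + 15)) / ((2 * z + 5) * (2 * z + 5)))%C.

Lemma cder_Gf z : cder Gf z (dGf z).
Proof. eapply cder_eq. unfold Gf. cder_tac. unfold dGf. simpl. ring. Qed.
Lemma cder_Gsf z : (2 * z + 5)%C <> 0 -> cder Gsf z (dGsf z).
Proof. intros H. eapply cder_eq. unfold Gsf. apply cder_div; [trivial|cder_tac..]. unfold dGsf. simpl. field. trivial. Qed.

(** Along a branch of xi such a function is |k / xi^2|^2, the squared modulus of a
    holomorphic function. *)
Lemma rder_over_rad (k : C -> C) (T : C -> R) z l : M0 z -> cder k z (k z * (l + 2 * eta z)) ->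
  locally z (fun w => T w = sqn (k w) / rad w ^ 4) ->
  rder T z (2 * T z * fst l) (- (2 * T z * snd l)).
Proof.
  intros Hz Hk HT. set (x0 := RtoC (rad z)). set (xi := xi_of x0 z).
  assert (L : locally z (xi_spec x0 z)) by (apply locally_xi_spec; [trivial | apply sqn_rad]).
  set (q := fun w => (k w / (xi w * xi w))%C).
  assert (E : locally z (fun w => sqn (q w) = T w)).
  { generalize (filter_and _ _ L HT). apply filter_imp. intros w [(Hw & Hx & Hs & _) ->]. fold xi in Hx, Hs.
    unfold q. rewrite sqn_div by (now apply Cmult_neq_0). rewrite sqn_mult, Hs. f_equal. ring. }
  destruct (locally_singleton _ _ L) as (_ & Hx & _ & Hc). fold xi in Hx, Hc.
  rewrite <- (locally_singleton _ _ E). apply (rder_ext (fun w => sqn (q w))); trivial.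
  apply rder_sqn. eapply cder_eq. unfold q.
  apply cder_div; [now apply Cmult_neq_0 | exact Hk | apply cder_mult; exact Hc].
  unfold q. cbv beta. field. trivial.
Qed.

Section Ratio.
Variable z : C.
Hypothesis Hz : M0 z.
Let r := RtoC (rad z).
Lemma sqn_e21_pos : 0 < sqn (e21 r z).
Proof. unfold e21. rewrite sqn_inv by exact (rad_neq0 z Hz). apply Rinv_0_lt_compat, sqn_pos, (rad_neq0 z Hz). Qed.
Lemma sqn_e11_pos : 0 < sqn (e11 r z).
Proof.
  destruct (M0_sqn z Hz) as (H0 & _). assert (Hr := sqn_pos _ (rad_neq0 z Hz)).
  unfold e11. rewrite sqn_div by exact (rad_neq0 z Hz). rewrite !sqn_mult. apply Rdiv_lt_0_compat; trivial. repeat apply Rmult_lt_0_compat; trivial.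
Qed.

Lemma den_fin_pos : 0 < chart_den 1 (fr 1 1 z).
Proof. unfold fr. rewrite chart_den_fin. pose proof sqn_e21_pos. pose proof (sqn_ge0 (e22 r z)). unfold r in *. lra. Qed.
Lemma den_inf_pos : 0 < chart_den (-1) (fr 1 1 z).
Proof. unfold fr. rewrite chart_den_inf. pose proof sqn_e11_pos. pose proof (sqn_ge0 (e12 r z)). unfold r in *. lra. Qed.

Hypothesis H5 : (2 * z + 5)%C <> RtoC 0.

Lemma tau_eq : sqn (e21 r z) / sqn (e22 r z) = tau z.
Proof.
  assert (HQ := Qp_neq0 z Hz). assert (H0 := proj1 (M0_factors z Hz)). assert (Hr := rad_neq0 z Hz). fold r in Hr.
  unfold tau, e21, e22. rewrite sqn_inv, sqn_div, !sqn_mult by (repeat first [assumption | apply Cmult_neq_0]).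
  replace (rad z ^ 4) with (sqn r ^ 2) by (unfold r; rewrite sqn_RtoC; ring).
  apply sqn_pos in HQ, H0, Hr, H5. field. lra.
Qed.

Lemma tau_pos : 0 < tau z.
Proof.
  destruct (M0_sqn z Hz) as (H0 & _). assert (HQ := sqn_pos _ (Qp_neq0 z Hz)). pose proof (rad_pos_M0 z Hz) as Hr.
  apply sqn_pos in H5 as H5'. unfold tau. apply Rdiv_lt_0_compat. nra. apply Rmult_lt_0_compat; trivial. now apply pow_lt.
Qed.

Lemma e22_neq0 : e22 r z <> RtoC 0.
Proof.
  assert (HQ := Qp_neq0 z Hz). assert (H0 := proj1 (M0_factors z Hz)). assert (Hr := rad_neq0 z Hz). fold r in Hr.
  apply sqn_neq0. unfold e22. rewrite sqn_div, !sqn_mult by (repeat first [assumption | apply Cmult_neq_0]).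
  apply sqn_pos in HQ, H0, Hr, H5. apply Rdiv_lt_0_compat; nra.
Qed.

Lemma zeta_fin : (chart_num 1 (fr 1 1 z) / RtoC (chart_den 1 (fr 1 1 z)))%C = mean Gf Gsf tau z.
Proof.
  assert (HQ := Qp_neq0 z Hz). assert (H0 := proj1 (M0_factors z Hz)). assert (Hr := rad_neq0 z Hz). fold r in Hr.
  unfold fr. rewrite chart_num_fin, chart_den_fin. fold r. unfold mean. rewrite <- tau_eq, <- weighted_mean by apply e22_neq0.
  f_equal. rewrite <- !Cconj_mul_self.
  replace (e11 r z) with (Gf z * e21 r z)%C by (unfold e11, e21, Gf; field; trivial).
  replace (e12 r z) with (Gsf z * e22 r z)%C by (unfold e12, e22, Gsf; field; auto). ring.
Qed.

Lemma mean_swap g1 g2 : mean g1 g2 tau z = mean g2 g1 (fun z => / tau z) z.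
Proof.
  unfold mean. pose proof tau_pos as Ht.
  replace (/ tau z * / (1 + / tau z)) with (1 - tau z * / (1 + tau z)) by (field; lra).
  rewrite RtoC_minus. ring.
Qed.
End Ratio.

Definition ell (z : C) : C :=
  (/ z + (6 * z * z + 10 * z - 1) / Qp z - 2 * eta z - 2 / (2 * z + 5))%C.

Lemma rder_tau z : M0 z -> (2 * z + 5)%C <> 0 -> rder tau z (2 * tau z * fst (ell z)) (- (2 * tau z * snd (ell z))).
Proof.
  intros Hz H5. destruct (M0_factors z Hz) as (Z0 & Z1 & Z2 & Z3 & Z4). assert (HQ := Qp_neq0 z Hz).
  apply (rder_over_rad (fun w => w * Qp w / (2 * w + 5))%C); trivial.
  - eapply cder_eq. apply cder_div; [trivial | apply cder_mult; [apply cder_id | apply Qp_cder] | cder_tac].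
    unfold ell. cbv beta. field. auto.
  - assert (L := locally_neq0 (fun w => 2 * w + 5)%C z ltac:(cinf_tac) H5).
    generalize (filter_and _ _ L (open_M0 z Hz)). apply filter_imp. intros w [Hw HM].
    unfold tau. rewrite sqn_div, sqn_mult by trivial. field.
    pose proof (rad_pos_M0 w HM). apply sqn_pos in Hw. lra.
Qed.

Lemma ell_eq z : M0 z -> (2 * z + 5)%C <> 0 -> ((Gf z - Gsf z) * ell z = - (dGf z + dGsf z))%C.
Proof.
  intros Hz H5. destruct (M0_factors z Hz) as (Z0 & Z1 & Z2 & Z3 & Z4).
  unfold Gf, Gsf, ell, dGf, dGsf, eta, Qp. field. auto.
Qed.

Lemma Near_punctured a P : Near a P -> exists r, 0 < r /\ forall z, 0 < Cmod (z - a) < r -> P z.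
Proof.
  intros (d & Hd & H). exists (sqrt d). split. now apply sqrt_lt_R0.
  intros z [H1 H2]. apply H. rewrite sqn_Cmod. split. now apply pow_lt.
  pose proof (sqrt_sqrt d). pose proof (sqrt_pos d). nra.
Qed.

Lemma Near_weight a c (T : C -> R) : 0 < c -> Near a (fun z => T z <= c * sqn (z - a)) ->
  forall e, 0 < e -> Near a (fun z => T z <= e).
Proof.
  intros Hc N e He. generalize (Near_and _ _ _ N (Near_small a (e / c) (Rdiv_lt_0_compat _ _ He Hc))).
  apply Near_imp. intros z [K [_ L]]. apply Rle_trans with (1 := K). apply Rle_trans with (c * (e / c)).
  apply Rmult_le_compat_l; lra. right. field. lra.
Qed.

Lemma mean_near a B m G1 G2 dG1 dG2 l T : 0 <= B -> 0 < m ->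
  (forall e, 0 < e -> Near a (dominated_mean a B e G1 G2 dG1 dG2 l T)) ->
  (forall z w, Ball a z -> Ball a w -> m * Cmod (w - z) <= Cmod (G2 w - G2 z)) ->
  exists r, 0 < r /\ forall z w, 0 < Cmod (z - a) < r -> 0 < Cmod (w - a) < r ->
    m / 2 * Cmod (w - z) <= Cmod (mean G1 G2 T w - mean G1 G2 T z).
Proof.
  intros HB Hm Hdm Hlow.
  assert (Hs : 0 < m / (12 * (B + 1))) by (apply Rdiv_lt_0_compat; lra).
  destruct (Near_punctured _ _ (Near_and _ _ _ (Hdm _ Hs) (Near_Ball a))) as (r & Hr & H).
  exists r. split; trivial. apply (mean_lipschitz_below a r B (m / (12 * (B + 1))) m G1 G2 dG1 dG2 l T); trivial.
  - intros z Hz. now apply H.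
  - replace (12 * B * (m / (12 * (B + 1)))) with (m * (B / (B + 1))) by (field; lra).
    assert (B / (B + 1) <= 1). { apply Rmult_le_reg_r with (B + 1). lra. unfold Rdiv. rewrite Rmult_assoc, Rinv_l; lra. }
    nra.
  - intros z w Hz Hw. apply Hlow; now apply H.
Qed.

(** ** Lower Lipschitz bounds for G and G_* *)

Lemma re_bound_Cmod (z : C) b : b <= fst z -> b <= Cmod z.
Proof. intros H. eapply Rle_trans. apply H. eapply Rle_trans. apply Rle_abs. apply re_le_Cmod. Qed.

Lemma Gf_lower z w : 2 <= fst (z * z + z * w + w * w)%C -> 2 * Cmod (w - z) <= Cmod (Gf w - Gf z).
Proof.
  intros H. replace (Gf w - Gf z)%C with ((z * z + z * w + w * w) * (w - z))%C by (unfold Gf; ring).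
  rewrite Cmod_mult. apply Rmult_le_compat_r. apply Cmod_ge_0. now apply re_bound_Cmod.
Qed.

Lemma quot_lower (N D D' x : C) b k m : b <= fst N -> 0 <= m -> Cmod D <= k -> Cmod D' <= k -> m * (k * k) <= b ->
  D <> 0 -> D' <> 0 -> m * Cmod x <= Cmod (N * x / (D * D')).
Proof.
  intros Hb Hm HD HD' Hk H0 H0'. rewrite Cmod_div, !Cmod_mult by (now apply Cmult_neq_0).
  assert (P := proj1 (Cmod_gt_0 D) H0). assert (P' := proj1 (Cmod_gt_0 D') H0').
  apply Rmult_le_reg_r with (Cmod D * Cmod D'). now apply Rmult_lt_0_compat.
  replace (Cmod N * Cmod x / (Cmod D * Cmod D') * (Cmod D * Cmod D')) with (Cmod N * Cmod x) by (field; lra).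
  pose proof (re_bound_Cmod N b Hb). pose proof (Cmod_ge_0 x).
  replace (m * Cmod x * (Cmod D * Cmod D')) with (m * (Cmod D * Cmod D') * Cmod x) by ring.
  apply Rmult_le_compat_r; trivial. assert (Cmod D * Cmod D' <= k * k) by (apply Rmult_le_compat; lra).
  apply Rle_trans with (m * (k * k)). now apply Rmult_le_compat_l. lra.
Qed.

Lemma Gsf_lower z w b k m : (2 * z + 5)%C <> 0 -> (2 * w + 5)%C <> 0 ->
  b <= fst (2 * z * w + 5 * (z + w) + 30)%C -> 0 <= m ->
  Cmod (2 * z + 5) <= k -> Cmod (2 * w + 5) <= k -> m * (k * k) <= b ->
  m * Cmod (w - z) <= Cmod (Gsf w - Gsf z).
Proof.
  intros Hz Hw Hb Hm Hk Hk' Hmk.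
  replace (Gsf w - Gsf z)%C with ((2 * z * w + 5 * (z + w) + 30) * (w - z) / ((2 * z + 5) * (2 * w + 5)))%C
    by (unfold Gsf; field; auto).
  now apply quot_lower with b k.
Qed.

(* bound of the modulus of an affine function on a ball by its coordinates *)
Ltac cmod_coords := eapply Rle_trans; [apply Cmod_le_sum | simpl;
  match goal with |- Rabs ?a + Rabs ?b <= _ =>
    assert (Rabs b <= 6/10) by (apply Rabs_le; lra); rewrite (Rabs_pos_eq a); lra end].
Ltac gsf_lower b k := intros z w Hz Hw; apply Gsf_lower with b k;
  [far Hz | far Hw | apply Ball_coords in Hz, Hw; simpl; nra | lra
  | apply Ball_coords in Hz; cmod_coords | apply Ball_coords in Hw; cmod_coords | lra].

Lemma Gsf_lower_0 z w : Ball 0 z -> Ball 0 w -> 1/4 * Cmod (w - z) <= Cmod (Gsf w - Gsf z).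
Proof. revert z w. gsf_lower 28 6. Qed.

Lemma Gsf_lower_2 z w : Ball (RtoC (-2)) z -> Ball (RtoC (-2)) w -> 1/4 * Cmod (w - z) <= Cmod (Gsf w - Gsf z).
Proof. revert z w. gsf_lower 16 2. Qed.

Lemma Gf_lower_1 z w : Ball 1 z -> Ball 1 w -> 2 * Cmod (w - z) <= Cmod (Gf w - Gf z).
Proof. intros Hz Hw. apply Ball_coords in Hz, Hw. apply Gf_lower. simpl. nra. Qed.

Lemma Gf_lower_3 z w : Ball (RtoC (-3/2)) z -> Ball (RtoC (-3/2)) w -> 2 * Cmod (w - z) <= Cmod (Gf w - Gf z).
Proof. intros Hz Hw. apply Ball_coords in Hz, Hw. apply Gf_lower. simpl. nra. Qed.

(** ** The finite ends *)

Lemma open_punctured_disc a r : open (punctured_disc (Some a) r).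
Proof.
  intros z (w & Hw & Ez). simpl in Ez. apply locally_Cmod.
  exists (Rmin (Cmod w) (r - Cmod w)). split. apply Rmin_glb_lt; lra.
  intros y Hy. exists (y - a)%C. split. 2: simpl; ring.
  pose proof (Rmin_l (Cmod w) (r - Cmod w)). pose proof (Rmin_r (Cmod w) (r - Cmod w)).
  assert (E : (y - a = w + (y - z))%C) by (rewrite Ez; ring). split.
  - assert (Cmod w <= Cmod (y - a) + Cmod (y - z)).
    { replace w with ((y - a) + - (y - z))%C at 1 by (rewrite Ez; ring).
      eapply Rle_trans. apply Cmod_triangle. rewrite Cmod_opp. lra. }
    lra.
  - rewrite E. eapply Rle_lt_trans. apply Cmod_triangle. lra.
Qed.

Lemma embed_finite a B m G1 G2 dG1 dG2 l T : Near a M0 ->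
  (exists c, 0 < c /\ Near a (fun z => c <= (norm_th z - norm_om z) ^ 2 * sqn (z - a))) -> 0 <= B -> 0 < m ->
  Near a (fun z => chart_num 1 (fr 1 1 z) / RtoC (chart_den 1 (fr 1 1 z)) = mean G1 G2 T z)%C ->
  (forall e, 0 < e -> Near a (dominated_mean a B e G1 G2 dG1 dG2 l T)) ->
  (forall z w, Ball a z -> Ball a w -> m * Cmod (w - z) <= Cmod (G2 w - G2 z)) ->
  embedded_end M0 (fr 1 1) (Some a).
Proof.
  intros HM (c & Hc & Hmet) HB Hm Hz Hdm Hlow.
  destruct (mean_near a B m G1 G2 dG1 dG2 l T) as (r0 & Hr0 & HL); trivial.
  destruct (Near_punctured _ _ (Near_and _ _ _ HM (Near_and _ _ _ Hmet Hz))) as (d & Hd & H).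
  assert (Hr : 0 < Rmin d r0) by (now apply Rmin_glb_lt).
  exists (mkposreal _ Hr). simpl pos.
  assert (HU : forall z, punctured_disc (Some a) (Rmin d r0) z -> M0 z /\ 0 < (norm_th z - norm_om z) ^ 2 /\
    (chart_num 1 (fr 1 1 z) / RtoC (chart_den 1 (fr 1 1 z)))%C = mean G1 G2 T z /\ 0 < Cmod (z - a) < r0).
  { intros z (w & Hw & ->). simpl.
    pose proof (Rmin_l d r0). pose proof (Rmin_r d r0). assert (E : (a + w - a = w)%C) by ring.
    destruct (H (a + w)%C) as (I1 & I2 & I3). rewrite E; lra.
    rewrite E in *. assert (0 < sqn w). { apply sqn_pos. apply Cmod_gt_0. lra. }
    repeat split; trivial; try apply I1; try lra. apply Rnot_le_lt. intros K. nra. }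
  split. intros z Hz'. now apply HU.
  assert (HO := open_punctured_disc a (Rmin d r0)).
  apply (chart_embedding 1). now left.
  - intros mu. apply Cinf_smooth; trivial. apply Cinf_fr; trivial. intros z Hz'. now apply HU.
  - intros z Hz'. apply fr_immersed_norms; now apply HU.
  - intros z Hz'. apply den_fin_pos, HU, Hz'.
  - intros z Hz' eps He. destruct (HU z Hz') as (_ & _ & Ez & Bz). exists (m / 2 * eps). split. apply Rmult_lt_0_compat; lra.
    intros w Hw. destruct (HU w Hw) as (_ & _ & Ew & Bw). rewrite Ez, Ew. intros K.
    apply Rmult_lt_reg_l with (m / 2). lra. eapply Rle_lt_trans. 2: exact K. now apply HL.
Qed.

(** As G - G_* = (z - a) h / (2 z + 5), the data of [dominated_mean] that do not involve the
    weight are bounded near the end. *)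
Lemma gauss_bounds a h : finite_end a h ->
  exists B, 0 <= B /\ Near a (fun z => (cder Gf z (dGf z) /\ Cmod (dGf z) <= B) /\
    (cder Gsf z (dGsf z) /\ Cmod (dGsf z) <= B) /\ Cmod (Gf z - Gsf z) <= B * Cmod (z - a)).
Proof.
  intros He. assert (Hh := fe_smooth a h He). assert (H5 := fe_pole a h He). assert (HO := open_Ball a).
  destruct (Near_Cmod_upper a dGf) as (B1 & P1 & N1). { unfold dGf. cinf_tac. }
  destruct (Near_Cmod_upper a dGsf) as (B2 & P2 & N2).
  { unfold dGsf. apply CCinf_div; trivial; [intros z Hz; apply Cmult_neq_0; auto | cinf_tac..]. }
  destruct (Near_Cmod_upper a (fun z => h z / (2 * z + 5))%C) as (B3 & P3 & N3).
  { apply CCinf_div; trivial. cinf_tac. }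
  exists (B1 + B2 + B3). split. lra.
  generalize (Near_and _ _ _ (Near_and _ _ _ N1 N2) (Near_and _ _ _ N3 (Near_Ball a))).
  apply Near_imp. intros z [[K1 K2] [K3 Hb]]. specialize (H5 z Hb).
  split; [|split]. split. apply cder_Gf. lra. split. now apply cder_Gsf. lra.
  replace (Gf z - Gsf z)%C with (h z / (2 * z + 5) * (z - a))%C.
  rewrite Cmod_mult. apply Rmult_le_compat_r. apply Cmod_ge_0. lra.
  transitivity ((z - a) * h z / (2 * z + 5))%C. field; trivial.
  rewrite <- (fe_cofactor a h He). unfold Gf, Gsf, Qp. field. trivial.
Qed.

(** At an end where theta dominates, the lower entries of the frame have ratio [tau]
    tending to zero, and G_* dominates the mean. *)
Lemma embed_theta_end a h c m : finite_end a h -> 0 < c -> Near a (fun z => c <= rad z ^ 4) -> crit_poly a <> 0 -> 0 < m ->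
  (forall z w, Ball a z -> Ball a w -> m * Cmod (w - z) <= Cmod (Gsf w - Gsf z)) ->
  embedded_end M0 (fr 1 1) (Some a).
Proof.
  intros He Hc Hr Hp Hm Hlow. assert (H5 := fe_pole a h He).
  destruct (theta_end_tau a h c He Hc Hr) as (c' & Hc' & Ht).
  destruct (gauss_bounds a h He) as (B & HB & NB).
  assert (N := Near_and _ _ _ (fe_M0 a h He) (Near_Ball a)).
  apply (embed_finite a B m Gf Gsf dGf dGsf ell tau); trivial.
  - apply (fe_M0 a h He).
  - apply (theta_end_metric a h c); trivial.
  - revert N. apply Near_imp. intros z [Hz Hb]. apply zeta_fin; auto.
  - intros e Hep. generalize (Near_and _ _ _ (Near_weight a c' tau Hc' Ht e Hep) (Near_and _ _ _ NB N)).
    apply Near_imp. intros z (K & (K1 & K2 & K3) & Hz & Hb). specialize (H5 z Hb).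
    split; trivial. split; trivial. now apply tau_pos. now apply rder_tau. now apply ell_eq.
Qed.

(** At an end where omega dominates, the ratio tends to infinity, and the mean is read with
    the inverse weight and dominated by G. *)
Lemma embed_omega_end a h c m : finite_end a h -> 0 < c -> Near a (fun z => rad z ^ 4 <= c * sqn (z - a) ^ 2) -> a <> 0 -> 0 < m ->
  (forall z w, Ball a z -> Ball a w -> m * Cmod (w - z) <= Cmod (Gf w - Gf z)) ->
  embedded_end M0 (fr 1 1) (Some a).
Proof.
  intros He Hc Hr Ha Hm Hlow. assert (H5 := fe_pole a h He).
  destruct (omega_end_tau a h c He Hc Hr) as (c' & Hc' & Ht).
  destruct (gauss_bounds a h He) as (B & HB & NB).
  assert (N := Near_and _ _ _ (fe_M0 a h He) (Near_Ball a)).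
  apply (embed_finite a B m Gsf Gf dGsf dGf (fun z => - ell z)%C (fun z => / tau z)); trivial.
  - apply (fe_M0 a h He).
  - apply (omega_end_metric a h c); trivial.
  - revert N. apply Near_imp. intros z [Hz Hb]. rewrite zeta_fin by auto. apply mean_swap; auto.
  - intros e Hep. generalize (Near_and _ _ _ (Near_weight a c' (fun z => / tau z) Hc' Ht e Hep) (Near_and _ _ _ NB N)).
    apply Near_imp. intros z (K & (K1 & K2 & K3) & Hz & Hb). specialize (H5 z Hb).
    assert (Htp := tau_pos z Hz H5). split; trivial.
    + replace (Gsf z - Gf z)%C with (- (Gf z - Gsf z))%C by ring. now rewrite Cmod_opp.
    + split; trivial. now apply Rinv_0_lt_compat.
    + eapply rder_eq. apply rder_inv. lra. now apply rder_tau.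
      change (fst (- ell z)%C) with (- fst (ell z)). field. lra.
      change (snd (- ell z)%C) with (- snd (ell z)). field. lra.
    + assert (E := ell_eq z Hz H5). transitivity ((Gf z - Gsf z) * ell z)%C. ring. rewrite E. ring.
Qed.

Lemma embed_finite_end (a : R) : In a (0 :: 1 :: -2 :: -3/2 :: nil) -> embedded_end M0 (fr 1 1) (Some (RtoC a)).
Proof.
  intros [<-|[<-|[<-|[<-|[]]]]].
  - destruct rad_end0 as (c & Hc & N). apply (embed_theta_end _ h0 c (1/4) finite_end0 Hc N); [|lra|apply Gsf_lower_0].
    intros E. apply (f_equal fst) in E. simpl in E. lra.
  - destruct rad_end1 as (c & Hc & N).
    apply (embed_omega_end _ h1 c 2 finite_end1 Hc N); [apply RtoC_neq0; lra | lra | apply Gf_lower_1].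
  - destruct rad_end2 as (c & Hc & N). apply (embed_theta_end _ h2 c (1/4) finite_end2 Hc N); [|lra|apply Gsf_lower_2].
    intros E. apply (f_equal fst) in E. simpl in E. lra.
  - destruct rad_end3 as (c & Hc & N).
    apply (embed_omega_end _ h3 c 2 finite_end3 Hc N); [apply RtoC_neq0; lra | lra | apply Gf_lower_3].
Qed.

(** ** The end at infinity *)

(** In the coordinate w = 1/z the Gauss maps are replaced by their reciprocals, and the
    lower entries of the frame by the upper ones. *)

Definition GI (w : C) : C := (w * w * w)%C.
Definition GsI (w : C) : C := (w * (2 + 5 * w) / (1 + 6 * w))%C.
Definition dGI (w : C) : C := (3 * w * w)%C.
Definition dGsI (w : C) : C := ((2 + 10 * w + 30 * w * w) / ((1 + 6 * w) * (1 + 6 * w)))%C.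

Lemma cder_GI z : cder GI z (dGI z).
Proof. eapply cder_eq. unfold GI. cder_tac. unfold dGI. simpl. ring. Qed.
Lemma cder_GsI z : (1 + 6 * z)%C <> 0 -> cder GsI z (dGsI z).
Proof. intros H. eapply cder_eq. unfold GsI. apply cder_div; [trivial|cder_tac..]. unfold dGsI. simpl. field. trivial. Qed.

Section RatioInf.
Variable z : C.
Hypothesis Hz : M0 z.
Hypothesis H6 : (z + 6)%C <> RtoC 0.
Let r := RtoC (rad z).

Lemma sigma_eq : sqn (e11 r z) / sqn (e12 r z) = sigma z.
Proof.
  assert (HQ := Qp_neq0 z Hz). assert (H0 := proj1 (M0_factors z Hz)). assert (Hr := rad_neq0 z Hz).
  unfold sigma, e11, e12. rewrite !sqn_div, !sqn_mult by (repeat first [assumption | apply Cmult_neq_0]).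
  replace (rad z ^ 4) with (sqn r ^ 2) by (unfold r; rewrite sqn_RtoC; ring).
  apply sqn_pos in HQ, H0, Hr, H6. fold r in Hr. field. lra.
Qed.

Lemma sigma_pos : 0 < sigma z.
Proof.
  destruct (M0_sqn z Hz) as (H0 & _). assert (HQ := sqn_pos _ (Qp_neq0 z Hz)). pose proof (rad_pos_M0 z Hz) as Hr.
  apply sqn_pos in H6 as H6'. unfold sigma. apply Rdiv_lt_0_compat; apply Rmult_lt_0_compat; trivial; now apply pow_lt.
Qed.

Lemma e12_neq0 : e12 r z <> RtoC 0.
Proof.
  assert (HQ := Qp_neq0 z Hz). assert (Hr := rad_neq0 z Hz). fold r in Hr.
  apply sqn_neq0. unfold e12. rewrite sqn_div, !sqn_mult by (repeat first [assumption | apply Cmult_neq_0]).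
  apply sqn_pos in HQ, Hr, H6. apply Rdiv_lt_0_compat; nra.
Qed.

Lemma zeta_inf_eq : (chart_num (-1) (fr 1 1 z) / RtoC (chart_den (-1) (fr 1 1 z)))%C = mean GI GsI (fun w => sigma (/ w)) (/ z).
Proof.
  assert (HQ := Qp_neq0 z Hz). assert (H0 := proj1 (M0_factors z Hz)). assert (Hr := rad_neq0 z Hz). fold r in Hr.
  unfold fr. rewrite chart_num_inf, chart_den_inf. fold r. unfold mean.
  replace (/ / z)%C with z by (field; trivial). rewrite <- sigma_eq, <- weighted_mean by apply e12_neq0.
  f_equal. rewrite <- !Cconj_mul_self.
  replace (e21 r z) with (GI (/ z) * e11 r z)%C by (unfold e11, e21, GI; field; auto).
  replace (e22 r z) with (GsI (/ z) * e12 r z)%C by (unfold e12, e22, GsI; field; auto). ring.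
Qed.
End RatioInf.

Definition ells (z : C) : C :=
  (3 / z + (6 * z * z + 10 * z - 1) / Qp z - 2 * eta z - 1 / (z + 6))%C.

Lemma rder_sigma z : M0 z -> (z + 6)%C <> 0 -> rder sigma z (2 * sigma z * fst (ells z)) (- (2 * sigma z * snd (ells z))).
Proof.
  intros Hz H6. destruct (M0_factors z Hz) as (Z0 & Z1 & Z2 & Z3 & Z4). assert (HQ := Qp_neq0 z Hz).
  apply (rder_over_rad (fun w => w * w * w * Qp w / (w + 6))%C); trivial.
  - eapply cder_eq. apply cder_div; [trivial | apply cder_mult; [cder_tac | apply Qp_cder] | cder_tac].
    unfold ells. cbv beta. field. auto.
  - assert (L := locally_neq0 (fun w => w + 6)%C z ltac:(cinf_tac) H6).
    generalize (filter_and _ _ L (open_M0 z Hz)). apply filter_imp. intros w [Hw HM].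
    unfold sigma. rewrite sqn_div, !sqn_mult by trivial. field.
    pose proof (rad_pos_M0 w HM). apply sqn_pos in Hw. lra.
Qed.

Definition ellI (w : C) : C := (ells (/ w) * - (/ (w * w)))%C.

Section AtW.
Variable w : C.
Hypothesis Hw : w <> RtoC 0.
Hypothesis HM : M0 (/ w).
Hypothesis H6 : (1 + 6 * w)%C <> RtoC 0.

Lemma inv_plus_6 : (/ w + 6)%C <> RtoC 0.
Proof.
  intros E. apply H6. transitivity (w * (/ w + 6))%C. field. trivial. rewrite E. ring.
Qed.

Lemma rder_sigma_inv : rder (fun w => sigma (/ w)) w (2 * sigma (/ w) * fst (ellI w)) (- (2 * sigma (/ w) * snd (ellI w))).
Proof.
  assert (K := rder_cder_comp sigma Cinv w _ _ _ (rder_sigma (/ w)%C HM inv_plus_6) (cder_Cinv w Hw)).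
  eapply rder_eq. exact K.
  unfold ellI. generalize (ells (/ w)) (- / (w * w))%C. intros [a b] [c d]; simpl. ring.
  unfold ellI. generalize (ells (/ w)) (- / (w * w))%C. intros [a b] [c d]; simpl. ring.
Qed.

Lemma ellI_eq : ((GI w - GsI w) * ellI w = - (dGI w + dGsI w))%C.
Proof.
  destruct (M0_factors _ HM) as (Z0 & Z1 & Z2 & Z3 & Z4).
  assert (K1 : (1 - w)%C <> 0). { intros E. apply Z1. transitivity ((1 - w) / w)%C. field; trivial. rewrite E. field. trivial. }
  assert (K2 : (1 + 2 * w)%C <> 0). { intros E. apply Z2. transitivity ((1 + 2 * w) / w)%C. field; trivial. rewrite E. field. trivial. }
  assert (K3 : (2 + 3 * w)%C <> 0). { intros E. apply Z3. transitivity ((2 + 3 * w) / w)%C. field; trivial. rewrite E. field. trivial. }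
  unfold GI, GsI, ellI, ells, dGI, dGsI, eta, Qp. field. repeat split; trivial.
Qed.
End AtW.

Lemma GsI_lower z w : Ball 0 z -> Ball 0 w -> 1/8 * Cmod (w - z) <= Cmod (GsI w - GsI z).
Proof.
  intros Hz Hw.
  assert (Nz : (1 + 6 * z)%C <> 0) by far Hz. assert (Nw : (1 + 6 * w)%C <> 0) by far Hw.
  apply Ball_coords in Hz, Hw.
  replace (GsI w - GsI z)%C with ((2 + 5 * (z + w) + 30 * z * w) * (w - z) / ((1 + 6 * z) * (1 + 6 * w)))%C
    by (unfold GsI; field; auto).
  apply quot_lower with (62/100) (22/10); trivial; try lra. simpl; nra. cmod_coords. cmod_coords.
Qed.

Lemma punctured_disc_None r z : 0 < r -> punctured_disc None r z <-> z <> 0 /\ Cmod (/ z) < r.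
Proof.
  intros Hr. split.
  - intros (w & Hw & ->). simpl. assert (w <> 0) by (apply Cmod_gt_0; lra). split.
    + intros E. assert (K : (w * / w)%C = 1) by (field; trivial). rewrite E, Cmult_0_r in K. apply RtoC_inj in K. lra.
    + replace (/ / w)%C with w by (field; trivial). lra.
  - intros [H0 H]. exists (/ z)%C. split. split; trivial.
    rewrite Cmod_inv by trivial. apply Rinv_0_lt_compat. now apply Cmod_gt_0. simpl. field. trivial.
Qed.

Lemma open_punctured_disc_None r : 0 < r -> open (punctured_disc None r).
Proof.
  intros Hr z Hz. apply punctured_disc_None in Hz; trivial. destruct Hz as [H0 H].
  assert (L : locally z (fun y : C => Cmod (/ y) < r)).
  { apply locally_lt; trivial.
    apply (continuous_comp Cinv Cmod). eapply cder_continuous, cder_Cinv, H0.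
    apply (filterlim_norm (V:=C_NormedModule)). }
  generalize (filter_and _ _ (open_neq_C 0 z H0) L). apply filter_imp. intros y Hy. now apply punctured_disc_None.
Qed.

Lemma embed_end_inf : embedded_end M0 (fr 1 1) None.
Proof.
  destruct endinf_metric as (c & Hc & Hmet). destruct endinf_sigma as (c' & Hc' & Hsig).
  assert (N6 : forall w, Ball 0 w -> (1 + 6 * w)%C <> 0) by (intros w Hw; apply sqn_neq0; now apply Ballinf_pos).
  assert (HN : Near 0 (fun w => (M0 (/ w) /\ Ball 0 w) /\ w <> 0)).
  { generalize (Near_and _ _ _ (Near_and _ _ _ endinf_M0 (Near_Ball 0)) (Near_small 0 1 Rlt_0_1)). apply Near_imp.
    intros w [K1 K2]. split; trivial. rewrite sqn_minus_0 in K2. apply sqn_neq0. lra. }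
  assert (Hsig' : Near 0 (fun w => sigma (/ w) <= c' * sqn (w - 0))).
  { revert Hsig. apply Near_imp. intros w. now rewrite sqn_minus_0. }
  destruct (Near_Cmod_upper 0 dGI) as (B1 & P1 & N1). { unfold dGI. cinf_tac. }
  destruct (Near_Cmod_upper 0 dGsI) as (B2 & P2 & N2).
  { unfold dGsI. apply CCinf_div. apply open_Ball. intros z Hz. apply Cmult_neq_0; now apply N6. cinf_tac. cinf_tac. }
  destruct (Near_Cmod_upper 0 (fun w => w * w - (2 + 5 * w) / (1 + 6 * w))%C) as (B3 & P3 & N3).
  { apply CCinf_minus. cinf_tac. apply CCinf_div. apply open_Ball. exact N6. cinf_tac. cinf_tac. }
  destruct (mean_near 0 (B1 + B2 + B3) (1/8) GI GsI dGI dGsI ellI (fun w => sigma (/ w))) as (r0 & Hr0 & Hlow); try lra.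
  - intros e He. generalize (Near_and _ _ _ (Near_and _ _ _ (Near_and _ _ _ N1 N2) N3)
      (Near_and _ _ _ HN (Near_weight 0 c' (fun w => sigma (/ w)) Hc' Hsig' e He))).
    apply Near_imp. intros z [[[K1 K2] K3] [[[HM Hb] H0] HT]]. specialize (N6 z Hb). split.
    + split. apply cder_GI. lra.
    + split. now apply cder_GsI. lra.
    + replace (GI z - GsI z)%C with ((z * z - (2 + 5 * z) / (1 + 6 * z)) * (z - 0))%C by (unfold GI, GsI; field; trivial).
      rewrite Cmod_mult. apply Rmult_le_compat_r. apply Cmod_ge_0. lra.
    + split; trivial. apply sigma_pos; trivial. now apply inv_plus_6.
    + now apply rder_sigma_inv.
    + now apply ellI_eq.
  - apply GsI_lower.
  - destruct (Near_punctured _ _ (Near_and _ _ _ Hmet HN)) as (d & Hd & H).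
    set (r := Rmin d r0). assert (Hr : 0 < r) by now apply Rmin_glb_lt.
    assert (HU : forall z, punctured_disc None r z ->
      M0 z /\ (z + 6)%C <> 0 /\ 0 < (norm_th z - norm_om z) ^ 2 /\ 0 < Cmod (/ z - 0) < r0 /\ z <> 0).
    { intros z Hz. apply punctured_disc_None in Hz; trivial. destruct Hz as [Z0 Z1].
      assert (R1 : r <= d) by apply Rmin_l. assert (R2 : r <= r0) by apply Rmin_r.
      assert (Z2 : 0 < Cmod (/ z)) by (rewrite Cmod_inv by trivial; now apply Rinv_0_lt_compat, Cmod_gt_0).
      assert (E : (/ z - 0 = / z)%C) by ring.
      destruct (H (/ z)%C) as [K1 [[K2 K3] K4]]. { rewrite E. lra. }
      assert (K6 := inv_plus_6 _ K4 (N6 _ K3)).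
      replace (/ / z)%C with z in * by (field; trivial). rewrite E. repeat split; try apply K2; trivial; lra. }
    exists (mkposreal r Hr). simpl pos. split. intros z Hz. now apply HU.
    assert (HO := open_punctured_disc_None r Hr).
    apply (chart_embedding (-1)). now right.
    + intros mu. apply Cinf_smooth; trivial. apply Cinf_fr; trivial. intros z Hz. now apply HU.
    + intros z Hz. apply fr_immersed_norms; now apply HU.
    + intros z Hz. apply den_inf_pos, HU, Hz.
    + intros z Hz eps He. destruct (HU z Hz) as (H1 & H2 & _ & H3 & H4).
      assert (Pz := proj1 (Cmod_gt_0 z) H4).
      (* the ratio of the coordinates controls |1/w - 1/z|, and 1/w stays away from 0 *)
      set (u := Cmod (/ z)). assert (Hu : 0 < u) by (unfold u; rewrite Cmod_inv by trivial; now apply Rinv_0_lt_compat).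
      set (e := Rmin (u / 2) (eps * u ^ 2 / 2)). assert (He' : 0 < e). { apply Rmin_glb_lt. lra. assert (0 < u ^ 2) by now apply pow_lt. nra. }
      exists (1 / 8 / 2 * e). split. lra. intros w Hw K. destruct (HU w Hw) as (W1 & W2 & _ & W3 & W4).
      rewrite !zeta_inf_eq in K by trivial.
      assert (K' := Hlow _ _ H3 W3).
      assert (L : Cmod (/ w - / z) < e) by lra.
      assert (L1 : Cmod (/ w - / z) < u / 2) by (eapply Rlt_le_trans; [exact L | apply Rmin_l]).
      assert (L2 : Cmod (/ w - / z) < eps * u ^ 2 / 2) by (eapply Rlt_le_trans; [exact L | apply Rmin_r]).
      assert (U2 : u / 2 <= Cmod (/ w)).
      { assert (u <= Cmod (/ w) + Cmod (/ w - / z)).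
        { unfold u. replace (/ z)%C with (/ w + - (/ w - / z))%C at 1 by ring. eapply Rle_trans. apply Cmod_triangle. rewrite Cmod_opp. lra. }
        lra. }
      replace (w - z)%C with (- (/ w - / z) / (/ w * / z))%C by (field; auto).
      assert (I0 : (/ w * / z)%C <> 0). { apply Cmod_gt_0. rewrite Cmod_mult. apply Rmult_lt_0_compat; trivial. lra. }
      rewrite Cmod_div, Cmod_opp, Cmod_mult by trivial. fold u.
      apply Rmult_lt_reg_r with (Cmod (/ w) * u). apply Rmult_lt_0_compat; lra.
      replace (Cmod (/ w - / z) / (Cmod (/ w) * u) * (Cmod (/ w) * u)) with (Cmod (/ w - / z)) by (field; lra).
      eapply Rlt_le_trans. exact L2. replace (eps * u ^ 2 / 2) with (eps * (u / 2 * u)) by field.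
      apply Rmult_le_compat_l. lra. apply Rmult_le_compat_r; lra.
Qed.

(** * Completeness *)

Definition poles (z : C) : R := / sqn z + / sqn (z - 1) + / sqn (z + 2) + / sqn (z + RtoC (3/2)).
(** An exhaustion function of M0. *)
Definition rho (z : C) : R := sqn z + poles z.

Lemma poles_pos z : M0 z -> 0 < poles z.
Proof.
  intros Hz. destruct (M0_sqn z Hz) as (H0 & H1 & H2 & H3). unfold poles.
  apply Rinv_0_lt_compat in H0, H1, H2, H3. lra.
Qed.

Lemma inv_le_100 x : 1/100 <= x -> / x <= 100.
Proof. intros H. replace 100 with (/ (1/100)) by field. apply Rinv_le_contravar; lra. Qed.

Lemma poles_bound x y z t : 0 < t < 1/100 -> / x <= 100 -> / y <= 100 -> / z <= 100 -> 1 + (/ x + / y + / z + / t) <= 5 * / t.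
Proof.
  intros H Hx Hy Hz. assert (100 < / t). { replace 100 with (/ (1/100)) by field. apply Rinv_lt_contravar; nra. }
  lra.
Qed.

Ltac far_bound H := apply inv_le_100; apply Ball_coords in H; unfold sqn, cdot; simpl; nra.

Lemma near_poles (a : R) z : In a (0 :: 1 :: -2 :: -3/2 :: nil) -> 0 < sqn (z - RtoC a) < 1/100 -> 1 + poles z <= 5 * / sqn (z - RtoC a).
Proof.
  intros Ha H. assert (HB : Ball (RtoC a) z) by apply H. unfold poles.
  destruct Ha as [<-|[<-|[<-|[<-|[]]]]].
  - rewrite sqn_minus_0 in *. pose proof (poles_bound (sqn (z - 1)) (sqn (z + 2)) (sqn (z + RtoC (3/2))) (sqn z) H).
    assert (/ sqn (z - 1) <= 100) by far_bound HB. assert (/ sqn (z + 2) <= 100) by far_bound HB.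
    assert (/ sqn (z + RtoC (3/2)) <= 100) by far_bound HB. lra.
  - pose proof (poles_bound (sqn z) (sqn (z + 2)) (sqn (z + RtoC (3/2))) (sqn (z - 1)) H).
    assert (/ sqn z <= 100) by far_bound HB. assert (/ sqn (z + 2) <= 100) by far_bound HB.
    assert (/ sqn (z + RtoC (3/2)) <= 100) by far_bound HB. lra.
  - rewrite minus_m2 in H |- *. pose proof (poles_bound (sqn z) (sqn (z - 1)) (sqn (z + RtoC (3/2))) (sqn (z + 2)) H).
    assert (/ sqn z <= 100) by far_bound HB. assert (/ sqn (z - 1) <= 100) by far_bound HB.
    assert (/ sqn (z + RtoC (3/2)) <= 100) by far_bound HB. lra.
  - rewrite minus_m3 in H |- *. pose proof (poles_bound (sqn z) (sqn (z - 1)) (sqn (z + 2)) (sqn (z + RtoC (3/2))) H).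
    assert (/ sqn z <= 100) by far_bound HB. assert (/ sqn (z - 1) <= 100) by far_bound HB.
    assert (/ sqn (z + 2) <= 100) by far_bound HB. lra.
Qed.

Lemma metric_near_end a : In a (0 :: 1 :: -2 :: -3/2 :: nil) ->
  exists c, 0 < c /\ Near (RtoC a) (fun z => c * (1 + poles z) <= (norm_th z - norm_om z) ^ 2).
Proof.
  intros Ha. destruct (end_metric a Ha) as (c & Hc & K). exists (c / 5). split. lra.
  assert (Hs : 0 < 1/100) by lra.
  generalize (Near_and _ _ _ K (Near_small (RtoC a) _ Hs)). apply Near_imp. intros z [H1 H2].
  pose proof (near_poles a z Ha H2). assert (Hi := Rinv_0_lt_compat _ (proj1 H2)).
  apply Rle_trans with (c * / sqn (z - RtoC a)).
  - replace (c * / sqn (z - RtoC a)) with (c / 5 * (5 * / sqn (z - RtoC a))) by (field; lra). apply Rmult_le_compat_l; lra.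
  - apply Rmult_le_reg_r with (sqn (z - RtoC a)). lra. rewrite Rmult_assoc, Rinv_l, Rmult_1_r; lra.
Qed.

Lemma metric_near_infinity : exists c, 0 < c /\ exists D, 0 < D /\ forall z, D < sqn z -> c * (1 + poles z) <= (norm_th z - norm_om z) ^ 2.
Proof.
  destruct endinf_metric as (c & Hc & d & Hd & H). exists (c / 5). split. lra.
  exists (Rmax (/ d) 100). split. eapply Rlt_le_trans; [|apply Rmax_r]. lra.
  intros z Hz. pose proof (Rmax_l (/ d) 100). pose proof (Rmax_r (/ d) 100).
  assert (Hz0 : z <> 0) by (apply sqn_neq0; lra).
  specialize (H (/ z)%C). replace (/ / z)%C with z in H by (field; trivial).
  rewrite sqn_minus_0, sqn_inv in H by trivial.
  assert (K : c <= (norm_th z - norm_om z) ^ 2).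
  { apply H. split. apply Rinv_0_lt_compat; lra. rewrite <- (Rinv_inv d). apply Rinv_lt_contravar; [|lra].
    apply Rmult_lt_0_compat; [now apply Rinv_0_lt_compat|lra]. }
  assert (P : poles z <= 4).
  { assert (B : forall x, 1 <= x -> / x <= 1) by (intros x Hx; rewrite <- Rinv_1; apply Rinv_le_contravar; lra).
    assert (Q : 100 < sqn z) by lra. clear -B Q. unfold poles.
    assert (forall b : R, -2 <= b <= 2 -> 1 <= sqn (z + RtoC b)).
    { intros b Hb. unfold sqn, cdot in *. simpl. pose proof (pow2_ge_0 (fst z + 2 * b)). nra. }
    assert (/ sqn z <= 1) by (apply B; lra). assert (/ sqn (z + 2) <= 1) by (apply B, H; lra).
    assert (/ sqn (z + RtoC (3/2)) <= 1) by (apply B, H; lra).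
    assert (/ sqn (z - 1) <= 1). { apply B. replace (z - 1)%C with (z + RtoC (-1))%C by (apply C_ext; simpl; lra). apply H; lra. }
    lra. }
  apply Rle_trans with (c / 5 * 5); [|lra]. apply Rmult_le_compat_l; lra.
Qed.

(** Off a compact set the first fundamental form dominates (1 + poles) |dz|^2, in which the
    distance to an end is infinite; a smooth cut-off supplies the bound on the compact set. *)
Lemma metric_lower : exists c D, 0 < c /\ forall z, M0 z ->
  c * (1 + poles z) <= (norm_th z - norm_om z) ^ 2 + bump 0 (D - rho z).
Proof.
  destruct metric_near_infinity as (ci & Hci & D & HD & Hi).
  destruct (metric_near_end 0) as (c0 & Hc0 & d0 & Hd0 & H0). simpl; tauto.
  destruct (metric_near_end 1) as (c1 & Hc1 & d1 & Hd1 & H1). simpl; tauto.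
  destruct (metric_near_end (-2)) as (c2 & Hc2 & d2 & Hd2 & H2). simpl; tauto.
  destruct (metric_near_end (-3/2)) as (c3 & Hc3 & d3 & Hd3 & H3). simpl; tauto.
  set (S := / d0 + / d1 + / d2 + / d3).
  assert (HS : 0 < S). { unfold S. apply Rinv_0_lt_compat in Hd0, Hd1, Hd2, Hd3. lra. }
  set (cb := bump 0 1 / (1 + S)).
  assert (Hcb : 0 < cb). { apply Rdiv_lt_0_compat. apply bump_pos; lra. lra. }
  set (c := Rmin (Rmin (Rmin ci c0) (Rmin c1 c2)) (Rmin c3 cb)).
  assert (L1 := Rmin_l (Rmin (Rmin ci c0) (Rmin c1 c2)) (Rmin c3 cb)).
  assert (L2 := Rmin_r (Rmin (Rmin ci c0) (Rmin c1 c2)) (Rmin c3 cb)).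
  assert (L3 := Rmin_l (Rmin ci c0) (Rmin c1 c2)). assert (L4 := Rmin_r (Rmin ci c0) (Rmin c1 c2)).
  assert (L5 := Rmin_l ci c0). assert (L6 := Rmin_r ci c0). assert (L7 := Rmin_l c1 c2). assert (L8 := Rmin_r c1 c2).
  assert (L9 := Rmin_l c3 cb). assert (L10 := Rmin_r c3 cb).
  exists c, (D + S + 1). split.
  { unfold c. repeat apply Rmin_glb_lt; trivial. }
  fold c in L1, L2. intros z Hz. pose proof (poles_pos z Hz) as HP. pose proof (bump_ge_0 (D + S + 1 - rho z)) as Hb.
  destruct (M0_sqn z Hz) as (N0 & N1 & N2 & N3).
  assert (R : forall x, c <= x -> x * (1 + poles z) <= (norm_th z - norm_om z) ^ 2 -> c * (1 + poles z) <= (norm_th z - norm_om z) ^ 2 + bump 0 (D + S + 1 - rho z)).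
  { intros x Hx K. assert (c * (1 + poles z) <= x * (1 + poles z)) by (apply Rmult_le_compat_r; lra). lra. }
  destruct (Rlt_le_dec D (sqn z)) as [K|K]. apply (R ci). lra. now apply Hi.
  destruct (Rlt_le_dec (sqn z) d0) as [K0|K0]. { apply (R c0). lra. apply H0. rewrite sqn_minus_0. lra. }
  destruct (Rlt_le_dec (sqn (z - 1)) d1) as [K1|K1]. { apply (R c1). lra. apply H1. lra. }
  destruct (Rlt_le_dec (sqn (z + 2)) d2) as [K2|K2]. { apply (R c2). lra. apply H2. rewrite minus_m2. lra. }
  destruct (Rlt_le_dec (sqn (z + RtoC (3/2))) d3) as [K3|K3]. { apply (R c3). lra. apply H3. rewrite minus_m3. lra. }
  apply Rinv_le_contravar in K0, K1, K2, K3; trivial.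
  assert (P : poles z <= S) by (unfold poles, S; lra).
  assert (B : bump 0 1 <= bump 0 (D + S + 1 - rho z)) by (apply bump_incr; unfold rho; lra).
  pose proof (pow2_ge_0 (norm_th z - norm_om z)).
  assert (c * (1 + poles z) <= cb * (1 + S)) by (apply Rmult_le_compat; try lra; unfold c; repeat apply Rmin_glb; lra).
  assert (cb * (1 + S) = bump 0 1) by (unfold cb; field; lra). lra.
Qed.

(** Heine-Borel, from the compactness of a box for gauges: the gauge at a point is a ball
    inside a member of the cover, or one that misses [K]. *)
Lemma compact_closed_bounded (K : C -> Prop) (b : R) :
  (forall z, K z -> - b <= fst z <= b /\ - b <= snd z <= b) ->
  (forall z, ~ K z -> locally z (fun w => ~ K w)) -> compact_set K.
Proof.
  intros Hb Hcl F HF Hcov.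
  set (good := fun (t : C) (d : posreal) (O : C -> Prop) => F O /\ (forall w : C, ball t d w -> O w) \/ (forall w : C, ball t d w -> ~ K w)).
  assert (Hd : forall t : C, exists dO : posreal * (C -> Prop), good t (fst dO) (snd dO)).
  { intros t. destruct (classic (K t)) as [Ht|Ht].
    - destruct (Hcov t Ht) as (O & HO & Ot). destruct (HF O HO t Ot) as [d Hd]. exists (d, O). left. auto.
    - destruct (Hcl t Ht) as [d Hd]. exists (d, K). right. exact Hd. }
  set (ch := fun t => proj1_sig (constructive_indefinite_description _ (Hd t))).
  assert (Hch : forall t, good t (fst (ch t)) (snd (ch t))) by (intros t; exact (proj2_sig (constructive_indefinite_description _ (Hd t)))).
  set (pt := fun t : Tn 2 R => (fst t, fst (snd t)) : C).
  apply NNPP. intros Hno.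
  apply (compactness_list 2 (- b, (- b, tt)) (b, (b, tt)) (fun t => fst (ch (pt t)))). intros (l & Hl). apply Hno. clear Hno.
  assert (L : forall l : list (Tn 2 R), exists lO : list (C -> Prop), (forall O, In O lO -> F O) /\
    forall t, In t l -> forall x, ball (pt t) (fst (ch (pt t))) x -> K x -> exists O, In O lO /\ O x).
  { clear Hl l. induction l as [|t l (lO & H1 & H2)].
    - exists nil. split. intros O []. intros t [].
    - destruct (Hch (pt t)) as [[G1 G2]|G].
      + exists (snd (ch (pt t)) :: lO). split. intros O [<-|HO]; auto.
        intros t' [<-|Ht'] x Hx Kx. exists (snd (ch (pt t))). split; [now left | auto].
        destruct (H2 t' Ht' x Hx Kx) as (O & HO & Ox). exists O. split; trivial. now right.
      + exists lO. split; trivial. intros t' [<-|Ht'] x Hx Kx; [destruct (G x Hx Kx) | eauto]. }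
  destruct (L l) as (lO & H1 & H2). exists lO. split; trivial. intros [x y] Kx.
  destruct (Hb _ Kx) as [B1 B2]. simpl in B1, B2.
  destruct (Hl (x, (y, tt))) as ((t1 & t2 & u) & Ht & _ & Hc). simpl. auto.
  apply (H2 (t1, (t2, u)) Ht); trivial. destruct Hc as (C1 & C2 & _). split; trivial.
Qed.

Lemma Cinf_poles : Cinf M0 poles.
Proof.
  unfold poles. cinf_real; intros z Hz; apply Rgt_not_eq, (M0_sqn z Hz).
Qed.

Lemma Cinf_rho : Cinf M0 rho.
Proof. apply Cinf_plus. apply Cinf_sqn; cinf_tac. apply Cinf_poles. Qed.

Definition core (D : R) (z : C) : Prop := M0 z /\ rho z <= D.

Lemma core_poles D z : core D z -> sqn z <= D /\ (0 < D /\ / D <= sqn z /\ / D <= sqn (z - 1) /\ / D <= sqn (z + 2) /\ / D <= sqn (z + RtoC (3/2))).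
Proof.
  intros [Hz H]. destruct (M0_sqn z Hz) as (N0 & N1 & N2 & N3). unfold rho, poles in H.
  assert (I0 := Rinv_0_lt_compat _ N0). assert (I1 := Rinv_0_lt_compat _ N1). assert (I2 := Rinv_0_lt_compat _ N2). assert (I3 := Rinv_0_lt_compat _ N3).
  assert (B : forall x, 0 < x -> / x <= D -> / D <= x).
  { intros x Hx K. rewrite <- (Rinv_inv x). apply Rinv_le_contravar; trivial. now apply Rinv_0_lt_compat. }
  repeat split; try lra; apply B; lra.
Qed.

Lemma compact_core D : compact_set (core D).
Proof.
  apply (compact_closed_bounded _ (D + 1)).
  - intros z H. destruct (core_poles D z H) as (H1 & H2 & _). unfold sqn, cdot in H1. split; nra.
  - intros z H. destruct (classic (M0 z)) as [Hz|Hz].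
    + assert (L : locally z (fun w => D < rho w)).
      { apply locally_gt. exact (Cinf_continuous M0 _ z Cinf_rho Hz). apply Rnot_le_lt. intros L. apply H. now split. }
      revert L. apply filter_imp. intros w Hw [_ K]. lra.
    + destruct (Rlt_le_dec 0 D) as [HD|HD].
      2: { apply filter_forall. intros w Hw. destruct (core_poles D w Hw) as (_ & H2 & _). lra. }
      assert (E : z = 0 \/ z = 1 \/ z = RtoC (-2) \/ z = RtoC (-3/2)).
      { apply NNPP. intros E. apply Hz. repeat split; tauto. }
      assert (HD' := Rinv_0_lt_compat _ HD).
      generalize (locally_sqn_lt z _ HD' z ltac:(now rewrite sqn_self)). apply filter_imp. intros w Hw K.
      destruct (core_poles D w K) as (_ & _ & K0 & K1 & K2 & K3).
      destruct E as [-> | [-> | [-> | ->] ] ].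
      rewrite sqn_minus_0 in Hw; lra. lra. rewrite minus_m2 in Hw; lra. rewrite minus_m3 in Hw; lra.
Qed.

Definition Tcore (D : R) : tensor2 := fun i j z =>
  match i, j with dx, dx => bump 0 (D - rho z) | dy, dy => bump 0 (D - rho z) | _, _ => 0 end.

Lemma Cinf_Tcore D i j : Cinf M0 (Tcore D i j).
Proof.
  assert (H : Cinf M0 (fun z => bump 0 (D - rho z))).
  { apply Cinf_bump. apply Cinf_minus. apply Cinf_const. apply Cinf_rho. }
  destruct i, j; trivial; exact (Cinf_const M0 0).
Qed.

Definition gcomp (D : R) : tensor2 := tensor_add (induced (fr 1 1)) (Tcore D).

Lemma Cinf_gcomp D i j : Cinf M0 (gcomp D i j).
Proof.
  apply Cinf_plus. apply Cinf_induced. apply open_M0. intros mu. apply Cinf_fr; auto using open_M0. apply Cinf_Tcore.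
Qed.

(** The first fundamental form is |theta + conj omega|^2, so its least eigenvalue is the
    square of the difference of the norms. *)
Lemma quad_gcomp D z v : M0 z ->
  ((norm_th z - norm_om z) ^ 2 + bump 0 (D - rho z)) * (v dx ^ 2 + v dy ^ 2) <= quad (gcomp D) z v.
Proof.
  intros Hz. unfold quad, gcomp, tensor_add, sum_dir. rewrite !fr_induced by trivial. unfold Tcore.
  set (V := (v dx, v dy) : C).
  assert (E : Cmod (thr z * V + Cconj (omr z * V)) ^ 2 =
    cdot (dev 1 1 (omr z) (thr z) dx) (dev 1 1 (omr z) (thr z) dx) * v dx * v dx
    + (cdot (dev 1 1 (omr z) (thr z) dx) (dev 1 1 (omr z) (thr z) dy) * v dx * v dy)
    + (cdot (dev 1 1 (omr z) (thr z) dy) (dev 1 1 (omr z) (thr z) dx) * v dy * v dx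
    + cdot (dev 1 1 (omr z) (thr z) dy) (dev 1 1 (omr z) (thr z) dy) * v dy * v dy)).
  { rewrite Cmod_sqr. unfold V, cdot. generalize (omr z) (thr z). intros [o1 o2] [s1 s2]. simpl. ring. }
  assert (N : Cmod V ^ 2 = v dx ^ 2 + v dy ^ 2) by (rewrite Cmod_sqr; reflexivity).
  assert (L : (norm_th z - norm_om z) ^ 2 * Cmod V ^ 2 <= Cmod (thr z * V + Cconj (omr z * V)) ^ 2).
  { assert (T1 : norm_th z * Cmod V <= Cmod (thr z * V + Cconj (omr z * V)) + norm_om z * Cmod V).
    { unfold norm_th, norm_om. rewrite <- !Cmod_mult, <- (Cmod_conj (omr z * V)), <- (Cmod_opp (Cconj (omr z * V))).
      eapply Rle_trans; [|apply Cmod_triangle]. right. f_equal. ring. }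
    assert (T2 : norm_om z * Cmod V <= Cmod (thr z * V + Cconj (omr z * V)) + norm_th z * Cmod V).
    { unfold norm_th, norm_om. rewrite <- !Cmod_mult. rewrite <- (Cmod_conj (omr z * V)), <- (Cmod_opp (thr z * V)).
      eapply Rle_trans; [|apply Cmod_triangle]. right. f_equal. ring. }
    pose proof (Cmod_ge_0 (thr z * V + Cconj (omr z * V))).
    replace ((norm_th z - norm_om z) ^ 2 * Cmod V ^ 2) with ((norm_th z * Cmod V - norm_om z * Cmod V) ^ 2) by ring.
    rewrite <- (pow2_abs (norm_th z * Cmod V - norm_om z * Cmod V)). apply pow_incr. split. apply Rabs_pos.
    apply Rabs_le. lra. }
  rewrite N, E in L. lra.
Qed.

Lemma C1_curve_cont U p q c t : C1_curve U p q c -> unit_interval t -> continuous c t.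
Proof.
  intros (_ & _ & H) Ht. destruct (H t Ht) as [_ Hd].
  apply (continuous_ext (fun s => (coord dx (c s), coord dy (c s)))). intros s. simpl. now destruct (c s).
  apply continuous_C_pair; apply (ex_derive_continuous (K:=R_AbsRing) (V:=R_NormedModule)), Hd.
Qed.

Lemma speed_continuous U g p q c t : (forall i j, Cinf U (g i j)) -> C1_curve U p q c -> unit_interval t ->
  continuous (fun t => sqrt (quad g (c t) (velocity c t))) t.
Proof.
  intros Hg Hc Ht. assert (Cc := C1_curve_cont U p q c t Hc Ht). destruct Hc as (_ & _ & H). destruct (H t Ht) as [HU Hd].
  apply (continuous_comp (fun t => quad g (c t) (velocity c t)) sqrt).
  - assert (K : forall i j, continuous (fun t => g i j (c t) * velocity c t i * velocity c t j) t).
    { intros i j. apply (continuous_mult (K:=R_AbsRing)). apply (continuous_mult (K:=R_AbsRing)).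
      apply (continuous_comp c (g i j)); trivial. exact (Cinf_continuous U _ _ (Hg i j) HU).
      apply Hd. apply Hd. }
    assert (P := fun i => continuous_plus (V:=R_NormedModule) _ _ t (K i dx) (K i dy)).
    exact (continuous_plus (V:=R_NormedModule) _ _ t (P dx) (P dy)).
  - apply continuous_sqrt.
Qed.

(** A function whose differential is bounded by a metric is 1-Lipschitz for its lengths. *)
Lemma length_lower U g (u p q : C -> R) a b c : (forall i j, Cinf U (g i j)) ->
  (forall z, U z -> rder u z (p z) (q z)) -> Cinf U p -> Cinf U q ->
  (forall z v, U z -> (p z * v dx + q z * v dy) ^ 2 <= quad g z v) ->
  C1_curve U a b c -> Rabs (u b - u a) <= curve_length g c.
Proof.
  intros Hg Hu Hp Hq Hb Hc.
  set (du := fun t => p (c t) * velocity c t dx + q (c t) * velocity c t dy).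
  assert (HI : forall t, Rmin 0 1 <= t <= Rmax 0 1 -> unit_interval t).
  { intros t Ht. rewrite Rmin_left, Rmax_right in Ht by lra. exact Ht. }
  assert (D : forall t, unit_interval t -> is_derive (fun t => u (c t)) t (du t)).
  { intros t Ht. destruct Hc as (_ & _ & H). destruct (H t Ht) as [HU Hd].
    apply (is_derive_ext (fun t => u (fst (c t), snd (c t)))). intros s. now destruct (c s).
    apply (rder_chain u (c t) (p (c t)) (q (c t)) (fun t => fst (c t)) (fun t => snd (c t))).
    now destruct (c t). now apply Hu.
    apply Derive_correct, (Hd dx). apply Derive_correct, (Hd dy). }
  assert (Dc : forall t, unit_interval t -> continuous du t).
  { intros t Ht. assert (Cc := C1_curve_cont U a b c t Hc Ht). destruct Hc as (_ & _ & H). destruct (H t Ht) as [HU Hd].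
    apply (continuous_plus (V:=R_NormedModule)); apply (continuous_mult (K:=R_AbsRing)).
    apply (continuous_comp c p); trivial. exact (Cinf_continuous U _ _ Hp HU).
    exact (proj2 (Hd dx)).
    apply (continuous_comp c q); trivial. exact (Cinf_continuous U _ _ Hq HU).
    exact (proj2 (Hd dy)). }
  assert (I : is_RInt du 0 1 (minus (u (c 1)) (u (c 0)))).
  { apply (is_RInt_derive (V:=R_CompleteNormedModule) (fun t => u (c t)) du). intros t Ht. now apply D, HI. intros t Ht. now apply Dc, HI. }
  assert (Hc' := Hc). destruct Hc' as (E0 & E1 & HU). rewrite E0, E1 in I.
  change (minus (u b) (u a)) with (u b - u a) in I.
  assert (Ex : ex_RInt du 0 1) by now exists (u b - u a).
  rewrite <- (is_RInt_unique _ _ _ _ I).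
  assert (Exs : ex_RInt (fun t => sqrt (quad g (c t) (velocity c t))) 0 1).
  { apply (ex_RInt_continuous (V:=R_CompleteNormedModule)). intros t Ht. apply (speed_continuous U g a b); auto. }
  eapply Rle_trans. apply abs_RInt_le; trivial; lra. unfold curve_length. apply RInt_le; trivial. lra.
  - apply (ex_RInt_continuous (V:=R_CompleteNormedModule)). intros t Ht.
    apply (continuous_comp du Rabs). now apply Dc, HI. apply continuous_Rabs.
  - intros t Ht. rewrite <- (sqrt_Rsqr_abs (du t)). apply sqrt_le_1_alt.
    replace ((du t)²) with ((du t) ^ 2) by (unfold Rsqr; ring). apply (Hb (c t) (velocity c t)). apply HU. unfold unit_interval. lra.
Qed.

Lemma riem_dist_lt U g p q e : Rbar_lt (riem_dist U g p q) (Finite e) -> exists c, C1_curve U p q c /\ curve_length g c < e.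
Proof.
  intros H.
  destruct (Classical_Prop.classic (exists c, C1_curve U p q c /\ curve_length g c < e)) as [K|K]; trivial. exfalso.
  unfold riem_dist in H. destruct (Glb_Rbar_correct (fun L => exists c, C1_curve U p q c /\ L = curve_length g c)) as [_ G].
  apply (Rbar_lt_not_le _ _ H). apply G. intros L (c & Hc & ->). apply Rnot_lt_le. intros L'. apply K. now exists c.
Qed.

Lemma riem_dist_le U g p q c : C1_curve U p q c -> Rbar_le (riem_dist U g p q) (Finite (curve_length g c)).
Proof.
  intros H. unfold riem_dist. destruct (Glb_Rbar_correct (fun L => exists c, C1_curve U p q c /\ L = curve_length g c)) as [G _].
  apply G. now exists c.
Qed.

(** Distances are locally bounded by Euclidean ones, so that a limit in the plane is a limit
    for the metric. *)
Lemma segment_length U g q : open U -> (forall i j, Cinf U (g i j)) -> U q ->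
  exists B d, 0 < B /\ 0 < d /\ forall p, Cmod (p - q) < d -> Rbar_le (riem_dist U g p q) (Finite (B * Cmod (p - q))).
Proof.
  intros HU Hg Hq.
  set (M := Rabs (g dx dx q) + Rabs (g dx dy q) + Rabs (g dy dx q) + Rabs (g dy dy q) + 1).
  assert (Hn : locally q (fun z => U z /\ forall i j, Rabs (g i j z) < M)).
  { assert (K : forall i j, locally q (fun z => Rabs (g i j z) < M)).
    { intros i j. apply locally_lt.
      - apply (continuous_comp (g i j) Rabs). exact (Cinf_continuous U _ _ (Hg i j) Hq). apply continuous_Rabs.
      - unfold M. pose proof (Rabs_pos (g dx dx q)). pose proof (Rabs_pos (g dx dy q)). pose proof (Rabs_pos (g dy dx q)). pose proof (Rabs_pos (g dy dy q)).
        destruct i, j; lra. }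
    generalize (filter_and _ _ (HU q Hq) (filter_and _ _ (filter_and _ _ (K dx dx) (K dx dy)) (filter_and _ _ (K dy dx) (K dy dy)))).
    apply filter_imp. intros z (H0 & (H1 & H2) & (H3 & H4)). split; trivial. intros [|] [|]; trivial. }
  apply locally_Cmod in Hn. destruct Hn as (d & Hd & H).
  assert (HM : 0 < M). { unfold M. pose proof (Rabs_pos (g dx dx q)). pose proof (Rabs_pos (g dx dy q)). pose proof (Rabs_pos (g dy dx q)). pose proof (Rabs_pos (g dy dy q)). lra. }
  exists (sqrt (4 * M)), d. split. apply sqrt_lt_R0; lra. split; trivial. intros p Hp.
  set (c := fun t : R => (fst p + t * (fst q - fst p), snd p + t * (snd q - snd p)) : C).
  set (w := fun i : dir => match i with dx => fst q - fst p | dy => snd q - snd p end).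
  assert (Hv : forall i t, is_derive (fun s => coord i (c s)) t (w i)).
  { intros [|] t; simpl; auto_derive; trivial; ring. }
  assert (Ev : forall t i, velocity c t i = w i) by (intros; apply is_derive_unique, Hv).
  assert (HcU : forall t, unit_interval t -> U (c t) /\ forall i j, Rabs (g i j (c t)) < M).
  { intros t [Ht0 Ht1]. apply H. replace (c t - q)%C with (RtoC (1 - t) * (p - q))%C by (apply C_ext; simpl; ring).
    rewrite Cmod_mult, Cmod_R, Rabs_pos_eq by lra. pose proof (Cmod_ge_0 (p - q)). nra. }
  assert (Hc : C1_curve U p q c).
  { split; [|split]. apply C_ext; simpl; ring. apply C_ext; simpl; ring.
    intros t Ht. split. now apply HcU. intros i. split. exists (w i). apply Hv.
    apply (continuous_ext (fun _ => w i)). intros s. symmetry. apply Ev. apply continuous_const. }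
  eapply Rbar_le_trans. apply (riem_dist_le U g p q c Hc). simpl.
  unfold curve_length.
  assert (L : Rabs (RInt (fun t => sqrt (quad g (c t) (velocity c t))) 0 1) <= (1 - 0) * (sqrt (4 * M) * Cmod (p - q))).
  { apply abs_RInt_le_const. lra.
    - apply (ex_RInt_continuous (V:=R_CompleteNormedModule)). intros t Ht. rewrite Rmin_left, Rmax_right in Ht by lra.
      apply (speed_continuous U g p q); auto.
    - intros t Ht. rewrite Rabs_pos_eq by apply sqrt_pos.
      rewrite <- (sqrt_pow2 (Cmod (p - q))) by apply Cmod_ge_0. rewrite <- sqrt_mult_alt by lra.
      apply sqrt_le_1_alt. unfold quad, sum_dir. rewrite !Ev. destruct (HcU t Ht) as [_ HB].
      rewrite Cmod_sqr.
      assert (W : forall i j, g i j (c t) * w i * w j <= M * (w dx ^ 2 + w dy ^ 2)).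
      { intros i j. specialize (HB i j). apply Rabs_lt_between in HB.
        assert (Rabs (w i * w j) <= w dx ^ 2 + w dy ^ 2).
        { rewrite Rabs_mult. rewrite <- (pow2_abs (w dx)), <- (pow2_abs (w dy)). pose proof (Rabs_pos (w dx)). pose proof (Rabs_pos (w dy)). destruct i, j; nra. }
        apply Rle_trans with (Rabs (g i j (c t) * (w i * w j))). rewrite Rmult_assoc. apply Rle_abs.
        rewrite Rabs_mult. apply Rmult_le_compat; try apply Rabs_pos; trivial. apply Rabs_le; lra. }
      replace (fst (p - q)%C ^ 2 + snd (p - q)%C ^ 2) with (w dx ^ 2 + w dy ^ 2) by (simpl; ring).
      pose proof (W dx dx). pose proof (W dx dy). pose proof (W dy dx). pose proof (W dy dy). lra. }
  eapply Rle_trans. apply Rle_abs. lra.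
Qed.

Lemma rder_lnsqn (a : C) z : 0 < sqn (z - a) ->
  rder (fun w => ln (sqn (w - a))) z (2 * fst (z - a)%C / sqn (z - a)) (2 * snd (z - a)%C / sqn (z - a)).
Proof.
  intros P. eapply rder_eq. apply (rder_comp ln (fun w => sqn (w - a))). now apply is_derive_ln.
  unfold sqn, cdot. simpl. rder_tac. simpl. field. lra. simpl. field. lra.
Qed.

Lemma pole_le_poles a z : In a (0 :: 1 :: -2 :: -3/2 :: nil) -> M0 z -> / sqn (z - RtoC a) <= poles z.
Proof.
  intros Ha Hz. destruct (M0_sqn z Hz) as (N0 & N1 & N2 & N3). unfold poles.
  apply Rinv_0_lt_compat in N0, N1, N2, N3.
  destruct Ha as [<-|[<-|[<-|[<-|[]]]]]; rewrite ?sqn_minus_0, ?minus_m2, ?minus_m3; lra.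
Qed.

Lemma M0_sqn_end a z : In a (0 :: 1 :: -2 :: -3/2 :: nil) -> M0 z -> 0 < sqn (z - RtoC a).
Proof.
  intros Ha (H0 & H1 & H2 & H3). apply sqn_pos, Cminus_eq_contra.
  destruct Ha as [<-|[<-|[<-|[<-|[]]]]]; trivial.
Qed.

Section Complete.
Variables (cc D : R).
Hypothesis Hcc : 0 < cc.
Hypothesis HD : forall z, M0 z -> cc * (1 + poles z) <= (norm_th z - norm_om z) ^ 2 + bump 0 (D - rho z).

Lemma quad_lower z v : M0 z -> cc * (1 + poles z) * (v dx ^ 2 + v dy ^ 2) <= quad (gcomp D) z v.
Proof.
  intros Hz. eapply Rle_trans; [|now apply quad_gcomp]. apply Rmult_le_compat_r. nra. now apply HD.
Qed.

(** The Euclidean part of the lower bound [quad_lower] makes Cauchy sequences converge in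
    the plane. *)
Lemma length_coord i p q c : C1_curve M0 p q c -> sqrt cc * Rabs (coord i q - coord i p) <= curve_length (gcomp D) c.
Proof.
  intros Hc. set (e := fun j => match i, j with dx, dx | dy, dy => sqrt cc | _, _ => 0 end).
  rewrite <- (Rabs_pos_eq (sqrt cc)) by apply sqrt_pos. rewrite <- Rabs_mult, Rmult_minus_distr_l.
  apply (length_lower M0 (gcomp D) (fun z => sqrt cc * coord i z) (fun _ => e dx) (fun _ => e dy));
    try apply Cinf_const; trivial.
  - apply Cinf_gcomp.
  - intros z _. apply rder_affine with 0. intros w. unfold e. destruct i; simpl; ring.
  - intros z v Hz. eapply Rle_trans; [|now apply quad_lower]. pose proof (poles_pos z Hz).
    apply Rle_trans with (cc * 1 * (v dx ^ 2 + v dy ^ 2)).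
    + replace cc with (sqrt cc ^ 2) at 1 by (apply pow2_sqrt; lra).
      pose proof (pow2_ge_0 (sqrt cc * v dx)). pose proof (pow2_ge_0 (sqrt cc * v dy)). unfold e. destruct i; lra.
    + apply Rmult_le_compat_r. nra. apply Rmult_le_compat_l; lra.
Qed.

(** The logarithm of the distance to an end is Lipschitz, so the end is at infinite
    distance. *)
Lemma length_ln a p q c : In a (0 :: 1 :: -2 :: -3/2 :: nil) -> C1_curve M0 p q c ->
  sqrt cc * / 2 * Rabs (ln (sqn (q - RtoC a)) - ln (sqn (p - RtoC a))) <= curve_length (gcomp D) c.
Proof.
  intros Ha Hc.
  assert (H := length_lower M0 (gcomp D) (fun z => sqrt cc * / 2 * ln (sqn (z - RtoC a)))
    (fun z => sqrt cc * / 2 * (2 * fst (z - RtoC a)%C * / sqn (z - RtoC a))) (fun z => sqrt cc * / 2 * (2 * snd (z - RtoC a)%C * / sqn (z - RtoC a))) p q c (Cinf_gcomp D)).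
  assert (P : 0 <= sqrt cc * / 2) by (pose proof (sqrt_pos cc); lra).
  rewrite <- (Rabs_pos_eq (sqrt cc * / 2)) by trivial. rewrite <- Rabs_mult, Rmult_minus_distr_l.
  assert (NZ := fun z => M0_sqn_end a z Ha).
  assert (Ci : Cinf M0 (fun z => / sqn (z - RtoC a))).
  { apply Cinf_inv. intros z Hz. apply Rgt_not_eq, NZ, Hz. apply Cinf_sqn. cinf_tac. }
  assert (Cd : CCinf M0 (fun z => z - RtoC a)%C) by cinf_tac. destruct Cd as [Cd1 Cd2].
  apply H; trivial.
  - intros z Hz. eapply rder_eq. apply rder_mult. apply rder_const. now apply rder_lnsqn, NZ. unfold Rdiv; cbv beta; ring. unfold Rdiv; cbv beta; ring.
  - repeat first [eassumption | apply Cinf_mult | apply Cinf_const].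
  - repeat first [eassumption | apply Cinf_mult | apply Cinf_const].
  - intros z v Hz. eapply Rle_trans; [|now apply quad_lower].
    specialize (NZ z Hz). pose proof (pole_le_poles a z Ha Hz) as HP. set (x := (z - RtoC a)%C) in *.
    replace ((sqrt cc * / 2 * (2 * fst x * / sqn x) * v dx + sqrt cc * / 2 * (2 * snd x * / sqn x) * v dy) ^ 2)
      with (sqrt cc ^ 2 * (/ sqn x * / sqn x * (fst x * v dx + snd x * v dy) ^ 2)) by (field; lra).
    rewrite pow2_sqrt by lra. rewrite (Rmult_assoc cc (1 + poles z)). apply Rmult_le_compat_l. lra.
    apply Rle_trans with (/ sqn x * (v dx ^ 2 + v dy ^ 2)).
    + rewrite Rmult_assoc. assert (Hi := Rinv_0_lt_compat _ NZ). apply Rmult_le_compat_l. lra.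
      apply Rmult_le_reg_l with (sqn x); trivial. rewrite <- Rmult_assoc, Rinv_r, Rmult_1_l by lra. unfold sqn, cdot.
      pose proof (pow2_ge_0 (fst x * v dy - snd x * v dx)). nra.
    + apply Rmult_le_compat_r. nra. lra.
Qed.

Lemma gcomp_riemannian : riemannian M0 (gcomp D).
Proof.
  split. split.
  - intros i j. apply Cinf_smooth. apply open_M0. apply Cinf_gcomp.
  - intros i j z Hz. unfold gcomp, tensor_add, induced, lorentz, Tcore. destruct i, j; ring.
  - intros z v Hz (i & Hi). eapply Rlt_le_trans; [|now apply quad_lower]. pose proof (poles_pos z Hz).
    assert (0 < v dx ^ 2 + v dy ^ 2). { pose proof (pow2_ge_0 (v dx)). pose proof (pow2_ge_0 (v dy)). destruct i; pose proof (pow_nonzero _ 2 Hi); lra. }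
    apply Rmult_lt_0_compat; trivial. nra.
Qed.

Lemma gcomp_complete : complete_metric M0 (gcomp D).
Proof.
  split. apply gcomp_riemannian.
  intros s Hs HC.
  assert (Hk : 0 < sqrt cc) by now apply sqrt_lt_R0.
  assert (Cau : forall u : C -> R, (exists k, 0 < k /\ forall p q c, C1_curve M0 p q c -> k * Rabs (u q - u p) <= curve_length (gcomp D) c) ->
    forall eps : posreal, exists N : nat, forall m n : nat, (N <= m)%nat -> (N <= n)%nat -> Rabs (u (s n) - u (s m)) < eps).
  { intros u (k & Hk' & Hu) eps. assert (He : 0 < k * eps) by (apply Rmult_lt_0_compat; [trivial|apply cond_pos]).
    destruct (HC (mkposreal _ He)) as [N HN]. exists N. intros m n Hm Hn.
    destruct (riem_dist_lt _ _ _ _ _ (HN m n Hm Hn)) as (c & Hc & L). simpl in L.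
    apply Rmult_lt_reg_l with k; trivial. eapply Rle_lt_trans; [|exact L]. now apply Hu. }
  assert (C1 := Cau (coord dx) (ex_intro _ _ (conj Hk (length_coord dx)))).
  assert (C2 := Cau (coord dy) (ex_intro _ _ (conj Hk (length_coord dy)))).
  destruct (proj2 (ex_lim_seq_cauchy_corr (fun n => fst (s n)))) as [l1 Hl1].
  { intros eps. destruct (C1 eps) as [N HN]. exists N. intros n m Hn Hm. apply HN; trivial. }
  destruct (proj2 (ex_lim_seq_cauchy_corr (fun n => snd (s n)))) as [l2 Hl2].
  { intros eps. destruct (C2 eps) as [N HN]. exists N. intros n m Hn Hm. apply HN; trivial. }
  set (q := (l1, l2) : C).
  assert (Hq : forall eps, 0 < eps -> exists N : nat, forall n, (N <= n)%nat -> Cmod (s n - q) < eps).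
  { intros eps He. assert (He2 : 0 < eps / 2) by lra.
    apply is_lim_seq_spec in Hl1, Hl2. destruct (Hl1 (mkposreal _ He2)) as [N1 H1]. destruct (Hl2 (mkposreal _ He2)) as [N2 H2].
    exists (N1 + N2)%nat. intros n Hn. eapply Rle_lt_trans. apply Cmod_le_sum.
    specialize (H1 n ltac:(lia)). specialize (H2 n ltac:(lia)). simpl in H1, H2 |- *. unfold Rminus in *. lra. }
  assert (HM : M0 q).
  { assert (NE : forall a, In a (0 :: 1 :: -2 :: -3/2 :: nil) -> q <> RtoC a).
    { intros a Ha E.
      assert (K : 0 < sqrt cc * / 2) by lra.
      destruct (Cau (fun z => ln (sqn (z - RtoC a))) (ex_intro _ _ (conj K (fun p q c => length_ln a p q c Ha))) (mkposreal 1 Rlt_0_1)) as [N HN].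
      simpl in HN. set (L := ln (sqn (s N - RtoC a))) in *.
      destruct (Hq (sqrt (exp (L - 1)))) as [N' HN']. apply sqrt_lt_R0, exp_pos.
      set (n := (N + N')%nat). specialize (HN N n (le_n _) ltac:(lia)). specialize (HN' n ltac:(lia)). rewrite E in HN'.
      assert (Pn := M0_sqn_end a (s n) Ha (Hs n)).
      assert (B : sqn (s n - RtoC a) < exp (L - 1)).
      { rewrite sqn_Cmod, <- (sqrt_sqrt (exp (L - 1))) by (left; apply exp_pos). simpl. rewrite Rmult_1_r.
        apply Rmult_le_0_lt_compat; trivial; apply Cmod_ge_0. }
      apply ln_increasing in B; trivial. rewrite ln_exp in B. apply Rabs_lt_between in HN. fold L in HN. lra. }
    split; [|split; [|split]]; apply NE; simpl; tauto. }
  exists q. split; trivial. intros eps.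
  destruct (segment_length M0 (gcomp D) q open_M0 (Cinf_gcomp D) HM) as (B & d & HB & Hd & H).
  destruct (Hq (Rmin d (eps / B))) as [N HN]. { apply Rmin_glb_lt; trivial. apply Rdiv_lt_0_compat; trivial. apply cond_pos. }
  exists N. intros n Hn. specialize (HN n Hn). pose proof (Rmin_l d (eps / B)). pose proof (Rmin_r d (eps / B)).
  eapply Rbar_le_lt_trans. apply H. lra. simpl.
  apply Rlt_le_trans with (B * (eps / B)). apply Rmult_lt_compat_l; lra. right. field. lra.
Qed.
End Complete.

Lemma fr_complete : complete_front M0 (fr 1 1).
Proof.
  destruct metric_lower as (cc & D & Hcc & HD).
  exists (Tcore D), (core D). split; [|split; [|split; [|split]]].
  - split. intros i j. apply Cinf_smooth. apply open_M0. apply Cinf_Tcore.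
    intros i j z _. destruct i, j; reflexivity.
  - apply compact_core.
  - now intros z [Hz _].
  - intros i j z Hz HK. assert (D - rho z <= 0). { apply Rnot_lt_le. intros L. apply HK. split; trivial. lra. }
    destruct i, j; simpl; trivial; now apply bump_0.
  - exact (gcomp_complete cc D Hcc HD).
Qed.

(** * Continuation of logarithms along paths *)

Lemma unit_0 : unit_interval 0.
Proof. unfold unit_interval. lra. Qed.
Lemma unit_1 : unit_interval 1.
Proof. unfold unit_interval. lra. Qed.

Lemma Ceq_minus (a b : C) : (a - b = 0)%C -> a = b.
Proof. intros H. replace a with ((a - b) + b)%C by ring. rewrite H. ring. Qed.

(** Retraction of the line to the unit interval; it turns continuity on the interval into
    continuity everywhere. *)
Definition clamp (t : R) : R := Rmax 0 (Rmin 1 t).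

Lemma clamp_unit t : unit_interval (clamp t).
Proof.
  unfold clamp, unit_interval. split. apply Rmax_l. apply Rmax_lub. lra. apply Rmin_l.
Qed.

Lemma clamp_id t : unit_interval t -> clamp t = t.
Proof. intros [H0 H1]. unfold clamp. rewrite Rmin_right by trivial. now apply Rmax_right. Qed.

Lemma continuous_Rmax a t : continuous (Rmax a) t.
Proof.
  intros P [e He]. exists e. intros s Hs. apply He. change (Rabs (Rmax a s - Rmax a t) < e). change (Rabs (s - t) < e) in Hs.
  eapply Rle_lt_trans; [|exact Hs]. unfold Rmax. destruct (Rle_dec a s), (Rle_dec a t); unfold Rabs; repeat destruct Rcase_abs; lra.
Qed.

Lemma continuous_Rmin a t : continuous (Rmin a) t.
Proof.
  intros P [e He]. exists e. intros s Hs. apply He. change (Rabs (Rmin a s - Rmin a t) < e). change (Rabs (s - t) < e) in Hs.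
  eapply Rle_lt_trans; [|exact Hs]. unfold Rmin. destruct (Rle_dec a s), (Rle_dec a t); unfold Rabs; repeat destruct Rcase_abs; lra.
Qed.

Lemma continuous_clamp t : continuous clamp t.
Proof. unfold clamp. apply (continuous_comp (Rmin 1) (Rmax 0)). apply continuous_Rmin. apply continuous_Rmax. Qed.

Lemma continuous_on_clamp {T : UniformSpace} (g : R -> T) : continuous_on unit_interval g -> forall t, continuous (fun t => g (clamp t)) t.
Proof.
  intros H t P HP. specialize (H (clamp t) (clamp_unit t) P HP). unfold filtermap, within in *.
  specialize (continuous_clamp t _ H). unfold filtermap. apply filter_imp. intros s K. apply K, clamp_unit.
Qed.

Lemma continuous_continuous_on {T U : UniformSpace} (D : T -> Prop) (g : T -> U) : (forall t, D t -> continuous g t) -> continuous_on D g.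
Proof. intros H x Hx P HP. specialize (H x Hx P HP). unfold filtermap, within in *. revert H. apply filter_imp. auto. Qed.

(** Compactness of the unit square: nearby values of a nonvanishing map have a quotient in
    the right half plane, where the principal logarithm is continuous. *)
Lemma uniform_halfplane (h : R * R -> C) :
  (forall st, continuous h st) -> (forall st, h st <> 0) ->
  exists d, 0 < d /\ forall s t s' t', unit_interval s -> unit_interval t -> Rabs (s' - s) < d -> Rabs (t' - t) < d ->
    0 < fst (h (s', t') / h (s, t))%C.
Proof.
  intros Hc H0.
  assert (Hloc : forall s t, exists e : posreal, forall s' t', Rabs (s' - s) < 2 * e -> Rabs (t' - t) < 2 * e -> Cmod (h (s', t') - h (s, t)) < Cmod (h (s, t)) / 4).
  { intros s t. assert (Hp : 0 < Cmod (h (s, t)) / 4). { pose proof (proj1 (Cmod_gt_0 _) (H0 (s, t))). lra. }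
    assert (L : locally (h (s, t)) (fun w => Cmod (w - h (s, t)) < Cmod (h (s, t)) / 4)) by (apply locally_Cmod; eauto).
    destruct (Hc (s, t) _ L) as [e He]. assert (He2 : 0 < e / 2) by (pose proof (cond_pos e); lra).
    exists (mkposreal _ He2). simpl. intros s' t' Hs Ht. apply (He (s', t')). split; simpl.
    change (Rabs (s' - s) < e). lra. change (Rabs (t' - t) < e). lra. }
  set (del := fun s t => proj1_sig (constructive_indefinite_description _ (Hloc s t))).
  assert (Hdel : forall s t s' t', Rabs (s' - s) < 2 * del s t -> Rabs (t' - t) < 2 * del s t -> Cmod (h (s', t') - h (s, t)) < Cmod (h (s, t)) / 4)
    by (intros s t; exact (proj2_sig (constructive_indefinite_description _ (Hloc s t)))).
  destruct (compactness_value_2d 0 1 0 1 del) as [d Hd]. exists d. split. apply cond_pos.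
  intros s t s' t' Hs Ht Hs' Ht'. apply NNPP. intros Hno. apply (Hd s t Hs Ht). intros (u & v & _ & _ & K1 & K2 & K3). apply Hno.
  assert (A := Hdel u v s t ltac:(pose proof (cond_pos (del u v)); lra) ltac:(pose proof (cond_pos (del u v)); lra)).
  assert (B : Cmod (h (s', t') - h (u, v)) < Cmod (h (u, v)) / 4).
  { apply Hdel.
    replace (s' - u) with ((s' - s) + (s - u)) by ring. eapply Rle_lt_trans. apply Rabs_triang. lra.
    replace (t' - v) with ((t' - t) + (t - v)) by ring. eapply Rle_lt_trans. apply Rabs_triang. lra. }
  pose proof (H0 (s, t)) as Nx. pose proof (H0 (u, v)) as Nz.
  set (x := h (s, t)) in *. set (y := h (s', t')) in *. set (z := h (u, v)) in *.
  assert (E : fst (y / x)%C = cdot y x / (fst x ^ 2 + snd x ^ 2)).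
  { apply cneq0_norm in Nx. unfold cdot. destruct x, y; simpl in *. field. lra. }
  rewrite E. apply Rdiv_lt_0_compat. 2: now apply cneq0_norm.
  (* y.x = |z|^2 + z.(x - z) + (y - z).z + (y - z).(x - z) *)
  replace (cdot y x) with (cdot z z + cdot z (x - z)%C + cdot (y - z)%C z + cdot (y - z)%C (x - z)%C) by (unfold cdot; simpl; ring).
  assert (Q : forall a b, - (Cmod a * Cmod b) <= cdot a b).
  { intros a b. assert (K := Rabs_cdot_le a b). apply Rabs_le_between in K. lra. }
  assert (Z : cdot z z = Cmod z ^ 2) by (rewrite Cmod_sqr; unfold cdot; ring).
  pose proof (Q z (x - z)%C). pose proof (Q (y - z)%C z). pose proof (Q (y - z)%C (x - z)%C).
  pose proof (proj1 (Cmod_gt_0 _) Nz). pose proof (Cmod_ge_0 (x - z)). pose proof (Cmod_ge_0 (y - z)). nra.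
Qed.

Definition log_lift (a : C) (c Theta : R -> C) : Prop :=
  continuous_on unit_interval Theta /\ forall t, unit_interval t -> cexp (Theta t) = (c t - a)%C.

Lemma continuous_Cplus {U : UniformSpace} (f g : U -> C) x : continuous f x -> continuous g x -> continuous (fun y => f y + g y)%C x.
Proof. intros Hf Hg. exact (continuous_plus (K:=C_AbsRing) (V:=C_NormedModule) f g x Hf Hg). Qed.

Lemma continuous_Cmult {U : UniformSpace} (f g : U -> C) x : continuous f x -> continuous g x -> continuous (fun y => f y * g y)%C x.
Proof.
  intros Hf Hg.
  assert (F1 : continuous (fun y => fst (f y)) x) by (apply (continuous_comp f fst); [trivial | apply continuous_fst]).
  assert (F2 : continuous (fun y => snd (f y)) x) by (apply (continuous_comp f snd); [trivial | apply continuous_snd]).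
  assert (G1 : continuous (fun y => fst (g y)) x) by (apply (continuous_comp g fst); [trivial | apply continuous_fst]).
  assert (G2 : continuous (fun y => snd (g y)) x) by (apply (continuous_comp g snd); [trivial | apply continuous_snd]).
  apply continuous_C_pair.
  - apply (continuous_minus (V:=R_NormedModule)); now apply (continuous_mult (K:=R_AbsRing)).
  - apply (continuous_plus (V:=R_NormedModule)); now apply (continuous_mult (K:=R_AbsRing)).
Qed.

Lemma continuous_clog_quot {U : UniformSpace} (f : U -> C) (b : C) x : b <> 0 -> 0 < fst (f x / b)%C -> continuous f x -> continuous (fun y => clog (f y / b)) x.
Proof.
  intros Hb Hp Hf. apply (continuous_comp f (fun w => clog (w / b))); trivial.
  assert (K : exists l, cder (fun w => clog (w / b)) (f x) l).
  { eexists. apply (cder_comp clog). now apply cder_clog. apply cder_div; trivial. apply cder_id. apply cder_const. }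
  destruct K as [l K]. eapply cder_continuous, K.
Qed.

Lemma continuous_pair_l {T : UniformSpace} (h : R * R -> T) s t : (forall st, continuous h st) -> continuous (fun t => h (s, t)) t.
Proof.
  intros Hh. apply (continuous_comp (fun t => (s, t)) h); [|apply Hh].
  apply (continuous_comp_2 (fun _ => s) (fun t => t) (fun x y => (x, y))). apply continuous_const. apply continuous_id.
  apply (continuous_ext (fun x => x)). now intros []. apply continuous_id.
Qed.

Lemma subdivision d : 0 < d -> exists N e, 0 < e < d /\ INR (S N) * e = 1 /\
  forall k, (k <= S N)%nat -> unit_interval (INR k * e).
Proof.
  intros Hd. destruct (nfloor_ex (/ d)) as [N [_ HN]]. { left. now apply Rinv_0_lt_compat. }
  assert (He : 0 < / INR (S N)) by (apply Rinv_0_lt_compat, lt_0_INR; lia).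
  exists N, (/ INR (S N)). assert (E : INR (S N) * / INR (S N) = 1) by (apply Rinv_r, not_0_INR; lia).
  split; [|split; trivial].
  - split; trivial. rewrite S_INR, <- (Rinv_inv d). apply Rinv_lt_contravar; trivial.
    apply Rmult_lt_0_compat. now apply Rinv_0_lt_compat. pose proof (pos_INR N). lra.
  - intros k Hk. split. apply Rmult_le_pos; [apply pos_INR | lra]. rewrite <- E.
    apply Rmult_le_compat_r. lra. now apply le_INR.
Qed.

(** The path is cut into pieces on each of which c - a stays in a half plane, where the
    principal logarithm is available. *)
Lemma log_lift_exists (a : C) (c : R -> C) (l0 : C) : continuous_on unit_interval c -> (forall t, unit_interval t -> c t <> a) ->
  cexp l0 = (c 0 - a)%C -> exists Theta, log_lift a c Theta /\ Theta 0 = l0.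
Proof.
  intros Hc Ha Hl0.
  set (g := fun t => (c (clamp t) - a)%C).
  assert (Hg : forall t, continuous g t).
  { intros t. apply (continuous_Cplus (fun t => c (clamp t)) (fun _ => - a)%C). now apply continuous_on_clamp. apply continuous_const. }
  assert (Hg0 : forall t, g t <> 0).
  { intros t E. now apply (Ha (clamp t) (clamp_unit t)), Ceq_minus. }
  destruct (uniform_halfplane (fun st => g (snd st))) as (d & Hd & H); auto.
  { intros [s t]. apply (continuous_comp snd g). apply continuous_snd. apply Hg. }
  destruct (subdivision d Hd) as (N & e & [He Hed] & HNe & Hke).
  assert (K : forall k, (k <= S N)%nat -> exists Theta : R -> C, (forall t, continuous Theta t) /\ (forall t, 0 <= t <= INR k * e -> cexp (Theta t) = g t) /\ Theta 0 = l0).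
  { induction k as [|k IH]; intros Hk.
    - exists (fun _ => l0). split. intros t; apply continuous_const. split; trivial. intros t Ht. simpl in Ht.
      replace t with 0 by lra. rewrite Hl0. unfold g. rewrite clamp_id; trivial. unfold unit_interval; lra.
    - destruct IH as (Th & H1 & H2 & H3). lia. set (b := INR k * e) in *.
      assert (Hb : 0 <= b) by (apply Rmult_le_pos; [apply pos_INR | lra]).
      assert (Hb1 : b + e <= 1). { destruct (Hke (S k) Hk) as [_ K]. rewrite S_INR in K. unfold b. lra. }
      set (m := fun t => Rmin (b + e) (Rmax b t)).
      assert (Hm : forall t, b <= m t <= b + e).
      { intros t. unfold m. split. apply Rmin_glb; [lra|apply Rmax_l]. apply Rmin_l. }
      exists (fun t => Th (Rmin b t) + clog (g (m t) / g b))%C. split; [|split].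
      + intros t. apply continuous_Cplus.
        * apply (continuous_comp (Rmin b) Th). apply continuous_Rmin. apply H1.
        * apply (continuous_clog_quot (fun t => g (m t))). apply Hg0.
          apply (H 0 b 0 (m t)). unfold unit_interval; lra. unfold unit_interval; lra. rewrite Rminus_diag, Rabs_R0; lra.
          pose proof (Hm t). apply Rabs_def1; lra.
          apply (continuous_comp m g); [|apply Hg]. apply (continuous_comp (Rmax b) (Rmin (b + e))). apply continuous_Rmax. apply continuous_Rmin.
      + intros t Ht. rewrite S_INR in Ht. rewrite cexp_plus, cexp_clog.
        2:{ apply (H 0 b 0 (m t)). unfold unit_interval; lra. unfold unit_interval; lra. rewrite Rminus_diag, Rabs_R0; lra.
            pose proof (Hm t). apply Rabs_def1; lra. }
        pose proof (Hg0 b). destruct (Rle_lt_dec t b) as [L|L].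
        * rewrite Rmin_right by trivial. rewrite H2 by lra. unfold m. rewrite (Rmax_left b t), Rmin_right by lra. field. trivial.
        * rewrite Rmin_left by lra. rewrite H2 by lra. unfold m. rewrite (Rmax_right b t), Rmin_right by (unfold b in *; lra). field. trivial.
      + rewrite Rmin_right by trivial. unfold m. rewrite (Rmax_left b 0), Rmin_right by lra. replace (g b / g b)%C with (RtoC 1) by (field; apply Hg0).
        rewrite clog_1, H3. ring. }
  destruct (K (S N) (le_n _)) as (Th & H1 & H2 & H3). exists Th. split; trivial. split.
  - apply continuous_continuous_on. auto.
  - intros t Ht. rewrite H2. unfold g. now rewrite clamp_id. rewrite HNe. exact Ht.
Qed.

Lemma cexp_eq_1 z : cexp z = 1 -> fst z = 0 /\ cos (snd z) = 1.
Proof.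
  intros H. assert (E : exp (fst z) = 1). { rewrite <- Cmod_cexp, H, Cmod_R, Rabs_R1. reflexivity. }
  assert (F : fst z = 0). { rewrite <- (ln_exp (fst z)), E. apply ln_1. }
  split; trivial. apply (f_equal fst) in H. unfold cexp in H. simpl in H. rewrite E in H. lra.
Qed.

Lemma cos_eq_1_zero x : -PI <= x <= PI -> cos x = 1 -> x = 0.
Proof.
  intros Hx H. destruct (Rtotal_order x 0) as [L|[L|L]]; trivial; exfalso.
  - rewrite <- cos_neg, <- cos_0 in H. assert (K : cos (- x) < cos 0) by (apply cos_decreasing_1; lra). lra.
  - rewrite <- cos_0 in H. assert (K : cos x < cos 0) by (apply cos_decreasing_1; lra). lra.
Qed.

(** The difference of two lifts is a continuous multiple of 2 i pi. *)
Lemma log_lift_unique a c Th Th' : log_lift a c Th -> log_lift a c Th' -> Th 0 = Th' 0 -> Th 1 = Th' 1.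
Proof.
  intros [Hc He] [Hc' He'] E0.
  assert (HD : forall t, cexp (Th (clamp t) - Th' (clamp t)) = 1).
  { intros t. pose proof (clamp_unit t) as Ht.
    assert (K : (cexp (Th (clamp t) - Th' (clamp t)) * cexp (Th' (clamp t)))%C = cexp (Th (clamp t))) by (rewrite <- cexp_plus; f_equal; ring).
    rewrite He, He' in K by trivial. pose proof (cexp_neq0 (Th' (clamp t))) as N. rewrite He' in N by trivial.
    transitivity ((cexp (Th (clamp t) - Th' (clamp t)) * (c (clamp t) - a)) / (c (clamp t) - a))%C. field; trivial. rewrite K. field; trivial. }
  set (phi := fun t => snd (Th (clamp t)) - snd (Th' (clamp t))).
  assert (Hphi : continuity phi).
  { intros t. apply continuity_pt_filterlim. apply (continuous_minus (V:=R_NormedModule)).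
    apply (continuous_comp (fun t => Th (clamp t)) snd). now apply continuous_on_clamp. apply continuous_snd.
    apply (continuous_comp (fun t => Th' (clamp t)) snd). now apply continuous_on_clamp. apply continuous_snd. }
  assert (U0 := unit_0). assert (U1 := unit_1).
  assert (P0 : phi 0 = 0). { unfold phi. rewrite clamp_id, E0 by trivial. ring. }
  assert (Hcos : forall t, cos (phi t) = 1) by (intros t; exact (proj2 (cexp_eq_1 _ (HD t)))).
  pose proof PI_RGT_0 as Hpi.
  assert (P1 : phi 1 = 0).
  { apply cos_eq_1_zero. 2: apply Hcos. split; apply Rnot_lt_le; intros L.
    - destruct (IVT_gen phi 0 1 (- PI) Hphi) as (t & _ & Et). rewrite P0. rewrite Rmin_right, Rmax_left; lra.
      specialize (Hcos t). rewrite Et, cos_neg, cos_PI in Hcos. lra.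
    - destruct (IVT_gen phi 0 1 PI Hphi) as (t & _ & Et). rewrite P0. rewrite Rmin_left, Rmax_right; lra.
      specialize (Hcos t). rewrite Et, cos_PI in Hcos. lra. }
  pose proof (proj1 (cexp_eq_1 _ (HD 1))) as F1. unfold phi in P1. rewrite clamp_id in F1, P1 by trivial. simpl in F1.
  apply C_ext; lra.
Qed.

(** The value at the endpoint of the logarithm of c - a continued from the value [l0]. *)
Definition end_log (a l0 : C) (c : R -> C) : C :=
  epsilon (inhabits (RtoC 0)) (fun l => exists Theta, log_lift a c Theta /\ Theta 0 = l0 /\ Theta 1 = l).

Lemma end_log_eq a l0 c Theta : log_lift a c Theta -> Theta 0 = l0 -> end_log a l0 c = Theta 1.
Proof.
  intros H H0. unfold end_log.
  destruct (epsilon_spec (inhabits (RtoC 0)) (fun l => exists Theta, log_lift a c Theta /\ Theta 0 = l0 /\ Theta 1 = l)) as (Th & K & K0 & K1).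
  - exists (Theta 1). eauto.
  - rewrite <- K1. apply (log_lift_unique a c); trivial. now rewrite H0.
Qed.

(** Neighbouring paths of a homotopy have logarithms that differ by the principal logarithm
    of the quotient of the paths, which vanishes at the fixed endpoints. *)
Lemma end_log_homotopic (M : C -> Prop) (a l0 : C) (c c' : R -> C) : (forall z, M z -> z <> a) -> cexp l0 = (c 0 - a)%C -> homotopic M c c' -> end_log a l0 c = end_log a l0 c'.
Proof.
  intros HM Hl0 (H & Hc & HH).
  assert (U0 := unit_0). assert (U1 := unit_1).
  set (h := fun st : R * R => (H (clamp (fst st), clamp (snd st)) - a)%C).
  assert (Hh : forall st, continuous h st).
  { intros [s t]. apply (continuous_Cplus (fun st : R * R => H (clamp (fst st), clamp (snd st))) (fun _ => - a)%C). 2: apply continuous_const.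
    intros P HP. specialize (Hc (clamp s, clamp t) (conj (clamp_unit s) (clamp_unit t)) P HP). destruct Hc as [e He].
    destruct (continuous_clamp s _ (locally_ball (clamp s) e)) as [e1 He1]. destruct (continuous_clamp t _ (locally_ball (clamp t) e)) as [e2 He2].
    assert (Hm : 0 < Rmin e1 e2) by (apply Rmin_glb_lt; apply cond_pos).
    exists (mkposreal _ Hm). intros [s' t'] [B1 B2]. simpl in B1, B2. apply He.
    - split; [apply He1 | apply He2]; eapply ball_le; [|exact B1| |exact B2]; simpl. apply Rmin_l. apply Rmin_r.
    - split; apply clamp_unit. }
  assert (Hh0 : forall st, h st <> 0).
  { intros st E. pose proof (HH _ _ (clamp_unit (fst st)) (clamp_unit (snd st))) as (K & _). apply (HM _ K).
    now apply Ceq_minus. }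
  destruct (uniform_halfplane h Hh Hh0) as (d & Hd & Hu).
  set (cs := fun s t => H (s, clamp t)).
  assert (Hlift : forall s, unit_interval s -> exists Th, log_lift a (cs s) Th /\ Th 0 = l0).
  { intros s Hs. apply log_lift_exists.
    - apply continuous_continuous_on. intros t _.
      apply (continuous_ext (fun t => h (s, t) + a)%C). { intros x. unfold h, cs. simpl. rewrite (clamp_id s) by trivial. ring. }
      apply continuous_Cplus. 2: apply continuous_const. now apply continuous_pair_l.
    - intros t Ht. apply HM. unfold cs. apply HH; trivial. apply clamp_unit.
    - rewrite Hl0. unfold cs. rewrite clamp_id by trivial. f_equal. symmetry. apply (HH s 0); trivial. }
  assert (Hstep : forall s s', unit_interval s -> unit_interval s' -> Rabs (s' - s) < d -> end_log a l0 (cs s') = end_log a l0 (cs s)).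
  { intros s s' Hs Hs' Hss. destruct (Hlift s Hs) as (Th & [K1 K2] & K3).
    assert (Hpos : forall t, 0 < fst (h (s', t) / h (s, t))%C).
    { intros t. assert (E : forall x, h (x, t) = h (x, clamp t)). { intros x. unfold h. simpl. now rewrite (clamp_id (clamp t)) by apply clamp_unit. }
      rewrite (E s), (E s'). apply Hu; trivial. apply clamp_unit. rewrite Rminus_diag, Rabs_R0; lra. }
    assert (Hsec := fun x t => continuous_pair_l h x t Hh).
    assert (Hval : forall x t, unit_interval x -> unit_interval t -> h (x, t) = (cs x t - a)%C).
    { intros x t Hx Ht. unfold h, cs. simpl. now rewrite (clamp_id x) by trivial. }
    rewrite (end_log_eq a l0 (cs s') (fun t => Th (clamp t) + clog (h (s', t) / h (s, t)))%C).
    - rewrite (end_log_eq a l0 (cs s) Th); trivial. 2: now split. rewrite clamp_id by trivial.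
      rewrite !Hval by trivial. unfold cs. rewrite clamp_id by trivial.
      replace (H (s', 1)) with (H (s, 1)). 2: { transitivity (c 1). apply (HH s 1); trivial. symmetry; apply (HH s' 1); trivial. }
      replace ((H (s, 1) - a) / (H (s, 1) - a))%C with (RtoC 1). rewrite clog_1. ring. field.
      intros E. apply (HM (H (s, 1))). apply HH; trivial. now apply Ceq_minus.
    - split.
      + apply continuous_continuous_on. intros t _. apply continuous_Cplus. now apply continuous_on_clamp.
        apply (continuous_comp (fun t => (h (s', t) / h (s, t))%C) clog).
        * apply (continuous_Cmult (fun t => h (s', t)) (fun t => / h (s, t))%C). apply Hsec.
          apply (continuous_comp (fun t => h (s, t)) Cinv). apply Hsec. eapply cder_continuous, cder_Cinv, Hh0.
        * eapply cder_continuous, cder_clog, Hpos.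
      + intros t Ht. rewrite cexp_plus, cexp_clog, clamp_id, K2, <- !Hval by trivial. field. apply Hh0.
    - rewrite clamp_id, K3 by trivial. rewrite !Hval by trivial. unfold cs. rewrite clamp_id by trivial.
      replace (H (s', 0)) with (H (s, 0)). 2: { transitivity (c 0). apply (HH s 0); trivial. symmetry; apply (HH s' 0); trivial. }
      replace ((H (s, 0) - a) / (H (s, 0) - a))%C with (RtoC 1). rewrite clog_1. ring. field.
      intros E. apply (HM (H (s, 0))). apply HH; trivial. now apply Ceq_minus. }
  destruct (subdivision d Hd) as (N & e & [He Hed] & HNe & Hk).
  assert (Hchain : forall k, (k <= S N)%nat -> end_log a l0 (cs (INR k * e)) = end_log a l0 (cs 0)).
  { induction k as [|k IH]; intros Hk'. simpl. now rewrite Rmult_0_l. rewrite <- IH by lia. apply Hstep; try (apply Hk; lia).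
    rewrite S_INR. replace ((INR k + 1) * e - INR k * e) with e by ring. rewrite Rabs_pos_eq; lra. }
  specialize (Hchain (S N) (le_n _)). rewrite HNe in Hchain.
  assert (Hext : forall s c0, unit_interval s -> (forall t, unit_interval t -> cs s t = c0 t) -> end_log a l0 c0 = end_log a l0 (cs s)).
  { intros s c0 Hs Hcs. destruct (Hlift s Hs) as (Th & [K1 K2] & K3). rewrite (end_log_eq a l0 (cs s) Th) by (trivial; now split).
    apply end_log_eq; trivial. split; trivial. intros t Ht. rewrite K2, Hcs; trivial. }
  rewrite (Hext 0 c), (Hext 1 c'); trivial. now symmetry.
  - intros t Ht. unfold cs. rewrite clamp_id by trivial. apply (HH 0 t); trivial.
  - intros t Ht. unfold cs. rewrite clamp_id by trivial. apply (HH 0 t); trivial.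
Qed.

(** The concatenated segment stays in the disc about c 1 that avoids [a], where the quotient
    (w - a) / (c 1 - a) has positive real part. *)
Lemma end_log_extend (a l0 : C) (c : R -> C) (w : C) : continuous_on unit_interval c -> (forall t, unit_interval t -> c t <> a) -> cexp l0 = (c 0 - a)%C ->
  Cmod (w - c 1) < Cmod (c 1 - a) ->
  end_log a l0 (extend_path c w) = (end_log a l0 c + clog ((w - a) / (c 1 - a)))%C.
Proof.
  intros Hc Ha Hl0 Hw. destruct (log_lift_exists a c l0 Hc Ha Hl0) as (Th & [K1 K2] & K3).
  assert (U1 := unit_1). assert (U0 := unit_0).
  rewrite (end_log_eq a l0 c Th) by (trivial; now split).
  assert (N : (c 1 - a)%C <> 0). { intros E. now apply (Ha 1 U1), Ceq_minus. }
  set (seg := fun t : R => (c 1 + RtoC (Rmax 0 (2 * t - 1)) * (w - c 1) - a)%C).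
  assert (Hpos : forall t, t <= 1 -> 0 < fst (seg t / (c 1 - a))%C).
  { intros t Ht. unfold seg. set (r := Rmax 0 (2 * t - 1)). assert (Hr : 0 <= r <= 1) by (split; [apply Rmax_l | apply Rmax_lub; lra]).
    replace ((c 1 + RtoC r * (w - c 1) - a) / (c 1 - a))%C with (1 + RtoC r * ((w - c 1) / (c 1 - a)))%C by (field; trivial).
    set (q := ((w - c 1) / (c 1 - a))%C). assert (Hq : Cmod q < 1).
    { unfold q. rewrite Cmod_div by trivial. pose proof (Cmod_ge_0 (w - c 1)). apply Rmult_lt_reg_r with (Cmod (c 1 - a)). lra.
      unfold Rdiv. rewrite Rmult_assoc, Rinv_l, Rmult_1_r, Rmult_1_l; lra. }
    assert (Hf : - 1 < fst q). { assert (K := re_le_Cmod q : Rabs (fst q) <= Cmod q).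
      apply Rabs_le_between in K. lra. }
    change (0 < 1 + (r * fst q - 0 * snd q)). destruct (Req_dec r 1) as [->|]; nra. }
  rewrite (end_log_eq a l0 _ (fun t => Th (clamp (2 * t)) + clog (seg (Rmin 1 t) / (c 1 - a)))%C).
  - f_equal. f_equal. unfold clamp. rewrite (Rmin_left 1 (2 * 1)), Rmax_right by lra. reflexivity.
    rewrite Rmin_left by lra. unfold seg. rewrite Rmax_right by lra. f_equal. f_equal. replace (2 * 1 - 1) with 1 by ring. ring.
  - split.
    + apply continuous_continuous_on. intros t _. apply continuous_Cplus.
      * apply (continuous_comp (fun t => 2 * t) (fun t => Th (clamp t))). 2: now apply continuous_on_clamp.
        apply (continuous_scal_r (K:=R_AbsRing) (V:=R_NormedModule) 2 (fun t => t)). apply continuous_id.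
      * apply (continuous_clog_quot (fun t => seg (Rmin 1 t))); trivial. apply Hpos, Rmin_l.
        apply (continuous_comp (Rmin 1) seg). apply continuous_Rmin. generalize (Rmin 1 t). intros x. unfold seg.
        apply (continuous_Cplus (fun t => c 1 + RtoC (Rmax 0 (2 * t - 1)) * (w - c 1))%C (fun _ => - a)%C). 2: apply continuous_const.
        apply continuous_Cplus. apply continuous_const.
        apply (continuous_Cmult (fun t => RtoC (Rmax 0 (2 * t - 1))) (fun _ => (w - c 1)%C)). 2: apply continuous_const.
        apply (continuous_comp (fun t => Rmax 0 (2 * t - 1)) RtoC).
        apply (continuous_comp (fun t => 2 * t - 1) (Rmax 0)). 2: apply continuous_Rmax.
        apply (ex_derive_continuous (K:=R_AbsRing) (V:=R_NormedModule)). auto_derive; trivial.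
        apply continuous_C_pair. apply continuous_id. apply continuous_const.
    + intros t [Ht0 Ht1]. rewrite cexp_plus, cexp_clog by (apply Hpos, Rmin_l). rewrite Rmin_right by lra.
      unfold extend_path. destruct (Rle_dec t (1 / 2)) as [L|L].
      * rewrite clamp_id, K2 by (unfold unit_interval; lra). unfold seg. rewrite Rmax_left by lra. field. trivial.
      * unfold clamp. rewrite (Rmin_left 1 (2 * t)), (Rmax_right 0 1) by lra. rewrite K2 by trivial. unfold seg. rewrite Rmax_right by lra. field. trivial.
  - rewrite Rmin_right by lra. unfold seg. rewrite Rmax_left by lra. rewrite clamp_id by (unfold unit_interval; lra). rewrite Rmult_0_r, K3.
    replace ((c 1 + 0 * (w - c 1) - a) / (c 1 - a))%C with (RtoC 1) by (field; trivial). rewrite clog_1. ring.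
Qed.

(** * The lift of the frame to the universal cover *)

(** The value of xi at the endpoint of a path, continued along the path. *)
Definition xi_end (l1 l3 : C) (c : R -> C) : C :=
  (cexp (RtoC (7/5) * end_log 1 l1 c + RtoC (18/5) * end_log (RtoC (-3/2)) l3 c)
   / ((c 1%R + 2) * (c 1%R + 2)))%C.

Definition frame_matrix (x z : C) : Mat := [[e11 x z, e12 x z], [e21 x z, e22 x z]].

Section Path.
Variables (p0 l1 l3 : C).
Hypothesis Hp0 : M0 p0.
Hypothesis Hl1 : cexp l1 = (p0 - 1)%C.
Hypothesis Hl3 : cexp l3 = (p0 - RtoC (-3/2))%C.

Lemma path_avoids c t : path_from M0 p0 c -> unit_interval t -> c t <> 1 /\ c t <> RtoC (-3/2).
Proof. intros (_ & _ & H) Ht. destruct (H t Ht) as (H0 & H1 & H2 & H3). now split. Qed.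

Lemma sqn_end_log a l0 c : path_from M0 p0 c -> (forall z, M0 z -> z <> a) -> cexp l0 = (p0 - a)%C ->
  cexp (end_log a l0 c) = (c 1%R - a)%C.
Proof.
  intros (H0 & Hc & HM) Ha Hl0. assert (U1 := unit_1).
  destruct (log_lift_exists a c l0 Hc) as (Th & K & K0).
  - intros t Ht. apply Ha, HM, Ht.
  - now rewrite H0.
  - rewrite (end_log_eq a l0 c Th K K0). now apply K.
Qed.

Lemma ln_sqn_cexp w z : cexp w = z -> fst w = / 2 * ln (sqn z).
Proof. intros <-. rewrite sqn_cexp, ln_exp. field. Qed.

Lemma sqn_xi_end c : path_from M0 p0 c -> sqn (xi_end l1 l3 c) = rad (c 1%R) * rad (c 1%R).
Proof.
  intros Hc. assert (Hz : M0 (c 1%R)) by (apply Hc, unit_1).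
  destruct (M0_factors _ Hz) as (Z0 & Z1 & Z2 & Z3 & Z4).
  assert (E1 := ln_sqn_cexp _ _ (sqn_end_log 1 l1 c Hc (fun z H => proj1 (proj2 H)) Hl1)).
  assert (E3 := ln_sqn_cexp _ _ (sqn_end_log (RtoC (-3/2)) l3 c Hc (fun z H => proj2 (proj2 (proj2 H))) Hl3)).
  rewrite minus_m3 in E3. unfold xi_end. rewrite sqn_div, sqn_mult, sqn_cexp by (now apply Cmult_neq_0).
  replace (fst (RtoC (7/5) * end_log 1 l1 c + RtoC (18/5) * end_log (RtoC (-3/2)) l3 c)%C)
   with (7/5 * fst (end_log 1 l1 c) + 18/5 * fst (end_log (RtoC (-3/2)) l3 c)) by (simpl; ring).
  rewrite E1, E3. unfold rad. apply sqn_pos in Z2.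
  replace (2 * (7 / 5 * (/ 2 * ln (sqn (c 1%R - 1))) + 18 / 5 * (/ 2 * ln (sqn (c 1%R + RtoC (3/2)))))) with
    ((7/10 * ln (sqn (c 1%R - 1)) + 9/5 * ln (sqn (c 1%R + RtoC (3/2)))) + (7/10 * ln (sqn (c 1%R - 1)) + 9/5 * ln (sqn (c 1%R + RtoC (3/2))))) by field.
  rewrite exp_plus. field. lra.
Qed.

Lemma xi_end_extend c w : path_from M0 p0 c -> Cmod (w - c 1%R) < Cmod (c 1%R - 1) -> Cmod (w - c 1%R) < Cmod (c 1%R - RtoC (-3/2)) ->
  M0 w -> xi_end l1 l3 (extend_path c w) = xi_of (xi_end l1 l3 c) (c 1%R) w.
Proof.
  intros Hc W1 W3 Hw. assert (Hz : M0 (c 1%R)) by (apply Hc, unit_1).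
  destruct (M0_factors _ Hz) as (Z0 & Z1 & Z2 & Z3 & Z4). destruct (M0_factors _ Hw) as (V0 & V1 & V2 & V3 & V4).
  assert (A := fun t => path_avoids c t Hc). destruct Hc as (H0 & Hc & _).
  unfold xi_end, xi_of, branch. rewrite !end_log_extend; trivial; try (intros; now apply A); try (now rewrite H0).
  replace (extend_path c w 1%R) with w.
  2: { unfold extend_path. destruct (Rle_dec 1 (1/2)). lra. replace (2 * 1 - 1)%R with 1%R by ring. ring. }
  rewrite !minus_m3.
  set (L1 := end_log 1 l1 c). set (L3 := end_log (RtoC (-3/2)) l3 c).
  set (m1 := clog ((w - 1) / (c 1%R - 1))). set (m3 := clog ((w + RtoC (3/2)) / (c 1%R + RtoC (3/2)))).
  replace (RtoC (7/5) * (L1 + m1) + RtoC (18/5) * (L3 + m3))%C with ((RtoC (7/5) * L1 + RtoC (18/5) * L3) + (RtoC (7/5) * m1 + RtoC (18/5) * m3))%C by ring.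
  rewrite cexp_plus. field. auto.
Qed.

Definition lift_E (c : R -> C) : Mat := frame_matrix (xi_end l1 l3 c) (c 1%R).

Lemma xi_end_neq0 c : path_from M0 p0 c -> xi_end l1 l3 c <> RtoC 0.
Proof.
  intros Hc. apply sqn_neq0. rewrite (sqn_xi_end c Hc). assert (Hz : M0 (c 1%R)) by (apply Hc, unit_1).
  pose proof (rad_pos_M0 _ Hz). nra.
Qed.

Lemma lift_E_homotopic c c' : path_from M0 p0 c -> path_from M0 p0 c' -> homotopic M0 c c' -> lift_E c = lift_E c'.
Proof.
  intros (H0 & _) _ Hh. unfold lift_E, xi_end.
  rewrite (end_log_homotopic M0 1 l1 c c'); trivial. 2: intros z H; apply H. 2: now rewrite H0.
  rewrite (end_log_homotopic M0 (RtoC (-3/2)) l3 c c'); trivial. 2: intros z H; apply H. 2: now rewrite H0.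
  replace (c' 1%R) with (c 1%R); trivial.
  destruct Hh as (H & _ & HH). assert (U1 := unit_1).
  destruct (HH 1%R 1%R U1 U1) as (_ & _ & E1 & _ & E2). now rewrite <- E1, <- E2.
Qed.

(** Along the local sections of the covering the frame is the holomorphic germ built from
    the branch of xi. *)
Lemma lift_E_local c : path_from M0 p0 c -> locally (c 1%R) (fun w => lift_E (extend_path c w) = frame_matrix (xi_of (xi_end l1 l3 c) (c 1%R) w) w).
Proof.
  intros Hc. assert (U1 := unit_1). assert (Hz : M0 (c 1%R)) by (now apply Hc).
  destruct (path_avoids c 1%R Hc U1) as [A1 A3].
  assert (N : forall a : C, c 1%R <> a -> locally (c 1%R) (fun w => Cmod (w - c 1%R) < Cmod (c 1%R - a))).
  { intros a Ha. apply locally_Cmod. exists (Cmod (c 1%R - a)). split; [now apply Cmod_gt_0, Cminus_eq_contra | auto]. }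
  generalize (filter_and _ _ (open_M0 _ Hz) (filter_and _ _ (N _ A1) (N _ A3))). apply filter_imp. intros w (Hw & W1 & W3).
  unfold lift_E. rewrite xi_end_extend by trivial. f_equal.
  unfold extend_path. destruct (Rle_dec 1 (1/2)). lra. replace (2 * 1 - 1)%R with 1%R by ring. ring.
Qed.

(** By [hvec_phase] the value of the continued frame gives the same front as |xi|; the shape
    of the Maurer-Cartan form is that of the local frame. *)
Lemma lift_E_holomorphic : holomorphic_lift M0 p0 (fr 1 1) (fr 1 (-1)) lift_E.
Proof.
  split. apply lift_E_homotopic.
  intros c Hc. assert (U1 := unit_1). assert (Hz : M0 (c 1%R)) by (now apply Hc).
  assert (Hx0 := xi_end_neq0 c Hc). assert (Hs := sqn_xi_end c Hc). assert (Hloc := lift_E_local c Hc).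
  unfold lift_E at 1 2 3 4 5. set (x := xi_end l1 l3 c) in *. set (z := c 1%R) in *.
  assert (Hdet := e_det x z Hz Hx0).
  assert (Hfr : forall d2 : R, fr 1 d2 z = hvec 1 d2 (e11 x z) (e12 x z) (e21 x z) (e22 x z)).
  { intros d2. apply FunctionalExtensionality.functional_extensionality. intros mu. symmetry. now apply hvec_phase. }
  split; [exact Hdet|]. split; [|split].
  - rewrite Hfr, herm_hvec. unfold frame_matrix. rewrite (mmul_entries (e11 x z)). do 2 f_equal; repeat (apply f_equal2; trivial); ring.
  - rewrite Hfr, herm_hvec. reflexivity.
  - destruct (locally_singleton _ _ (locally_xi_spec x z Hz Hs)) as (_ & Hxz & _ & Hder).
    assert (D11 := cder_e11 _ z Hz Hxz Hder). assert (D12 := cder_e12 _ z Hz Hxz Hder).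
    assert (D21 := cder_e21 _ z Hz Hxz Hder). assert (D22 := cder_e22 _ z Hz Hxz Hder).
    assert (Ex : xi_of x z z = x) by now apply xi_of_self. rewrite Ex in D11, D12, D21, D22.
    exists [[ (e12 x z * om x z)%C, (e11 x z * th x z)%C ], [ (e22 x z * om x z)%C, (e21 x z * th x z)%C ]].
    split; [|split; [|split]].
    + assert (T : forall (k : C -> C) i j l, (forall w, entry (frame_matrix (xi_of x z w) w) i j = k w) -> cder k z l ->
        is_derive (fun w : C => entry (lift_E (extend_path c w)) i j) z l).
      { intros k i j l Hk Hl. apply is_derive_cder. apply (cder_ext k); trivial. revert Hloc. apply filter_imp.
        intros w ->. symmetry. apply Hk. }
      intros [|[|i]] [|[|j]] Hi Hj; try lia.
      * eapply T; [|exact D11]. reflexivity.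
      * eapply T; [|exact D12]. reflexivity.
      * eapply T; [|exact D21]. reflexivity.
      * eapply T; [|exact D22]. reflexivity.
    + assert (Ho := om_neq0 x z Hz Hx0).
      destruct (Ceq_dec (e12 x z) 0) as [E12|E12].
      * exists 1%nat, 0%nat. change ((e22 x z * om x z)%C <> 0). apply Cmult_neq_0; trivial. intros E22.
        rewrite E12, E22 in Hdet. apply (f_equal fst) in Hdet. simpl in Hdet. lra.
      * exists 0%nat, 0%nat. change ((e12 x z * om x z)%C <> 0). now apply Cmult_neq_0.
    + unfold minv. rewrite mmul_entries.
      change ((e22 x z / mdet (frame_matrix x z) * (e12 x z * om x z) + - e12 x z / mdet (frame_matrix x z) * (e22 x z * om x z))%C = 0).
      unfold Cdiv. ring.
    + unfold minv. rewrite mmul_entries.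
      change ((- e21 x z / mdet (frame_matrix x z) * (e11 x z * th x z) + e11 x z / mdet (frame_matrix x z) * (e21 x z * th x z))%C = 0).
      unfold Cdiv. ring.
Qed.

Lemma lift_E_gauss c : path_from M0 p0 c ->
  G0 (c 1%R) = hat_div (entry (lift_E c) 0 0) (entry (lift_E c) 1 0) /\
  Gs0 (c 1%R) = hat_div (entry (lift_E c) 0 1) (entry (lift_E c) 1 1).
Proof.
  intros Hc. assert (Hz : M0 (c 1%R)) by (apply Hc, unit_1). assert (Hx0 := xi_end_neq0 c Hc).
  unfold lift_E. set (x := xi_end l1 l3 c) in *. set (z := c 1%R) in *.
  destruct (M0_factors _ Hz) as (Z0 & Z1 & Z2 & Z3 & Z4). assert (HQ := Qp_neq0 z Hz).
  change (G0 z = hat_div (e11 x z) (e21 x z) /\ Gs0 z = hat_div (e12 x z) (e22 x z)). split.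
  - unfold G0, hat_div. destruct (Ceq_dec (e21 x z) 0) as [E|E].
    + exfalso. unfold e21 in E. apply (f_equal (fun y => x * y)%C) in E. rewrite Cinv_r, Cmult_0_r in E by trivial.
      apply RtoC_inj in E. lra.
    + f_equal. unfold e11, e21. simpl. field. trivial.
  - unfold Gs0, hat_div. destruct (Ceq_dec (2 * z + 5) 0) as [E|E], (Ceq_dec (e22 x z) 0) as [E'|E']; trivial.
    + exfalso. apply E'. unfold e22. rewrite E. unfold Cdiv. ring.
    + exfalso. apply E. transitivity (e22 x z * (z * Qp z) / x)%C. unfold e22. field. auto. rewrite E'. unfold Cdiv. ring.
    + f_equal. unfold e12, e22. field. repeat split; trivial.
Qed.
End Path.

Lemma fr_gauss_maps : hyperbolic_gauss_maps M0 (fr 1 1) (fr 1 (-1)) G0 Gs0.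
Proof.
  intros p0 Hp0. destruct (M0_factors _ Hp0) as (Z0 & Z1 & Z2 & Z3 & Z4).
  destruct (cexp_surj _ Z1) as [l1 Hl1]. rewrite <- (minus_m3 p0) in Z4. destruct (cexp_surj _ Z4) as [l3 Hl3].
  exists (lift_E l1 l3). split.
  - now apply lift_E_holomorphic.
  - intros c Hc. now apply (lift_E_gauss p0).
Qed.

(** * Ramification of the Gauss maps *)

Lemma holo_at_cder u z : holo_at u z -> exists l, cder u z l.
Proof. intros H. destruct (locally_singleton _ _ H) as [l Hl]. exists l. now apply is_derive_cder. Qed.

Lemma cder_holo_at u z : locally z (fun w => exists l, cder u w l) -> holo_at u z.
Proof. unfold holo_at. apply filter_imp. intros w [l Hl]. exists l. now apply is_derive_cder. Qed.

(** The factor 0 ^ k is 1 for k = 0 and 0 otherwise, so that the derivative tells zeros of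
    order one from the others. *)
Lemma cder_zero_order z u k l : cder u z l -> cder (fun w => (w - z) ^ (S k) * u w)%C z (0 ^ k * u z)%C.
Proof.
  intros H. apply (cder_ext (fun w => (w - z) * ((w - z) ^ k * u w))%C).
  apply filter_forall. intros w. simpl. ring.
  eapply cder_eq. apply cder_mult. cder_tac. apply cder_mult. apply cder_pow. cder_tac. exact H.
  cbv beta. replace (z - z)%C with (RtoC 0) by ring. ring.
Qed.

Lemma multiplicity_derivative h g z m l b : locally z (fun w => h w = Some (g w)) -> cder g z l -> h z = Some b ->
  multiplicity h z m -> ((2 <= m)%nat <-> l = 0).
Proof.
  intros Hh Hg Hb (Hm & u & Hu & Hu0 & H). rewrite Hb in H.
  destruct m as [|k]. lia. destruct (holo_at_cder u z Hu) as [l' Hl'].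
  assert (E : l = (0 + 0 ^ k * u z)%C).
  { apply (cder_unique g z); trivial. apply (cder_ext (fun w => b + (w - z) ^ (S k) * u w)%C).
    generalize (filter_and _ _ Hh H). apply filter_imp. intros w [E1 E2]. rewrite E1 in E2. now injection E2.
    apply cder_plus. apply cder_const. now apply cder_zero_order with l'. }
  rewrite E. destruct k as [|k]; simpl.
  - split. lia. intros K. exfalso. apply Hu0. rewrite <- K. ring.
  - split; [intros _; ring | lia].
Qed.

(** One of the three cube roots avoids the ends: the primitive ones of a real cube are
    not real. *)
Lemma cube_roots (b : C) : b <> 0 -> exists z, M0 z /\ (z ^ 3)%C = b.
Proof.
  intros Hb. destruct (cexp_surj b Hb) as [l Hl].
  set (z := cexp (l * RtoC (/ 3))).
  assert (Hz : (z ^ 3)%C = b).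
  { rewrite <- Hl. unfold z. simpl. rewrite Cmult_1_r, <- !cexp_plus. f_equal. apply C_ext; simpl; field. }
  assert (Hz0 : z <> 0) by apply cexp_neq0.
  set (w := (- / 2, sqrt 3 / 2) : C).
  assert (S3 : sqrt 3 * sqrt 3 = 3) by (apply sqrt_sqrt; lra).
  assert (Hw : (w ^ 3)%C = 1).
  { unfold w. apply C_ext; simpl; field_simplify; rewrite ?(pow2_sqrt 3) by lra. field.
    replace (sqrt 3 ^ 3) with (sqrt 3 ^ 2 * sqrt 3) by ring. rewrite pow2_sqrt by lra. field. }
  assert (P3 : 0 < sqrt 3) by (apply sqrt_lt_R0; lra).
  destruct (Ceq_dec z 1) as [E|E1]; [|destruct (Ceq_dec z (RtoC (-2))) as [E|E2]; [|destruct (Ceq_dec z (RtoC (-3/2))) as [E|E3]]].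
  4: now exists z.
  all: exists (z * w)%C; split; [|rewrite Cpow_mult_l, Hw, Hz; ring];
    assert (I : snd (z * w)%C <> 0) by (rewrite E; unfold w; simpl; lra);
    repeat split; intros K; apply I; now rewrite K.
Qed.

Lemma G0_ramified : ramified_number M0 G0 2.
Proof.
  exists (Some (RtoC 0) :: None :: nil), nil.
  split; [|split; [|split; [|split]]].
  - constructor. intros [H|[]]; discriminate. constructor. intros []. constructor.
  - constructor.
  - intros a. split.
    + intros [<-|[<-|[]]] z Hz E; unfold G0 in E; [|discriminate].
      assert (E' : (z ^ 3)%C = 0) by congruence. revert E'. simpl. assert (H0 := proj1 Hz).
      repeat apply Cmult_neq_0; trivial. apply RtoC_neq0; lra.
    + intros H. destruct a as [b|]; simpl; [|tauto]. destruct (Ceq_dec b 0) as [->|Hb]; [tauto|].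
      destruct (cube_roots b Hb) as (z & Hz & E). exfalso. apply (H z Hz). unfold G0. now rewrite E.
  - intros b nu. split. intros [].
    intros (Ht & He & _). apply He. intros z Hz E. destruct (Ht z Hz E) as (m & Hm & Hmult).
    assert (K : (3 * z * z)%C = 0).
    { unfold G0 in E. apply (multiplicity_derivative G0 (fun w => w ^ 3)%C z m _ (z ^ 3)%C); trivial.
      apply filter_forall. reflexivity. eapply cder_eq. apply (cder_pow (fun w => w)). apply cder_id.
      simpl. replace (1 + 1 + 1)%R with 3%R by ring. ring. }
    revert K. assert (H0 := proj1 Hz). repeat apply Cmult_neq_0; trivial. apply RtoC_neq0; lra.
  - simpl. ring.
Qed.

(** The critical points of G_*, the roots of z^2 + 5 z + 15. *)
Definition zp : C := (-5/2, sqrt 35 / 2).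
Definition zm : C := (-5/2, - (sqrt 35 / 2)).

Lemma sqrt35 : sqrt 35 * sqrt 35 = 35 /\ 0 < sqrt 35.
Proof. split. apply sqrt_sqrt; lra. apply sqrt_lt_R0; lra. Qed.

Lemma crit_zp : (zp * zp + 5 * zp + 15)%C = RtoC 0.
Proof. destruct sqrt35. apply C_ext; unfold zp; simpl; lra. Qed.
Lemma crit_zm : (zm * zm + 5 * zm + 15)%C = RtoC 0.
Proof. destruct sqrt35. apply C_ext; unfold zm; simpl; lra. Qed.

Lemma crit_factor z : (z * z + 5 * z + 15 = (z - zp) * (z - zm))%C.
Proof. destruct sqrt35. apply C_ext; unfold zp, zm; destruct z; simpl; lra. Qed.

Lemma nonreal_M0 z : snd z <> 0 -> M0 z /\ (2 * z + 5)%C <> RtoC 0.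
Proof.
  intros H. split. repeat split; intros ->; now apply H.
  intros E. apply (f_equal snd) in E. simpl in E. lra.
Qed.

Lemma zp_im : snd zp <> 0.
Proof. destruct sqrt35. unfold zp; simpl. lra. Qed.
Lemma zm_im : snd zm <> 0.
Proof. destruct sqrt35. unfold zm; simpl. lra. Qed.

Lemma Gs0_fin z : (2 * z + 5)%C <> 0 -> Gs0 z = Some (Gsf z).
Proof. intros H. unfold Gs0, hat_div. destruct (Ceq_dec (2 * z + 5) 0). contradiction. reflexivity. Qed.

Lemma locally_pole z : (2 * z + 5)%C <> 0 -> locally z (fun w => (2 * w + 5)%C <> 0).
Proof. apply (locally_neq0 (fun w => 2 * w + 5)%C). cinf_tac. Qed.

Lemma locally_Gs0 z : (2 * z + 5)%C <> 0 -> locally z (fun w => Gs0 w = Some (Gsf w)).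
Proof. intros H. generalize (locally_pole z H). apply filter_imp. intros w. apply Gs0_fin. Qed.

(** G_* has degree two, so a critical value is taken at the critical point only. *)
Lemma crit_fiber c z : (c * c + 5 * c + 15)%C = 0 -> (2 * z + 5)%C <> 0 ->
  (Gsf z = (c + 3) + (z - c) ^ 2 * / (2 * z + 5))%C.
Proof.
  intros Hc Hz. unfold Gsf. simpl.
  assert (E : (z * (z + 6) = (c + 3) * (2 * z + 5) + (z - c) * (z - c))%C).
  { transitivity ((c + 3) * (2 * z + 5) + (z - c) * (z - c) - (c * c + 5 * c + 15))%C. ring. rewrite Hc. ring. }
  rewrite E. field. trivial.
Qed.

Lemma crit_value_fiber c z : snd c <> 0 -> (c * c + 5 * c + 15)%C = 0 -> Gs0 z = Some (c + 3)%C -> z = c.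
Proof.
  intros Hi Hc E. unfold Gs0, hat_div in E. destruct (Ceq_dec (2 * z + 5) 0) as [K|K]. discriminate.
  assert (E' : Gsf z = (c + 3)%C) by (unfold Gsf; congruence). rewrite (crit_fiber c z Hc K) in E'.
  destruct (Ceq_dec (z - c) 0) as [Z|Z]. now apply Ceq_minus.
  exfalso. apply (Cmult_neq_0 (z - c) (z - c)); trivial.
  transitivity (((c + 3) + (z - c) ^ 2 * / (2 * z + 5) - (c + 3)) * (2 * z + 5))%C.
  simpl. field. trivial. rewrite E'. ring.
Qed.

Lemma crit_multiplicity c : snd c <> 0 -> (c * c + 5 * c + 15)%C = 0 ->
  Gs0 c = Some (c + 3)%C /\ multiplicity Gs0 c 2.
Proof.
  intros Hi Hc. destruct (nonreal_M0 c Hi) as [_ H5].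
  assert (E : Gs0 c = Some (c + 3)%C). { rewrite Gs0_fin by trivial. f_equal. rewrite (crit_fiber c c) by trivial. simpl. ring. }
  split; trivial. split. lia. exists (fun w => / (2 * w + 5))%C. split; [|split].
  - apply cder_holo_at. generalize (locally_pole c H5). apply filter_imp. intros w Hw. eexists. apply cder_inv. trivial. cder_tac.
  - intros K. apply (f_equal (fun y => y * (2 * c + 5))%C) in K. rewrite Cinv_l, Cmult_0_l in K by trivial. apply RtoC_inj in K; lra.
  - rewrite E. generalize (locally_pole c H5). apply filter_imp. intros w Hw. rewrite Gs0_fin by trivial. f_equal. now apply crit_fiber.
Qed.

Lemma crit_min_multiplicity c nu : snd c <> 0 -> (c * c + 5 * c + 15)%C = 0 ->
  min_multiplicity M0 Gs0 (Some (c + 3)%C) nu <-> nu = 2%nat.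
Proof.
  intros Hi Hc. destruct (nonreal_M0 c Hi) as [HM H5]. destruct (crit_multiplicity c Hi Hc) as [E Hm].
  assert (L : forall z m, Gs0 z = Some (c + 3)%C -> multiplicity Gs0 z m -> (2 <= m)%nat).
  { intros z m Ez Hmz. assert (z = c) by now apply crit_value_fiber. subst z.
    apply (multiplicity_derivative Gs0 Gsf c m (dGsf c) (c + 3)%C); trivial. now apply locally_Gs0. now apply cder_Gsf.
    unfold dGsf. rewrite Hc. unfold Cdiv. ring. }
  split.
  - intros [(z & _ & Ez & Hmz) Hmin]. specialize (L z nu Ez Hmz). specialize (Hmin c 2%nat HM E Hm). lia.
  - intros ->. split. exists c. auto. intros z m _. apply L.
Qed.

Lemma C_sqrt z : exists s, (s * s)%C = z.
Proof.
  destruct (Ceq_dec z 0) as [->|H]. exists 0. ring.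
  destruct (cexp_surj z H) as [l Hl]. exists (cexp (l * RtoC (/ 2))). rewrite <- cexp_plus, <- Hl. f_equal. apply C_ext; simpl; field.
Qed.

Lemma Gs0_value z b : (z * (z + 6) = b * (2 * z + 5))%C -> Gs0 z = Some b.
Proof.
  intros H. assert (H5 : (2 * z + 5)%C <> 0).
  { intros E. rewrite E, Cmult_0_r in H. assert (Ez : z = RtoC (-5/2)).
    { apply (f_equal fst) in E as E1; apply (f_equal snd) in E as E2. apply C_ext; simpl in *; lra. }
    rewrite Ez in H. apply (f_equal fst) in H. simpl in H. lra. }
  rewrite Gs0_fin by trivial. f_equal. unfold Gsf. rewrite H. field. trivial.
Qed.

Lemma Gs0_surjective b : exists z, M0 z /\ Gs0 z = b.
Proof.
  destruct b as [b|].
  - destruct (C_sqrt (b * b - b + 9)%C) as [s Hs].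
    set (z := (b - 3 + s)%C).
    assert (Hz : (z * (z + 6) = b * (2 * z + 5))%C).
    { transitivity (b * (2 * z + 5) + (s * s - (b * b - b + 9)))%C. unfold z. ring. rewrite Hs. ring. }
    (* a value taken at an end has a second preimage, which is not an end *)
    assert (Other : forall a y : R, z = RtoC a -> (2 * a + 5) * y * (y + 6) = a * (a + 6) * (2 * y + 5) -> 2 * a + 5 <> 0 ->
      y <> 0 -> y <> 1 -> y <> -2 -> y <> -3/2 -> exists z, M0 z /\ Gs0 z = Some b).
    { intros a y Ea Hy Ha N0 N1 N2 N3. exists (RtoC y). split.
      - repeat split; intros E; apply RtoC_inj in E; lra.
      - apply Gs0_value. rewrite Ea in Hz.
        assert (Hb : b = RtoC (a * (a + 6) / (2 * a + 5))).
        { assert (N : (2 * RtoC a + 5)%C <> 0). { intros E; apply (f_equal fst) in E; simpl in E; lra. }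
          transitivity (b * (2 * RtoC a + 5) / (2 * RtoC a + 5))%C. field; trivial. rewrite <- Hz.
          rewrite RtoC_div, RtoC_mult, !RtoC_plus, RtoC_mult by trivial. reflexivity. }
        rewrite Hb. rewrite <- !RtoC_mult, <- !RtoC_plus, <- !RtoC_mult. f_equal.
        apply Rmult_eq_reg_r with (2 * a + 5); trivial. transitivity ((2 * a + 5) * y * (y + 6)). ring. rewrite Hy. field. trivial. }
    destruct (Ceq_dec z 0) as [E|E0]. { apply (Other 0 (-6)); trivial; lra. }
    destruct (Ceq_dec z 1) as [E|E1]. { apply (Other 1 (-5)); trivial; lra. }
    destruct (Ceq_dec z (RtoC (-2))) as [E|E2]. { apply (Other (-2) (-20)); trivial; lra. }
    destruct (Ceq_dec z (RtoC (-3/2))) as [E|E3]. { apply (Other (-3/2) (-45/4)); trivial; lra. }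
    exists z. split. repeat split; trivial. now apply Gs0_value.
  - exists (RtoC (-5/2)). split. repeat split; intros E; apply RtoC_inj in E; lra.
    unfold Gs0, hat_div. destruct (Ceq_dec (2 * RtoC (-5/2) + 5) 0) as [E|E]; trivial.
    exfalso. apply E. apply C_ext; simpl; lra.
Qed.

(** The pole of G_* at -5/2 lies in M0, and it is simple. *)
Lemma Gs0_pole_simple z m : M0 z -> Gs0 z = None -> multiplicity Gs0 z m -> ~ (2 <= m)%nat.
Proof.
  intros Hz E (Hm & u & Hu & Hu0 & H) Hm2. rewrite E in H.
  assert (Z5 : (2 * z + 5)%C = 0).
  { unfold Gs0, hat_div in E. destruct (Ceq_dec (2 * z + 5) 0); trivial. discriminate. }
  assert (Ez : z = RtoC (-5/2)).
  { apply (f_equal fst) in Z5 as E1; apply (f_equal snd) in Z5 as E2. apply C_ext; simpl in *; lra. }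
  destruct (holo_at_cder u z Hu) as [l Hl]. destruct m as [|[|k]]; try lia.
  assert (D := cder_zero_order z u (S k) l Hl).
  assert (N6 : (z + 6)%C <> 0). { rewrite Ez. intros K; apply (f_equal fst) in K; simpl in K; lra. }
  assert (N0 : z <> 0) by apply Hz.
  assert (D' : cder (fun w => (2 * w + 5) / (w * (w + 6)))%C z (2 / (z * (z + 6)))%C).
  { eapply cder_eq. apply cder_div. now apply Cmult_neq_0. cder_tac. cder_tac. cbv beta.
    transitivity ((2 * (z * (z + 6)) - (2 * z + 5) * (1 * (z + 6) + z * (1 + 0))) / (z * (z + 6) * (z * (z + 6))))%C.
    field; auto. rewrite Z5. field. auto. }
  assert (L6 : locally z (fun w : C => w <> 0 /\ (w + 6)%C <> 0)).
  { apply filter_and; [now apply open_neq_C | apply (locally_neq0 (fun w => w + 6)%C); trivial; cinf_tac]. }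
  assert (K : (0 ^ (S k) * u z = 2 / (z * (z + 6)))%C).
  { apply (cder_unique (fun w => (w - z) ^ (S (S k)) * u w)%C z); trivial. revert D'. apply cder_ext.
    generalize (filter_and _ _ H L6). apply filter_imp. intros w [Hw [W0 W6]].
    set (X := ((w - z) ^ S (S k) * u w)%C) in *. unfold Gs0, hat_div in Hw.
    destruct (Ceq_dec (2 * w + 5) 0) as [A|A], (Ceq_dec X 0) as [B|B]; try discriminate.
    - rewrite A, B. unfold Cdiv. ring.
    - assert (Hw' : (w * (w + 6) / (2 * w + 5) = 1 / X)%C) by congruence.
      transitivity (1 / (1 / X))%C. rewrite <- Hw'. field. auto. field. trivial. }
  simpl in K. rewrite Cmult_0_l, Cmult_0_l in K.
  assert (F : (2 / (z * (z + 6)) * (z * (z + 6)))%C = 2) by (field; auto).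
  rewrite <- K, Cmult_0_l in F. apply RtoC_inj in F. lra.
Qed.

Lemma Gs0_ramified : ramified_number M0 Gs0 1.
Proof.
  exists nil, ((Some (zp + 3)%C, 2%nat) :: (Some (zm + 3)%C, 2%nat) :: nil).
  assert (Hex : forall b, ~ exceptional M0 Gs0 b).
  { intros b H. destruct (Gs0_surjective b) as (z & Hz & E). now apply (H z). }
  assert (Hcrit : forall c, snd c <> 0 -> (c * c + 5 * c + 15)%C = 0 ->
    totally_ramified M0 Gs0 (Some (c + 3)%C) /\ ~ exceptional M0 Gs0 (Some (c + 3)%C) /\ min_multiplicity M0 Gs0 (Some (c + 3)%C) 2).
  { intros c Hi Hc. split; [|split; [apply Hex | now apply crit_min_multiplicity]].
    intros z _ E. assert (z = c) by now apply crit_value_fiber. subst z. exists 2%nat. split; trivial. now apply crit_multiplicity. }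
  split; [|split; [|split; [|split]]].
  - constructor.
  - constructor. 2: constructor; [intros [] | constructor]. intros [E|[]].
    assert (E2 : snd (zm + 3)%C = snd (zp + 3)%C) by congruence. destruct sqrt35. unfold zm, zp in E2. simpl in E2. lra.
  - intros a. split. intros []. intros H. destruct (Hex a H).
  - intros b nu. split.
    + intros [E|[E|[]]]; injection E as <- <-; apply Hcrit. apply zp_im. apply crit_zp. apply zm_im. apply crit_zm.
    + intros (Ht & _ & Hmin). destruct (Gs0_surjective b) as (z & Hz & E). destruct (Ht z Hz E) as (m & Hm & Hmult).
      destruct b as [b|]. 2: destruct (Gs0_pole_simple z m Hz E Hmult Hm).
      assert (H5 : (2 * z + 5)%C <> 0).
      { unfold Gs0, hat_div in E. destruct (Ceq_dec (2 * z + 5) 0); trivial. discriminate. }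
      assert (D : dGsf z = 0).
      { apply (multiplicity_derivative Gs0 Gsf z m (dGsf z) b); trivial. now apply locally_Gs0. now apply cder_Gsf. }
      assert (P : ((z - zp) * (z - zm))%C = 0).
      { rewrite <- crit_factor. transitivity (dGsf z * ((2 * z + 5) * (2 * z + 5)) / 2)%C.
        unfold dGsf. field. exact H5. rewrite D. unfold Cdiv. ring. }
      assert (Hzc : z = zp \/ z = zm).
      { destruct (Ceq_dec (z - zp) 0) as [Z|Z]; [left | right].
        now apply Ceq_minus.
        destruct (Ceq_dec (z - zm) 0) as [Z'|Z']. now apply Ceq_minus.
        destruct (Cmult_neq_0 _ _ Z Z' P). }
      destruct Hzc as [-> | ->].
      * rewrite (proj1 (crit_multiplicity zp zp_im crit_zp)) in E. injection E as <-. left.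
        apply crit_min_multiplicity in Hmin. now rewrite Hmin. apply zp_im. apply crit_zp.
      * rewrite (proj1 (crit_multiplicity zm zm_im crit_zm)) in E. injection E as <-. right. left.
        apply crit_min_multiplicity in Hmin. now rewrite Hmin. apply zm_im. apply crit_zm.
  - simpl. field.
Qed.

(** * Regularity of the ends *)

Lemma regular_finite a : Near a M0 -> regular_end M0 G0 (Some a).
Proof.
  intros N. destruct (Near_punctured _ _ N) as (d & Hd & H). exists (mkposreal _ Hd), (fun w => G0 (a + w)%C). split.
  - intros w _. exists (fun w => (a + w) ^ 3)%C. split. 2: left; apply filter_forall; reflexivity.
    apply cder_holo_at, filter_forall. intros z. eexists. apply cder_pow. cder_tac.
  - intros w Hw. split; [|reflexivity]. apply H. simpl. now replace (a + w - a)%C with w by ring.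
Qed.

Lemma regular_inf : regular_end M0 G0 None.
Proof.
  destruct (Near_punctured _ _ endinf_M0) as (d & Hd & H). exists (mkposreal _ Hd), (fun w => hat_div 1 (w ^ 3)%C). split.
  - intros w _. exists (fun w => w ^ 3)%C. split. 2: right; apply filter_forall; reflexivity.
    apply cder_holo_at, filter_forall. intros z. eexists. apply (cder_pow (fun w => w)), cder_id.
  - intros w Hw. assert (W0 : w <> 0) by (apply Cmod_gt_0; apply Hw). split.
    + apply H. now replace (w - 0)%C with w by ring.
    + unfold hat_div, G0. simpl end_chart. destruct (Ceq_dec (w ^ 3) 0) as [E|E].
      * exfalso. revert E. simpl. repeat apply Cmult_neq_0; trivial. apply RtoC_neq0; lra.
      * f_equal. simpl. field. trivial.
Qed.

Theorem proposition3p6 :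
  exists f n : C -> L4,
    is_flat_front M0 f n /\
    complete_front M0 f /\
    hyperbolic_gauss_maps M0 f n G0 Gs0 /\
    ramified_number M0 G0 2 /\
    ramified_number M0 Gs0 1 /\
    (forall p : Chat, In p ends0 ->
       regular_end M0 G0 p /\ embedded_end M0 f p).
Proof.
  exists (fr 1 1), (fr 1 (-1)).
  split; [apply fr_is_flat_front|]. split; [apply fr_complete|]. split; [apply fr_gauss_maps|].
  split; [apply G0_ramified|]. split; [apply Gs0_ramified|].
  assert (K : forall a, In a (0 :: 1 :: -2 :: -3/2 :: nil) ->
    regular_end M0 G0 (Some (RtoC a)) /\ embedded_end M0 (fr 1 1) (Some (RtoC a))).
  { intros a Ha. split. now apply regular_finite, Near_M0. now apply embed_finite_end. }
  intros p [<-|[<-|[<-|[<-|[<-|[]]]]]]; try (apply K; simpl; tauto).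
  split. apply regular_inf. apply embed_end_inf.
Qed.
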